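(* Let $n\ge 3$. Call a pair $(\ell_0,\ell_1)$ of positive integers admissible if $\gcd(\ell_0,\ell_1)=1$, $\ell_0$ is odd, and $\rho:=\ell_1^2/\ell_0^2\in(0,1/n)$. For an admissible pair let $r,s>0$ be given by $$r^2=\frac{1-n\rho}{n(1-\rho)},\qquad s^2=\frac{n-1}{n(1-\rho)},$$ and define $$F_{\ell_0,\ell_1}:\ \mathbb R/(2\pi\mathbb Z)\times\mathbb S^{n-1}\to\mathbb S^{2n+1}\subset\mathbb C\oplus\mathbb C^n,\qquad F_{\ell_0,\ell_1}(t,x)=\left(re^{i\ell_0t},\,se^{i\ell_1t}x\right),$$ where $x\in\mathbb S^{n-1}\subset\mathbb R^n\subset\mathbb C^n$. Then: (1) For every admissible pair, $F_{\ell_0,\ell_1}$ is a closed connected homogeneous minimal embedding into $\mathbb S^{2n+1}$ (codimension $n+1$), and it is linearly full in $\mathbb S^{2n+1}$. (2) Its fundamental matrix has constant spectrum: at every point the eigenvalues, with multiplicity, are $n(1-n\rho)$ (once), $2n\rho$ (with multiplicity $n-1$), and $0$ (once). In particular $S=n+n(n-2)\rho$ and $Q=n+n^2\rho$. (3) As $(\ell_0,\ell_1)$ ranges over all admissible pairs, the values $Q=n+n^2\rho$ are dense in the interval $(n,2n)$. All the domains have the same topology $\mathbb S^1\times\mathbb S^{n-1}$. (4) For every fixed $q>n+1$, composing the maps $F_{\ell_0,\ell_1}$ with a totally geodesic inclusion $\mathbb S^{2n+1}\hookrightarrow\mathbb S^{n+q}$ preserves all of these conclusions except linear fullness; the additional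 eigenvalues of the fundamental matrix are zero.
   Context: All spheres $\mathbb S^k$ are unit round spheres. For an isometric minimal immersion $F:M^n\to\mathbb S^{n+q}$ (with $M$ carrying the induced metric), $h$ is the second fundamental form in the sphere, and for a normal vector $\xi$ the shape operator $A_\xi$ is defined by $\langle A_\xi X,Y\rangle=\langle h(X,Y),\xi\rangle$. For a local orthonormal normal frame $\nu_1,\dots,\nu_q$ put $A^\alpha=A_{\nu_\alpha}$. The (Lu) fundamental matrix at a point is the $q\times q$ matrix $\mathcal A=(\langle A^\alpha,A^\beta\rangle)_{\alpha,\beta}$ with $\langle U,V\rangle=\operatorname{Tr}(U^TV)$; its eigenvalues, counted with multiplicity, are ordered $\lambda_1\ge\lambda_2\ge\cdots\ge\lambda_q\ge0$ and do not depend on the frame. Set $S=|h|^2=\operatorname{Tr}\mathcal A$ and $Q=S+\lambda_2$. ''Closed'' means compact without boundary. ''Homogeneous'' means that the image is an orbit of a group of isometries of the ambient sphere. ''Linearly full'' in $\mathbb S^{2n+1}$ means that the image is not contained in any proper real linear subspace of the ambient Euclidean space $\mathbb R^{2n+2}=\mathbb C\oplus\mathbb C^n$. *)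

(* Defs.v *)
From HB Require Import structures.
From mathcomp Require Import all_boot all_order all_algebra.
From mathcomp Require Import generic_quotient.
From mathcomp.real_closed Require Import complex.
From mathcomp Require Import all_classical all_reals all_analysis.
From mathcomp Require Import ring.

Set Implicit Arguments.
Unset Strict Implicit.
Unset Printing Implicit Defensive.

Import Order.TTheory GRing.Theory Num.Theory.
Import numFieldNormedType.Exports.

Local Open Scope classical_set_scope.
Local Open Scope ring_scope.

Definition homeomorphic (X Y : topologicalType) : Prop :=
  exists (f : X -> Y) (g : Y -> X),
    [/\ continuous f, continuous g, cancel f g & cancel g f].

(* The norm `|x| of the library on row vectors is the sup norm; the Euclidean
   inner product is used throughout instead. *)
Definition dot {R : realType} {k : nat} (u v : 'rV[R]_k) : R := (u *m v^T) 0 0.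

Definition iter_derive {R : realType} {m k : nat} (vs : seq 'rV[R]_m)
    (f : 'rV[R]_m -> 'rV[R]_k) : 'rV[R]_m -> 'rV[R]_k :=
  foldr (fun v g => 'D_v g) f vs.

(* C^oo on an open set U: all iterated directional derivatives exist and are
   (Frechet) differentiable, hence also continuous. *)
Definition smooth_on {R : realType} {m k : nat} (U : set 'rV[R]_m)
    (f : 'rV[R]_m -> 'rV[R]_k) : Prop :=
  forall (vs : seq 'rV[R]_m) (u : 'rV[R]_m),
    U u -> differentiable (iter_derive vs f) u.

(* The values of pmap outside dom are irrelevant. *)
Record param (R : realType) (m : nat) (M : Type) := Param {
  dom : set 'rV[R]_m;
  pmap :> 'rV[R]_m -> M }.

Definition atlas (R : realType) (m : nat) (M : Type) := set (param R m M).

Definition manifold {R : realType} {m : nat} {M : topologicalType}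
    (A : atlas R m M) : Prop :=
  [/\ hausdorff_space M /\ @second_countable M,
      forall c, A c ->
        [/\ open (dom c),
            {in dom c &, injective c},
            {within dom c, continuous c} &
            forall O, open O -> O `<=` dom c -> open (c @` O)],
      forall p, exists c u, [/\ A c, dom c u & c u = p] &
      forall c1 c2 (tau : 'rV[R]_m -> 'rV[R]_m), A c1 -> A c2 ->
        let W := [set u | dom c1 u /\ (c2 @` dom c2) (c1 u)] in
        (forall u, W u -> dom c2 (tau u) /\ c2 (tau u) = c1 u) ->
        smooth_on W tau].

(* Charts take values in open subsets of R^m, so there is no boundary. *)
Definition closed_connected_manifold {R : realType} {m : nat}
    {M : topologicalType} (A : atlas R m M) : Prop :=
  [/\ manifold A, compact [set: M] & connected [set: M]].

Definition smooth_map {R : realType} {m N : nat} {M : Type} (A : atlas R m M)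
    (F : M -> 'rV[R]_N) : Prop :=
  forall c, A c -> smooth_on (dom c) (F \o c).

Definition immersion {R : realType} {m N : nat} {M : Type} (A : atlas R m M)
    (F : M -> 'rV[R]_N) : Prop :=
  smooth_map A F /\
  forall c u, A c -> dom c u -> row_free ('J (F \o c) u).

Definition embedding {R : realType} {m N : nat} {M : topologicalType}
    (A : atlas R m M) (F : M -> 'rV[R]_N) : Prop :=
  [/\ immersion A F, injective F, continuous F &
      forall O : set M, open O ->
        exists2 V : set 'rV[R]_N, open V & F @` O = range F `&` V].

(* In what follows phi : R^m -> R^N is a local expression of an immersion into the unit sphere
   of R^N.  A tangent vector at u is represented by its coordinates
   X : 'rV_m; the vector of R^N it stands for is 'D_X phi u. *)

Definition gram {R : realType} {m N : nat} (phi : 'rV[R]_m -> 'rV[R]_N)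
    (u : 'rV[R]_m) : 'M[R]_m :=
  'J phi u *m ('J phi u)^T.

(* The rows span the position vector and the tangent space, that is, the
   orthogonal in R^N of the normal space of the submanifold in the sphere. *)
Definition tangent_cone {R : realType} {m N : nat}
    (phi : 'rV[R]_m -> 'rV[R]_N) (u : 'rV[R]_m) : 'M[R]_(1 + m, N) :=
  col_mx (phi u) ('J phi u).

Definition normal_space {R : realType} {m N : nat}
    (phi : 'rV[R]_m -> 'rV[R]_N) (u : 'rV[R]_m) : 'M[R]_N :=
  kermx (tangent_cone phi u)^T.

Definition normal_proj {R : realType} {m N : nat}
    (phi : 'rV[R]_m -> 'rV[R]_N) (u : 'rV[R]_m) : 'M[R]_N :=
  proj_mx (normal_space phi u) <<tangent_cone phi u>>%MS.

(* Gauss formula: h(X, Y) is the normal part of the Euclidean derivative along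
   X of the vector field with constant coordinates Y. *)
Definition second_ff {R : realType} {m N : nat} (phi : 'rV[R]_m -> 'rV[R]_N)
    (u X Y : 'rV[R]_m) : 'rV[R]_N :=
  'D_X ('D_Y phi) u *m normal_proj phi u.

Definition mean_curvature {R : realType} {m N : nat}
    (phi : 'rV[R]_m -> 'rV[R]_N) (u : 'rV[R]_m) : 'rV[R]_N :=
  \sum_(i < m) \sum_(j < m)
    invmx (gram phi u) i j *:
      second_ff phi u (delta_mx 0 i) (delta_mx 0 j).

Definition tangent_frame {R : realType} {m N : nat}
    (phi : 'rV[R]_m -> 'rV[R]_N) (u : 'rV[R]_m) (E : 'M[R]_m) : Prop :=
  E *m gram phi u *m E^T = 1%:M.

(* The rows of nu form an orthonormal basis of the normal space; in particular
   q is the codimension. *)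
Definition normal_frame {R : realType} {m N q : nat}
    (phi : 'rV[R]_m -> 'rV[R]_N) (u : 'rV[R]_m) (nu : 'M[R]_(q, N)) : Prop :=
  nu *m nu^T = 1%:M /\ (nu == normal_space phi u)%MS.

(* Matrix, in the orthonormal tangent frame E, of the shape operator A_xi
   defined by <A_xi X, Y> = <h(X, Y), xi>. *)
Definition shape_mx {R : realType} {m N : nat} (phi : 'rV[R]_m -> 'rV[R]_N)
    (u : 'rV[R]_m) (E : 'M[R]_m) (xi : 'rV[R]_N) : 'M[R]_m :=
  \matrix_(a, b) dot (second_ff phi u (row a E) (row b E)) xi.

Definition fundamental_mx {R : realType} {m N q : nat}
    (phi : 'rV[R]_m -> 'rV[R]_N) (u : 'rV[R]_m) (E : 'M[R]_m)
    (nu : 'M[R]_(q, N)) : 'M[R]_q :=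
  \matrix_(a, b) \tr ((shape_mx phi u E (row a nu))^T *m
                      shape_mx phi u E (row b nu)).

Definition minimal {R : realType} {m N : nat} {M : Type} (A : atlas R m M)
    (F : M -> 'rV[R]_N) : Prop :=
  forall c u, A c -> dom c u -> mean_curvature (F \o c) u = 0.

Definition minimal_embedding {R : realType} {m N : nat} {M : topologicalType}
    (A : atlas R m M) (F : M -> 'rV[R]_N) : Prop :=
  [/\ forall p, dot (F p) (F p) = 1, embedding A F & minimal A F].

(* B is the fundamental matrix of F at p with respect to some chart and some
   orthonormal frames. *)
Definition is_fundamental_mx {R : realType} {m N q : nat} {M : Type}
    (A : atlas R m M) (F : M -> 'rV[R]_N) (p : M) (B : 'M[R]_q) : Prop :=
  exists (c : param R m M) (u : 'rV[R]_m) (E : 'M[R]_m) (nu : 'M[R]_(q, N)),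
    [/\ A c, dom c u & c u = p] /\
    [/\ tangent_frame (F \o c) u E, normal_frame (F \o c) u nu &
        B = fundamental_mx (F \o c) u E nu].

Definition ordered_eigenvalues {R : realType} {q : nat} (B : 'M[R]_q)
    (s : seq R) : Prop :=
  sorted >=%R s /\ char_poly B = \prod_(a <- s) ('X - a%:P).

(* y is S + lambda_2 at p; the list s is indexed from 0. *)
Definition is_Q {R : realType} {m N : nat} (q : nat) {M : Type}
    (A : atlas R m M) (F : M -> 'rV[R]_N) (p : M) (y : R) : Prop :=
  exists (B : 'M[R]_q) (s : seq R),
    [/\ is_fundamental_mx A F p B, ordered_eigenvalues B s &
        y = \tr B + s`_1].

Definition linearly_full {R : realType} {N : nat} {M : Type}
    (F : M -> 'rV[R]_N) : Prop :=
  forall V : {vspace 'rV[R]_N}, (forall p, F p \in V) -> V = fullv.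

Definition unit_sphere (R : realType) (k : nat) : set 'rV[R]_k :=
  [set x | dot x x = 1].

Definition sphere (R : realType) (k : nat) : topologicalType :=
  set_type (@unit_sphere R k).

Definition spt {R : realType} {k : nat} (x : sphere R k) : 'rV[R]_k := val x.

(* The graph of +- sqrt (1 - |u|^2) over the i-th coordinate hyperplane. *)
Definition hemisphere {R : realType} {k : nat} (i : 'I_k) (b : bool)
    (u : 'rV[R]_k.-1) : 'rV[R]_k :=
  \row_j (if unlift i j is Some j' then u 0 j'
          else (-1) ^+ b * Num.sqrt (1 - dot u u)).

Definition sphere_atlas (R : realType) (k : nat) :
    atlas R k.-1 (sphere R k) :=
  [set c | dom c = [set u | dot u u < 1] /\
           exists (i : 'I_k) (b : bool),
             forall u, dom c u -> spt (c u) = hemisphere i b u].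

Arguments sphere_atlas : clear implicits.

Definition riemannian_map {R : realType} {k N : nat}
    (f : sphere R k -> 'rV[R]_N) : Prop :=
  smooth_map (sphere_atlas R k) f /\
  forall c u, sphere_atlas R k c -> dom c u ->
    gram (f \o c) u = gram (spt \o c) u.

Definition sphere_isometry {R : realType} {k : nat}
    (g : sphere R k -> sphere R k) : Prop :=
  bijective g /\ riemannian_map (spt \o g).

Definition sphere_isometry_group {R : realType} {k : nat}
    (G : set (sphere R k -> sphere R k)) : Prop :=
  [/\ forall g, G g -> sphere_isometry g,
      G id,
      forall g1 g2, G g1 -> G g2 -> G (g1 \o g2) &
      forall g, G g -> exists g', [/\ G g', cancel g g' & cancel g' g]].

Definition homogeneous {R : realType} {N : nat} {M : Type}
    (F : M -> 'rV[R]_N) : Prop :=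
  exists (G : set (sphere R N -> sphere R N)) (y : sphere R N),
    sphere_isometry_group G /\ range F = [set spt (g y) | g in G].

(* iota is a map between the ambient Euclidean spaces of which only the
   restriction to the unit sphere matters. *)
Definition totally_geodesic_inclusion {R : realType} {k N : nat}
    (iota : 'rV[R]_k -> 'rV[R]_N) : Prop :=
  let f : sphere R k -> 'rV[R]_N := iota \o spt in
  [/\ forall x, dot (f x) (f x) = 1,
      embedding (sphere_atlas R k) f,
      riemannian_map f &
      forall c u X Y, sphere_atlas R k c -> dom c u ->
        second_ff (f \o c) u X Y = 0].

Definition circle_eq {R : realType} : rel R :=
  fun t t' => (t - t') / (2 * pi) \is a Num.int.

Lemma circle_eq_refl {R : realType} : reflexive (@circle_eq R).
Proof. by move=> t; rewrite /circle_eq subrr mul0r rpred0. Qed.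

Lemma circle_eq_sym {R : realType} : symmetric (@circle_eq R).
Proof. by move=> t t'; rewrite /circle_eq -opprB mulNr rpredN. Qed.

Lemma circle_eq_trans {R : realType} : transitive (@circle_eq R).
Proof.
move=> t2 t1 t3; rewrite /circle_eq => h12 h23.
by rewrite -(subrK t2 t1) -addrA mulrDl rpredD.
Qed.

Canonical circle_equiv (R : realType) :=
  EquivRel (@circle_eq R) circle_eq_refl circle_eq_sym circle_eq_trans.

Definition circle (R : realType) : topologicalType :=
  quotient_topology {eq_quot (circle_equiv R)}%qT.

Definition circle_pi {R : realType} (t : R) : circle R :=
  (\pi_({eq_quot (circle_equiv R)}%qT) t)%qT.

Definition circle_repr {R : realType} (z : circle R) : R :=
  repr (z : {eq_quot (circle_equiv R)}%qT).

Definition circle_atlas (R : realType) : atlas R 1 (circle R) :=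
  [set c | exists a : R,
     dom c = [set u | a < u 0 0 < a + 2 * pi] /\
     forall u, dom c u -> c u = circle_pi (u 0 0)].

Arguments circle_atlas : clear implicits.

Definition product_atlas {R : realType} {m1 m2 : nat} {M1 M2 : Type}
    (A1 : atlas R m1 M1) (A2 : atlas R m2 M2) :
    atlas R (m1 + m2) (M1 * M2)%type :=
  [set c | exists c1 c2, [/\ A1 c1, A2 c2 &
     c = Param [set u | dom c1 (lsubmx u) /\ dom c2 (rsubmx u)]
               (fun u => (c1 (lsubmx u), c2 (rsubmx u)))]].

Definition domainF (R : realType) (n : nat) : topologicalType :=
  (circle R * sphere R n)%type.

Definition domainF_atlas (R : realType) (n : nat) :
    atlas R (1 + n.-1) (domainF R n) :=
  product_atlas (circle_atlas R) (sphere_atlas R n).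

Arguments domainF_atlas : clear implicits.

Definition rho (R : realType) (l0 l1 : nat) : R := l1%:R ^+ 2 / l0%:R ^+ 2.

Definition admissible (R : realType) (n l0 l1 : nat) : Prop :=
  [/\ (0 < l0)%N /\ (0 < l1)%N, coprime l0 l1, odd l0 &
      0 < rho R l0 l1 < n%:R^-1].

Definition radius_r (R : realType) (n l0 l1 : nat) : R :=
  Num.sqrt ((1 - n%:R * rho R l0 l1) / (n%:R * (1 - rho R l0 l1))).

Definition radius_s (R : realType) (n l0 l1 : nat) : R :=
  Num.sqrt ((n%:R - 1) / (n%:R * (1 - rho R l0 l1))).

Definition cis {R : realType} (t : R) : R[i] := (cos t +i* sin t)%C.

(* C^k = R^(2 k), real parts first. *)
Definition realify {R : realType} {k : nat} (z : 'rV[R[i]]_k) :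
    'rV[R]_(k + k) :=
  row_mx (map_mx (@complex.Re R) z) (map_mx (@complex.Im R) z).

Definition F_formula {R : realType} {n : nat} (l0 l1 : nat) (t : R)
    (x : 'rV[R]_n) : 'rV[R[i]]_(1 + n) :=
  row_mx ((radius_r R n l0 l1)%:C%C * cis (l0%:R * t))%:M
         (((radius_s R n l0 l1)%:C%C * cis (l1%:R * t)) *:
            map_mx (real_complex R) x).

Definition F {R : realType} {n : nat} (l0 l1 : nat) (p : domainF R n) :
    'rV[R]_((1 + n) + (1 + n)) :=
  realify (F_formula l0 l1 (circle_repr p.1) (spt p.2)).

Lemma cis_periodic {R : realType} (l : nat) (t t' : R) :
  circle_eq t t' -> cis (l%:R * t) = cis (l%:R * t').
Proof.
move=> /intrP[k hk].
have pi2 : 2 * pi != 0 :> R by rewrite mulf_neq0 ?pnatr_eq0 ?gt_eqF ?pi_gt0.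
have -> : t = t' + k%:~R * (2 * pi) by rewrite -hk divfK // addrC subrK.
have per (a : R) (j : nat) : cis (a + j%:R * (2 * pi)) = cis a.
  elim: j => [|j IHj]; first by rewrite mul0r addr0.
  rewrite -natr1 mulrDl mul1r addrA -IHj; set b := a + _.
  rewrite /cis (mulr_natl pi 2) (cosD b) (sinD b) cos2pi sin2pi.
  by rewrite !mulr0 !mulr1 subr0 addr0.
case: k {hk} => k; first by rewrite mulrDr mulrA -natrM per.
rewrite NegzE mulrNz -[LHS](per _ (l * k.+1)%N).
by congr cis; rewrite natrM; ring.
Qed.

(* F is well defined on the quotient: it does not depend on representatives. *)
Lemma FE {R : realType} {n : nat} (l0 l1 : nat) (t : R) (x : sphere R n) :
  F l0 l1 (circle_pi t, x) = realify (F_formula l0 l1 t (spt x)).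
Proof.
have h : circle_eq (circle_repr (circle_pi t)) t.
  by have /eqmodP := reprK (\pi_{eq_quot (circle_equiv R)}%qT t)%qT.
by rewrite /F /F_formula /= !(cis_periodic _ h).
Qed.

(* All values of Q on the immersions G l0 l1, (l0, l1) admissible, viewed as
   immersions of codimension q. *)
Definition Q_values {R : realType} {n N : nat} (q : nat)
    (G : nat -> nat -> domainF R n -> 'rV[R]_N) : set R :=
  [set y | exists l0 l1, admissible R n l0 l1 /\
     exists p, is_Q q (domainF_atlas R n) (G l0 l1) p y].

(* At every point the fundamental matrix exists, is of size q, and whatever the
   frames its eigenvalues are the entries of spec, its trace is S and
   S + lambda_2 is Q. *)
Definition constant_spectrum {R : realType} {m N : nat} (q : nat) {M : Type}
    (A : atlas R m M) (F : M -> 'rV[R]_N) (spec : seq R) (S Q : R) : Prop :=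
  forall p,
    (exists B : 'M[R]_q, is_fundamental_mx A F p B) /\
    forall B : 'M[R]_q, is_fundamental_mx A F p B ->
      exists s, [/\ ordered_eigenvalues B s, perm_eq s spec,
                    \tr B = S & \tr B + s`_1 = Q].

Definition dense_in {R : realType} (D I : set R) : Prop :=
  D `<=` I /\ I `<=` closure D.

(* Main.v *)
Require Import Defs.
From HB Require Import structures.
From mathcomp Require Import all_boot all_order all_algebra.
From mathcomp.real_closed Require Import complex.
From mathcomp Require Import all_classical all_reals all_analysis.
From mathcomp Require Import ring lra.

Set Implicit Arguments.
Unset Strict Implicit.
Unset Printing Implicit Defensive.

Import Order.TTheory GRing.Theory Num.Theory.
Import numFieldNormedType.Exports.

Local Open Scope classical_set_scope.
Local Open Scope ring_scope.

(* By rigidity of totally geodesic round spheres, every totally geodesic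
   inclusion of the unit sphere is the restriction of a linear map v |-> v L
   with L L^T = 1.  Hence all the conclusions concern the maps F L (with L = 1
   for F itself), which in the charts of the domain have the form
     phi(t, u) = r P0(l0 t) + s x(u) P(l1 t),
   where x is a chart of the sphere by the graph of a height function, P0
   rotates in the plane spanned by two orthonormal vectors a, b, and P rotates
   between two orthonormal n-frames A, B.  The normal space contains
   s P0 - r x P and the vectors y Q, with y orthogonal to x and Q the
   derivative of P, and is spanned by them and one more direction.  The second fundamental form only takes the values
     h(T, T) = multiple of s P0 - r x P,  h(T, X) = multiple of X Q,
     h(X, Y) = <X, Y> multiple of s P0 - r x P
   on an orthonormal tangent frame (T, X_1, ..., X_(n-1)); minimality is the
   vanishing of one scalar, and the fundamental matrix is diagonal in the
   corresponding orthonormal family of n normal vectors and vanishes on their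
   orthogonal. *)

(** * Directional derivatives and smoothness *)

(** Each arithmetic hypothesis has a definite place. Minimality requires the n - 1 sphere
    directions, each contributing r/s along s P0 - r x P, to cancel the direction T. This is a
    linear equation in r^2 and s^2; together with r^2 + s^2 = 1 it yields the stated radii, which
    are positive because rho < 1/n. Equal values at (t, x) and (t', x') give l0 (t - t') in 2 pi Z,
    but only l1 (t - t') in pi Z, since x' may be - x; injectivity therefore asks that l0 be prime
    to 2 l1. The two nonzero eigenvalues come in either order, depending on the position of rho with
    respect to 1/(n + 2); lambda_2 is 2 n rho in both cases because this eigenvalue has multiplicity
    n - 1 >= 2. A totally geodesic inclusion is given by conditions in charts and is arbitrary off
    the sphere, so its linearity has to be derived. In a graph chart with round metric g the
    conditions become D_X D_Y phi = g(X, Y) (D_u phi - phi), which is integrated explicitly on each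
    half sphere; the resulting linear maps are then matched on overlaps. *)

Lemma differentiable_near_eq {K : numFieldType} {V W : normedModType K}
    (f g : V -> W) (x : V) :
  {near x, f =1 g} -> differentiable f x -> differentiable g x.
Proof.
move=> fg df; have dfc := diff_continuous df.
have fgx := nbhs_singleton fg.
have gE : g \o shift x = cst (g x) + 'd f x +o_ 0 id.
  apply/eqaddoP => e e0; have /eqaddoP/(_ e e0) := diff_locally df.
  have : \forall h \near (0 : V), f (h + x) = g (h + x).
    by have := fg; rewrite (near_shift 0 x) /=; apply: filterS => h; rewrite /= subr0.
  by apply: filterS2 => h; rewrite !fctE /= fgx => ->.
by apply/diff_locallyP; rewrite (diff_unique dfc gE).
Qed.

Section Products.
Context {R : realFieldType} {V : normedModType R}.

Lemma is_derive_mxP {m n} (M : V -> 'M[R]_(m, n)) (t v : V) (dM : 'M[R]_(m, n)) :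
  is_derive t v M dM <->
  forall i j, is_derive t v (fun x => M x i j) (dM i j).
Proof.
split=> [[dv <-] i j|H].
  rewrite derive_mx // mxE; apply/derivableP.
  by have /derivable_mxP := dv.
have dv : derivable M t v by apply/derivable_mxP => i j; apply: ex_derive.
split=> //; rewrite derive_mx //; apply/matrixP => i j; rewrite mxE.
exact: derive_val.
Qed.

Lemma is_derive_mulmx {m n p} (M : V -> 'M[R]_(m, n)) (N : V -> 'M[R]_(n, p))
    (t v : V) dM dN :
  is_derive t v M dM -> is_derive t v N dN ->
  is_derive t v (fun x => M x *m N x) (dM *m N t + M t *m dN).
Proof.
move=> /is_derive_mxP hM /is_derive_mxP hN; apply/is_derive_mxP => i j.
have -> : (fun x => (M x *m N x) i j) =
    \sum_k ((fun x => M x i k) * (fun x => N x k j)).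
  by apply/funext => x; rewrite mxE fct_sumE.
rewrite !mxE -big_split /=.
have := @is_derive_sum _ _ _ n (fun k => (fun x => M x i k) * (fun x => N x k j))
  t v (fun k => dM i k * N t k j + M t i k * dN k j).
apply => k; have H := is_deriveM (hM i k) (hN k j).
by apply: (is_derive_eq H); rewrite /GRing.scale /= addrC mulrC.
Qed.

Lemma is_derive_mulmxr {m n p} (M : V -> 'M[R]_(m, n)) (N : 'M[R]_(n, p))
    (t v : V) dM :
  is_derive t v M dM -> is_derive t v (fun x => M x *m N) (dM *m N).
Proof.
move=> hM; apply: is_derive_eq.
  exact: (is_derive_mulmx hM (is_derive_cst N t v)).
by rewrite mulmx0 addr0.
Qed.

Lemma is_derive_scale {m n} (f : V -> R) (M : V -> 'M[R]_(m, n)) (t v : V) df dM :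
  is_derive t v f df -> is_derive t v M dM ->
  is_derive t v (fun x => f x *: M x) (df *: M t + f t *: dM).
Proof.
move=> hf /is_derive_mxP hM; apply/is_derive_mxP => i j.
have -> : (fun x => (f x *: M x) i j) = f * (fun x => M x i j).
  by apply/funext => x; rewrite mxE.
have H := is_deriveM hf (hM i j).
by apply: (is_derive_eq H); rewrite !mxE /GRing.scale /= addrC (mulrC df).
Qed.

Lemma is_derive_entry {m n} (M : V -> 'M[R]_(m, n)) (t v : V) dM i j :
  is_derive t v M dM -> is_derive t v (fun x => M x i j) (dM i j).
Proof. by move/is_derive_mxP. Qed.

Lemma is_derive_trmx {m n} (M : V -> 'M[R]_(m, n)) (t v : V) dM :
  is_derive t v M dM -> is_derive t v (fun x => (M x)^T) dM^T.
Proof.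
move=> /is_derive_mxP hM; apply/is_derive_mxP => i j; rewrite mxE.
suff -> : (fun x => (M x)^T i j) = (fun x => M x j i) by [].
by apply/funext => x; rewrite mxE.
Qed.

(** By linearity of [l], the difference quotients of [f \o l] at [t] along [v] and of [f] at [l t]
    along [l v] are the same function. *)
Lemma is_derive_inner_linear {U W : normedModType R} (l : {linear U -> V})
    (f : V -> W) (t v : U) df :
  is_derive (l t) (l v) f df -> is_derive t v (f \o l) df.
Proof.
move=> [h1 h2].
have E : (fun h => h^-1 *: (((f \o l) \o shift t) (h *: v) - (f \o l) t))
   = (fun h => h^-1 *: ((f \o shift (l t)) (h *: l v) - f (l t))).
  by apply/funext => h /=; rewrite (linearP l).
by split; rewrite /derivable /derive E.
Qed.

End Products.

Lemma is_derive_comp1 {R : realFieldType} {V : normedModType R} (f : V -> R)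
    (h : R -> R) (t v : V) df dh :
  differentiable f t -> is_derive t v f df -> is_derive (f t) 1 h dh ->
  differentiable (h \o f) t /\ is_derive t v (h \o f) (dh * df).
Proof.
move=> Df [_ hf] [h1 h2].
have Dh : differentiable h (f t) by apply/derivable1_diffP.
have D : differentiable (h \o f) t by exact: differentiable_comp.
split=> //; split; first exact: diff_derivable.
rewrite deriveE // diff_comp //= -(deriveE _ Df) hf.
have -> : 'd h (f t) df = df *: 'd h (f t) 1.
  by rewrite -linearZ; congr ('d h (f t) _); rewrite /GRing.scale /= mulr1.
by rewrite -deriveE // h2 /GRing.scale /= mulrC.
Qed.

(* C^k by recursion on directional derivatives.  Unlike smooth_on, it is closed
   under products and composition by a direct induction on k. *)
Fixpoint Cn {R : realType} {m : nat} {W : normedModType R} (k : nat)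
    (U : set 'rV[R]_m) (f : 'rV[R]_m -> W) : Prop :=
  (forall u, U u -> differentiable f u) /\
  (if k is k'.+1 then forall v, Cn k' U ('D_v f) else True).

Section Cn.
Context {R : realType} {m : nat}.
Implicit Types (U : set 'rV[R]_m).

Lemma Cn_diff {W : normedModType R} k U (f : 'rV[R]_m -> W) u :
  Cn k U f -> U u -> differentiable f u.
Proof. by case: k => [|k] [] + _; apply. Qed.

Lemma Cn_derive {W : normedModType R} k U (f : 'rV[R]_m -> W) u v :
  Cn k U f -> U u -> is_derive u v f ('D_v f u).
Proof. by move=> fU Uu; apply/derivableP/diff_derivable/(Cn_diff fU Uu). Qed.

Lemma CnW {W : normedModType R} k U (f : 'rV[R]_m -> W) : Cn k.+1 U f -> Cn k U f.
Proof.
elim: k f => [|k IH] f /=; first by case.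
by move=> [df Df]; split=> // v; apply: IH.
Qed.

Lemma Cn_sub {W : normedModType R} k U U' (f : 'rV[R]_m -> W) :
  U' `<=` U -> Cn k U f -> Cn k U' f.
Proof.
move=> UU; elim: k f => [|k IH] f /= [df Df]; split=> //; [by move=> u /UU /df|by move=> u /UU /df|].
by move=> v; apply: IH.
Qed.

Lemma open_near_eq {W : Type} U (f g : 'rV[R]_m -> W) u :
  open U -> (forall u, U u -> f u = g u) -> U u -> {near u, f =1 g}.
Proof.
move=> oU fg Uu; have := open_nbhs_nbhs (conj oU Uu).
by apply: filterS => x /fg.
Qed.

Lemma derive_ext {W : normedModType R} U (f g : 'rV[R]_m -> W) u v :
  open U -> (forall u, U u -> f u = g u) -> U u -> 'D_v f u = 'D_v g u.
Proof. by move=> oU fg Uu; apply/near_eq_derive/(open_near_eq oU fg Uu). Qed.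

Lemma Cn_ext {W : normedModType R} k U (f g : 'rV[R]_m -> W) :
  open U -> (forall u, U u -> f u = g u) -> Cn k U f -> Cn k U g.
Proof.
move=> oU; elim: k f g => [|k IH] f g fg /= [df Df]; split=> //.
- by move=> u Uu; apply: differentiable_near_eq (df u Uu); apply: (open_near_eq oU).
- by move=> u Uu; apply: differentiable_near_eq (df u Uu); apply: (open_near_eq oU).
by move=> v; apply: IH (Df v) => u Uu; exact: (derive_ext v oU fg Uu).
Qed.

(** The rules of differentiation compute ['D_v f] only at points of [U], so the derivative is
    allowed to be any function with the right values there. *)
Lemma CnS {W : normedModType R} k U (f : 'rV[R]_m -> W) : open U ->
  (forall u, U u -> differentiable f u) ->
  (forall v, exists2 f', Cn k U f' & forall u, U u -> 'D_v f u = f' u) ->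
  Cn k.+1 U f.
Proof.
move=> oU df Df; split=> // v; have [f' Cf' ff'] := Df v.
by apply: Cn_ext Cf' => // u Uu; rewrite ff'.
Qed.

Lemma Cn_cst {W : normedModType R} k U (a : W) : Cn k U (cst a).
Proof.
elim: k a => [|k IH] a; first by split.
split=> // v; suff -> : 'D_v (cst a) = cst 0 by exact: IH.
by apply/funext => u; rewrite derive_cst.
Qed.

Lemma CnD {W : normedModType R} k U (f g : 'rV[R]_m -> W) : open U ->
  Cn k U f -> Cn k U g -> Cn k U (f \+ g).
Proof.
move=> oU; elim: k f g => [|k IH] f g Cf Cg.
  by split=> // u Uu; apply: differentiableD; [apply: Cn_diff Cf Uu|apply: Cn_diff Cg Uu].
apply: CnS => // [u Uu|v].
  by apply: differentiableD; [apply: Cn_diff Cf Uu|apply: Cn_diff Cg Uu].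
exists ('D_v f \+ 'D_v g); first by apply: IH; [apply: Cf.2|apply: Cg.2].
by move=> u Uu; apply: (@derive_val _ _ _ _ _ (f + g)); apply: is_deriveD; apply: Cn_derive Uu; eassumption.
Qed.

Lemma Cn_sum {W : normedModType R} k U n (f : 'I_n -> 'rV[R]_m -> W) : open U ->
  (forall i, Cn k U (f i)) -> Cn k U (fun u => \sum_i f i u).
Proof.
move=> oU Cf; rewrite -fct_sumE; elim/big_ind: _ => //; first exact: Cn_cst.
by move=> ? ?; apply: CnD.
Qed.

Lemma CnM k U (f g : 'rV[R]_m -> R) : open U ->
  Cn k U f -> Cn k U g -> Cn k U (fun u => f u * g u).
Proof.
move=> oU; elim: k f g => [|k IH] f g Cf Cg.
  by split=> // u Uu; apply: (@differentiableM _ _ f g); [apply: Cn_diff Cf Uu|apply: Cn_diff Cg Uu].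
apply: CnS => // [u Uu|v].
  by apply: (@differentiableM _ _ f g); [apply: Cn_diff Cf Uu|apply: Cn_diff Cg Uu].
exists ((fun u => f u * 'D_v g u) \+ (fun u => g u * 'D_v f u)).
  by apply: CnD => //; apply: IH (CnW _) _ => //; [apply: Cg.2|apply: Cf.2].
move=> u Uu; apply: (@derive_val _ _ _ _ _ (f * g)).
by apply: is_deriveM; apply: Cn_derive Uu; eassumption.
Qed.

Lemma CnZ k U (c : R) (f : 'rV[R]_m -> R) : open U ->
  Cn k U f -> Cn k U (fun u => c * f u).
Proof. by move=> oU; apply: CnM => //; apply: Cn_cst. Qed.

Lemma is_derive_coord (u v : 'rV[R]_m) i j :
  is_derive u v (fun u : 'rV[R]_m => u i j) (v i j).
Proof. exact: is_derive_entry (is_derive_id u v). Qed.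

Lemma Cn_coord k U i j : open U -> Cn k U (fun u : 'rV[R]_m => u i j).
Proof.
move=> oU; case: k => [|k]; first by split=> // u _; exact: differentiable_coord.
apply: CnS => // [u _|v]; first exact: differentiable_coord.
exists (cst (v i j)); first exact: Cn_cst.
by move=> u Uu; apply: derive_val; exact: is_derive_coord.
Qed.

(** [h] is a whole sequence of successive derivatives, so that the induction on [k] can pass from
    [h] to its shift. The phase shifts of the cosine and the real powers with falling factorial
    coefficients are such sequences. *)
Lemma Cn_comp k U (f : 'rV[R]_m -> R) (P : set R) (h : nat -> R -> R) : open U ->
  (forall j x, P x -> is_derive x 1 (h j) (h j.+1 x)) ->
  (forall u, U u -> P (f u)) -> Cn k U f -> Cn k U (h 0%N \o f).
Proof.
move=> oU hd fP; elim: k h hd => [|k IH] h hd Cf.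
  split=> // u Uu.
  by have [] := is_derive_comp1 (Cn_diff Cf Uu) (Cn_derive 0 Cf Uu) (hd 0%N _ (fP _ Uu)).
apply: CnS => // [u Uu|v].
  by have [] := is_derive_comp1 (Cn_diff Cf Uu) (Cn_derive 0 Cf Uu) (hd 0%N _ (fP _ Uu)).
exists (fun u => h 1%N (f u) * 'D_v f u).
  apply: CnM; [by []| |exact: Cf.2].
  by apply: (IH (fun j => h j.+1)) (CnW Cf) => j x; apply: hd.
move=> u Uu; apply: derive_val.
by have [] := is_derive_comp1 (Cn_diff Cf Uu) (Cn_derive v Cf Uu) (hd 0%N _ (fP _ Uu)).
Qed.

Lemma Cn_cos k U (f : 'rV[R]_m -> R) : open U -> Cn k U f ->
  Cn k U (fun u => cos (f u)).
Proof.
move=> oU; pose h j x : R := cos (x + j%:R * (pi / 2)).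
have -> : (fun u => cos (f u)) = h 0%N \o f.
  by apply/funext => u; rewrite /h /= mul0r addr0.
apply: (@Cn_comp _ _ _ setT) => // j x _.
have -> : h j.+1 x = - sin (x + j%:R * (pi / 2)).
  by rewrite /h -natr1 mulrDl mul1r addrA cosDpihalf.
have H1 : is_derive x 1 (fun x : R => x + j%:R * (pi / 2)) (1 + 0).
  exact: (is_deriveD (is_derive_id _ _) (is_derive_cst _ _ _)).
have H := @is_derive1_comp _ (@cos R) _ _ _ _ (is_derive_cos _) H1.
by apply: (is_derive_eq H); rewrite addr0 mulr1.
Qed.

Lemma Cn_sin k U (f : 'rV[R]_m -> R) : open U -> Cn k U f ->
  Cn k U (fun u => sin (f u)).
Proof.
move=> oU Cf; have -> : (fun u => sin (f u)) = (fun u => cos (f u - pi / 2)).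
  by apply/funext => u; rewrite cosBpihalf.
by apply: Cn_cos => //; apply: CnD => //; apply: Cn_cst.
Qed.

Lemma Cn_sqrt k U (f : 'rV[R]_m -> R) : open U -> (forall u, U u -> 0 < f u) ->
  Cn k U f -> Cn k U (fun u => Num.sqrt (f u)).
Proof.
move=> oU f0 Cf; pose c j : R := \prod_(i < j) (2^-1 - i%:R).
pose h j x : R := c j * x `^ (2^-1 - j%:R).
apply: (@Cn_ext _ _ _ (h 0%N \o f)) => //.
  by move=> u Uu; rewrite /h /c /= big_ord0 mul1r subr0 powR12_sqrt // ltW ?f0.
apply: (@Cn_comp _ _ _ [set x | 0 < x]) => // j x x0.
have H := is_derive1_powR (2^-1 - j%:R) x0.
apply: (is_derive_eq (is_deriveZ (c j) H)).
by rewrite /h /c big_ord_recr /= -[j.+1%:R]natr1 opprD addrA /GRing.scale /= mulrA.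
Qed.

Lemma differentiable_rowP n (f : 'rV[R]_m -> 'rV[R]_n) u :
  (forall j, differentiable (fun u => f u 0 j) u) -> differentiable f u.
Proof.
move=> df; have -> : f = \sum_j (fun u => f u 0 j *: delta_mx 0 j).
  by apply/funext => x; rewrite fct_sumE; exact: row_sum_delta.
by apply: differentiable_sum => j; apply: differentiableZl.
Qed.

Lemma Cn_rowP k U n (f : 'rV[R]_m -> 'rV[R]_n) : open U ->
  Cn k U f <-> forall j, Cn k U (fun u => f u 0 j).
Proof.
have dj (g : 'rV[R]_m -> 'rV[R]_n) u j : differentiable g u ->
    differentiable (fun u => g u 0 j) u.
  move=> dg; apply: (@differentiable_comp _ _ _ _ g (fun M : 'rV[R]_n => M 0 j)) => //.
  exact: differentiable_coord.
move=> oU; elim: k f => [|k IH] f; split.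
- by move=> Cf j; split=> // u Uu; apply/dj/(Cn_diff Cf Uu).
- by move=> Cf; split=> // u Uu; apply: differentiable_rowP => j; apply: Cn_diff (Cf j) Uu.
- move=> Cf j; apply: CnS => // [u Uu|v]; first by apply/dj/(Cn_diff Cf Uu).
  exists (fun u => 'D_v f u 0 j); first exact: ((IH ('D_v f)).1 (Cf.2 v) j).
  move=> u Uu; apply: derive_val; apply: is_derive_entry.
  exact: Cn_derive Cf Uu.
move=> Cf; apply: CnS => // [u Uu|v].
  by apply: differentiable_rowP => j; apply: Cn_diff (Cf j) Uu.
exists (fun u => \row_j 'D_v (fun u => f u 0 j) u).
  apply: (IH _).2 => j; apply: Cn_ext ((Cf j).2 v) => // u Uu.
  by rewrite mxE.
move=> u Uu; apply: derive_val; apply/is_derive_mxP => i j; rewrite mxE ord1.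
exact: Cn_derive (Cf j) Uu.
Qed.

Lemma Cn_mulmxr k U n p (f : 'rV[R]_m -> 'rV[R]_n) (M : 'M[R]_(n, p)) : open U ->
  Cn k U f -> Cn k U (fun u => f u *m M).
Proof.
move=> oU /(Cn_rowP _ _ oU) Cf; apply/Cn_rowP => // j.
have -> : (fun u => (f u *m M) 0 j) = (fun u => \sum_i M i j * f u 0 i).
  by apply/funext => u; rewrite mxE; apply: eq_bigr => i _; rewrite mulrC.
by apply: Cn_sum => // i; apply: CnZ.
Qed.

Lemma CnZl k U n (f : 'rV[R]_m -> R) (g : 'rV[R]_m -> 'rV[R]_n) : open U ->
  Cn k U f -> Cn k U g -> Cn k U (fun u => f u *: g u).
Proof.
move=> oU Cf /(Cn_rowP _ _ oU) Cg; apply/Cn_rowP => // j.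
have -> : (fun u => (f u *: g u) 0 j) = (fun u => f u * g u 0 j).
  by apply/funext => u; rewrite mxE.
exact: CnM.
Qed.

Lemma CnB k U n (f g : 'rV[R]_m -> 'rV[R]_n) : open U ->
  Cn k U f -> Cn k U g -> Cn k U (fun u => f u - g u).
Proof.
move=> oU Cf Cg; apply: (@Cn_ext _ _ _ (f \+ (fun u => cst (-1) u *: g u))) => //.
  by move=> u _; rewrite /= scaleN1r.
by apply: CnD => //; apply: CnZl => //; exact: Cn_cst.
Qed.

Lemma Cn_id k U : open U -> Cn k U (@id 'rV[R]_m).
Proof. by move=> oU; apply/Cn_rowP => // j; apply: Cn_coord. Qed.

(** [iter_derive] applies the last direction of the list first, and [Cn] also peels off the
    innermost derivative first; lists are therefore consumed from the right. *)
Lemma smooth_onP U n (f : 'rV[R]_m -> 'rV[R]_n) :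
  smooth_on U f <-> forall k, Cn k U f.
Proof.
split=> [sf k|Cf vs u Uu].
  elim: k f sf => [|k IH] f sf; first by split=> // u; apply: (sf [::]).
  split=> [u|v]; first exact: (sf [::]).
  apply: IH => vs u Uu; have := sf (rcons vs v) u Uu.
  by rewrite /iter_derive foldr_rcons.
elim/last_ind: vs f Cf => [|vs v IH] f Cf; first exact: Cn_diff (Cf 0%N) Uu.
rewrite /iter_derive foldr_rcons; apply: IH => k; exact: (Cf k.+1).2.
Qed.

End Cn.

Lemma Cn_rsubmx {R : realType} {m1 m2 : nat} {W : normedModType R} k
    (U : set 'rV[R]_m2) (f : 'rV[R]_m2 -> W) : open U ->
  Cn k U f -> Cn k [set u : 'rV[R]_(m1 + m2) | U (rsubmx u)] (f \o rsubmx).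
Proof.
move=> oU; have oU' : open [set u : 'rV[R]_(m1 + m2) | U (rsubmx u)].
  apply: (@open_comp _ _ (rsubmx : 'rV[R]_(m1 + m2) -> 'rV[R]_m2)) => // u _.
  exact/differentiable_continuous/differentiable_rsubmx.
have dr g u : differentiable g (rsubmx u) -> differentiable (g \o rsubmx) (u : 'rV[R]_(m1 + m2)).
  by move=> dg; apply: (@differentiable_comp _ _ _ _ rsubmx g) => //; apply: differentiable_rsubmx.
elim: k f => [|k IH] f Cf.
  by split=> // u Uu; apply/dr/(Cn_diff Cf).
apply: CnS => // [u Uu|v]; first by apply/dr/(Cn_diff Cf).
exists ('D_(rsubmx v) f \o rsubmx); first exact/IH/Cf.2.
move=> u Uu; apply: derive_val; apply: (@is_derive_inner_linear _ _ _ _ rsubmx).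
exact: Cn_derive Cf Uu.
Qed.

(** * Mean values along lines and symmetry of second derivatives *)

Section Lines.
Context {R : realType} {m : nat}.
Implicit Types (p u X Y : 'rV[R]_m) (U : set 'rV[R]_m).

Lemma is_derive_line {W : normedModType R} (f : 'rV[R]_m -> W) p X (s : R) df :
  is_derive (p + s *: X) X f df -> is_derive s 1 (fun s => f (p + s *: X)) df.
Proof.
move=> [h1 h2].
have E : (fun h : R => h^-1 *: (((fun s => f (p + s *: X)) \o shift s) (h *: (1 : R))
     - f (p + s *: X)))
   = (fun h => h^-1 *: ((f \o shift (p + s *: X)) (h *: X) - f (p + s *: X))).
  apply/funext => h /=; congr (_ *: (f _ - _)).
  by rewrite [h *: _]mulr1 scalerDl addrCA.
by split; rewrite /derivable /derive E.
Qed.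

Lemma MVT_line (f : 'rV[R]_m -> R) p X (h : R) : 0 <= h ->
  (forall t : R, 0 <= t <= h -> differentiable f (p + t *: X)) ->
  exists2 t : R, 0 <= t <= h & f (p + h *: X) - f p = 'D_X f (p + t *: X) * h.
Proof.
move=> h0 df.
have dl (t : R) : 0 <= t <= h ->
    is_derive t (1 : R) (fun s => f (p + s *: X)) ('D_X f (p + t *: X)).
  by move=> th; apply/is_derive_line/derivableP/diff_derivable/df.
have [t||t] := @MVT_segment R (fun s => f (p + s *: X))
    (fun t => 'D_X f (p + t *: X)) 0 h h0.
- by rewrite in_itv /= => /andP[a b]; apply: dl; rewrite !ltW.
- apply: continuous_in_subspaceT => t; rewrite inE /= in_itv /= => /dl [ht _].
  exact/differentiable_continuous/derivable1_diffP.
by rewrite in_itv /= scale0r addr0 subr0 => th ->; exists t.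
Qed.

Lemma near_parallelogram (P : set 'rV[R]_m) u X Y : nbhs u P ->
  exists2 d : R, 0 < d & forall s t : R, 0 <= s <= d -> 0 <= t <= d ->
    P (u + s *: X + t *: Y).
Proof.
move=> /nbhs_ballP[e /= e0 eP].
have N0 : 0 < `|X| + `|Y| + 1 by rewrite ltr_wpDl // addr_ge0.
(* The [+ 1] keeps the denominator positive when [X] and [Y] vanish, and makes the last inequality
   strict. *)
exists (e / (`|X| + `|Y| + 1)); first by rewrite divr_gt0.
move=> s t /andP[s0 sd] /andP[t0 td]; apply: eP.
rewrite -ball_normE /= -addrA opprD addNKr normrN.
apply: (le_lt_trans (ler_normD _ _)); rewrite !normrZ !ger0_norm //.
apply: (@le_lt_trans _ _ (e / (`|X| + `|Y| + 1) * (`|X| + `|Y|))).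
  by rewrite mulrDr lerD // ler_wpM2r.
by rewrite mulrAC ltr_pdivrMr // ltr_pM2l // ltrDl.
Qed.

(** The mean value theorem is applied along [X] to the increment [f (p + h *: Y) - f p], then along
    [Y] to the derivative of [f] along [X]. *)
Lemma second_difference U (f : 'rV[R]_m -> R) u X Y (h : R) : 0 <= h ->
  Cn 1 U f ->
  (forall s t : R, 0 <= s <= h -> 0 <= t <= h -> U (u + s *: X + t *: Y)) ->
  exists s t : R, [/\ 0 <= s <= h, 0 <= t <= h &
    f (u + h *: X + h *: Y) - f (u + h *: X) - f (u + h *: Y) + f u
      = 'D_Y ('D_X f) (u + s *: X + t *: Y) * h ^+ 2].
Proof.
move=> h0 Cf hU; have hh : 0 <= h <= h by apply/andP; split.
have h00 : (0 : R) <= 0 <= h by apply/andP; split.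
pose g p := f (p + h *: Y) - f p.
have Dg (s : R) : 0 <= s <= h -> differentiable g (u + s *: X).
  move=> hs; apply: (@differentiableB _ _ _ (fun p => f (p + h *: Y)) f).
    apply: (@differentiable_comp _ _ _ _ (fun p => p + h *: Y) f) => //.
    exact: Cn_diff Cf (hU _ _ hs hh).
  by apply: Cn_diff Cf _; have := hU _ _ hs h00; rewrite scale0r addr0.
have [s hs E] := MVT_line h0 Dg.
have Eg : 'D_X g (u + s *: X) = 'D_X f (u + s *: X + h *: Y) - 'D_X f (u + s *: X).
  apply: derive_val; apply: (@is_deriveB _ _ _ (fun p => f (p + h *: Y)) f); last first.
    by apply: Cn_derive Cf _; have := hU _ _ hs h00; rewrite scale0r addr0.
  have H := Cn_derive X Cf (hU _ _ hs hh).
  have E1 : (fun k : R => k^-1 *: (((fun p => f (p + h *: Y)) \o shift (u + s *: X)) (k *: X)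
     - f (u + s *: X + h *: Y)))
   = (fun k => k^-1 *: ((f \o shift (u + s *: X + h *: Y)) (k *: X)
      - f (u + s *: X + h *: Y))).
    by apply/funext => k /=; rewrite !addrA.
  by case: H => H1 H2; split; rewrite /derivable /derive E1.
have [t ht E2] : exists2 t : R, 0 <= t <= h &
    'D_X f (u + s *: X + h *: Y) - 'D_X f (u + s *: X) =
    'D_Y ('D_X f) (u + s *: X + t *: Y) * h.
  have [t ht|t ht ->] := @MVT_line ('D_X f) (u + s *: X) Y h h0; last by exists t.
  have C0 : Cn 0 U ('D_X f) := Cf.2 X.
  exact: (Cn_diff C0 (hU _ _ hs ht)).
exists s, t; split=> //; rewrite -[_ - _ - _]addrA -opprB opprK.
rewrite expr2 mulrA -E2 -Eg -E /g; lra.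
Qed.

Lemma close_trans (x y b e : R) :
  `|x - b| < e / 2 -> `|y - b| < e / 2 -> `|x - y| <= e.
Proof.
move=> xb yb; rewrite (splitr e) -(subrKA b).
by apply: (le_trans (ler_normD _ _)); rewrite lerD ?ltW // distrC.
Qed.

Lemma near_close2 U (A B : 'rV[R]_m -> R) u (e : R) : open U -> U u -> 0 < e ->
  {for u, continuous A} -> {for u, continuous B} ->
  nbhs u [set p | [/\ U p, `|A u - A p| < e & `|B u - B p| < e]].
Proof.
move=> oU Uu e0 /cvgrPdist_lt/(_ _ e0) hA /cvgrPdist_lt/(_ _ e0) hB.
by apply: filterS3 (open_nbhs_nbhs (conj oU Uu)) hA hB => p.
Qed.

(** Schwarz's theorem: at suitable points of a small parallelogram both mixed derivatives equal the
    same second difference divided by [d ^+ 2], and both are continuous at [u]. *)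
Lemma derive_comm U (f : 'rV[R]_m -> R) u X Y : open U -> Cn 2 U f -> U u ->
  'D_X ('D_Y f) u = 'D_Y ('D_X f) u.
Proof.
move=> oU Cf Uu; have Cf1 : Cn 1 U f by exact: CnW.
have cont V W : {for u, continuous ('D_V ('D_W f))}.
  have C0 : Cn 0 U ('D_V ('D_W f)) := (Cf.2 W).2 V.
  exact/differentiable_continuous/(Cn_diff C0 Uu).
apply/eqP; rewrite -subr_eq0 -normr_eq0; apply/eqP/le_anti; rewrite normr_ge0 andbT.
apply/ler_addgt0Pr => e e0; rewrite add0r.
have e2 : 0 < e / 2 by rewrite divr_gt0.
have nP : nbhs u [set p | [/\ U p, `|'D_X ('D_Y f) u - 'D_X ('D_Y f) p| < e / 2 &
   `|'D_Y ('D_X f) u - 'D_Y ('D_X f) p| < e / 2]].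
  exact: (near_close2 oU Uu e2 (cont X Y) (cont Y X)).
have [d d0 hd] := near_parallelogram X Y nP.
have hX s t (hs : 0 <= s <= d) (ht : 0 <= t <= d) := hd s t hs ht.
have [s [t [hs ht E1]]] : exists s t : R, [/\ 0 <= s <= d, 0 <= t <= d &
    f (u + d *: X + d *: Y) - f (u + d *: X) - f (u + d *: Y) + f u
      = 'D_Y ('D_X f) (u + s *: X + t *: Y) * d ^+ 2].
  by apply: (second_difference (ltW d0) Cf1) => s t hs ht; have [] := hd s t hs ht.
have [s' [t' [hs' ht' E2]]] : exists s t : R, [/\ 0 <= s <= d, 0 <= t <= d &
    f (u + d *: Y + d *: X) - f (u + d *: Y) - f (u + d *: X) + f u
      = 'D_X ('D_Y f) (u + s *: Y + t *: X) * d ^+ 2].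
  apply: (second_difference (ltW d0) Cf1) => a b ha hb.
  by have [] := hd b a hb ha; rewrite addrAC.
have E : 'D_Y ('D_X f) (u + s *: X + t *: Y) = 'D_X ('D_Y f) (u + s' *: Y + t' *: X).
  have d2 : d ^+ 2 != 0 by rewrite expf_neq0 ?gt_eqF.
  apply: (mulIf d2); apply: etrans (esym E1) (etrans _ E2).
  rewrite [u + d *: Y + _]addrAC; congr (_ + _).
  exact: addrAC.
have [_ _ a1] := hd _ _ hs ht; have [_ a2 _] := hd _ _ ht' hs'.
rewrite addrAC in a2; rewrite E in a1.
exact: close_trans a2 a1.
Qed.

Lemma derive_comm_row U n (f : 'rV[R]_m -> 'rV[R]_n) u X Y :
  open U -> Cn 2 U f -> U u -> 'D_X ('D_Y f) u = 'D_Y ('D_X f) u.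
Proof.
move=> oU Cf Uu; have Cj := (Cn_rowP 2 f oU).1 Cf; apply/rowP => j.
have E V W : 'D_V ('D_W f) u 0 j = 'D_V ('D_W (fun u => f u 0 j)) u.
  have C1 : Cn 1 U ('D_W f) := Cf.2 W.
  have H x : U x -> 'D_W f x 0 j = 'D_W (fun u => f u 0 j) x.
    by move=> Ux; have [] := is_derive_entry 0 j (Cn_derive W Cf Ux).
  have [_ <-] := is_derive_entry 0 j (Cn_derive V C1 Uu).
  exact: (derive_ext V oU H Uu).
exact: etrans (E X Y) (etrans (derive_comm X Y oU (Cj j) Uu) (esym (E Y X))).
Qed.

Lemma derive0_star_cst U n (f : 'rV[R]_m -> 'rV[R]_n) :
  (forall u (t : R), U u -> 0 <= t <= 1 -> U (t *: u)) ->
  (forall u, U u -> differentiable f u) ->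
  (forall u X, U u -> 'D_X f u = 0) -> forall u, U u -> f u = f 0.
Proof.
move=> sU df Df u Uu; apply/rowP => j.
have dj p : U p -> is_derive p u (fun p => f p 0 j) 0.
  move=> Up; have -> : 0 = ('D_u f p) 0 j by rewrite Df // mxE.
  by apply/is_derive_entry/derivableP/diff_derivable/df.
have df0 (t : R) : 0 <= t <= 1 -> differentiable (fun p => f p 0 j) (0 + t *: u).
  move=> ht; rewrite add0r.
  apply: (@differentiable_comp _ _ _ _ f (fun M : 'rV[R]_n => M 0 j)).
    exact/df/sU.
  exact: differentiable_coord.
have [t ht] := MVT_line ler01 df0; rewrite scale1r !add0r mulr1.
have [_ ->] := dj _ (sU _ _ Uu ht).
by move/eqP; rewrite subr_eq0 => /eqP.
Qed.

End Lines.

(** * The Euclidean inner product *)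

Section Dot.
Context {R : realType} {k : nat}.
Implicit Types u v w : 'rV[R]_k.

Lemma dotE u v : dot u v = \sum_i u 0 i * v 0 i.
Proof. by rewrite /dot mxE; apply: eq_bigr => i _; rewrite mxE. Qed.

Lemma dotC u v : dot u v = dot v u.
Proof. by rewrite !dotE; apply: eq_bigr => i _; rewrite mulrC. Qed.

Lemma dotDl u v w : dot (u + v) w = dot u w + dot v w.
Proof. by rewrite /dot mulmxDl mxE. Qed.

Lemma dotDr u v w : dot w (u + v) = dot w u + dot w v.
Proof. by rewrite dotC dotDl !(dotC _ w). Qed.

Lemma dotZl a u v : dot (a *: u) v = a * dot u v.
Proof. by rewrite /dot -scalemxAl mxE. Qed.

Lemma dotZr a u v : dot u (a *: v) = a * dot u v.
Proof. by rewrite dotC dotZl dotC. Qed.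

Lemma dotNl u v : dot (- u) v = - dot u v.
Proof. by rewrite -scaleN1r dotZl mulN1r. Qed.

Lemma dotNr u v : dot u (- v) = - dot u v.
Proof. by rewrite dotC dotNl dotC. Qed.

Lemma dotBl u v w : dot (u - v) w = dot u w - dot v w.
Proof. by rewrite dotDl dotNl. Qed.

Lemma dotBr u v w : dot w (u - v) = dot w u - dot w v.
Proof. by rewrite dotDr dotNr. Qed.

Lemma dot0l u : dot 0 u = 0.
Proof. by rewrite /dot mul0mx mxE. Qed.

Lemma dot0r u : dot u 0 = 0.
Proof. by rewrite dotC dot0l. Qed.

Lemma dot_ge0 u : 0 <= dot u u.
Proof. by rewrite dotE; apply: sumr_ge0 => i _; rewrite -expr2 sqr_ge0. Qed.

Lemma dot_eq0 u : (dot u u == 0) = (u == 0).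
Proof.
apply/eqP/eqP => [|->]; last by rewrite dot0l.
rewrite dotE => /eqP; rewrite psumr_eq0; last by move=> i _; rewrite -expr2 sqr_ge0.
move=> /allP H; apply/rowP => i; rewrite mxE; apply/eqP.
by have := H i (mem_index_enum _); rewrite /= mulf_eq0 orbb.
Qed.

Lemma dot_inj u v : (forall w, dot u w = dot v w) -> u = v.
Proof.
move=> H; apply/eqP; rewrite -subr_eq0 -dot_eq0; apply/eqP.
by rewrite dotBl H subrr.
Qed.

End Dot.

Lemma dot_mulmx {R : realType} {k l : nat} (u : 'rV[R]_k) (M : 'M[R]_(k, l)) v :
  dot (u *m M) v = dot u (v *m M^T).
Proof. by rewrite /dot trmx_mul trmxK mulmxA. Qed.

Lemma dot_mulmx_id {R : realType} {k l : nat} (u v : 'rV[R]_k) (M : 'M[R]_(k, l)) :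
  M *m M^T = 1%:M -> dot (u *m M) (v *m M) = dot u v.
Proof. by move=> MM; rewrite dot_mulmx -mulmxA MM mulmx1. Qed.

(** * Graph charts of the sphere *)

Definition ball1 {R : realType} {m : nat} : set 'rV[R]_m := [set u | dot u u < 1].

Definition height {R : realType} {m : nat} (u : 'rV[R]_m) : R :=
  Num.sqrt (1 - dot u u).

(* The affine-linear image of the graph of the height function; if the rows of
   La and ep are orthonormal, it parametrizes an open half sphere. *)
Definition cap {R : realType} {m N : nat} (La : 'M[R]_(m, N)) (ep : 'rV[R]_N) u :=
  u *m La + height u *: ep.

(* The round metric in the coordinates of cap. *)
Definition cap_metric {R : realType} {m : nat} (u X Y : 'rV[R]_m) : R :=
  dot X Y + dot u X * dot u Y / height u ^+ 2.

Lemma Cn_dot {R : realType} {m N : nat} k (U : set 'rV[R]_m)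
    (f g : 'rV[R]_m -> 'rV[R]_N) : open U ->
  Cn k U f -> Cn k U g -> Cn k U (fun u => dot (f u) (g u)).
Proof.
move=> oU Cf Cg; have -> : (fun u => dot (f u) (g u)) = (fun u => \sum_i f u 0 i * g u 0 i).
  by apply/funext => u; rewrite dotE.
by apply: Cn_sum => // i; apply: CnM => //; [exact: ((Cn_rowP k f oU).1 Cf i)|exact: ((Cn_rowP k g oU).1 Cg i)].
Qed.

Lemma is_derive_dot {R : realType} {V : normedModType R} {N : nat} (f g : V -> 'rV[R]_N) (t v : V) df dg :
  is_derive t v f df -> is_derive t v g dg ->
  is_derive t v (fun t => dot (f t) (g t)) (dot df (g t) + dot (f t) dg).
Proof.
move=> hf hg; have H := is_derive_entry 0 0 (is_derive_mulmx hf (is_derive_trmx hg)).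
by apply: (is_derive_eq H); rewrite mxE.
Qed.

Lemma capE {R : realType} {m N : nat} (La : 'M[R]_(m, N)) (ep : 'rV[R]_N) u :
  cap La ep u = u *m La + height u *: ep.
Proof. by []. Qed.

Section CapDerivatives.
Context {R : realType} {m N : nat} (La : 'M[R]_(m, N)) (ep : 'rV[R]_N).
Implicit Types u X Y : 'rV[R]_m.
Local Notation cap := (cap La ep).

Lemma Cn_sqnorm k (U : set 'rV[R]_m) : open U -> Cn k U (fun u => dot u u).
Proof. by move=> oU; apply: Cn_dot => //; apply: Cn_id. Qed.

Lemma open_ball1 : open (@ball1 R m).
Proof.
apply: (@open_comp _ _ (fun u : 'rV[R]_m => dot u u) [set x | x < 1]); last exact: open_lt.
move=> u _; apply: differentiable_continuous.
exact: (Cn_diff (Cn_sqnorm 0 openT)).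
Qed.

Lemma ball1_0 : (@ball1 R m) 0.
Proof. by rewrite /ball1 /= dot0l. Qed.

Lemma ball1_star u (t : R) : ball1 u -> 0 <= t <= 1 -> ball1 (t *: u).
Proof.
rewrite /ball1 /= dotZl dotZr => u1 /andP[t0 t1].
apply: le_lt_trans u1; rewrite mulrA ler_piMl ?dot_ge0 //.
by rewrite mulr_ile1.
Qed.

Lemma height_gt0 u : ball1 u -> 0 < height u.
Proof. by move=> Bu; rewrite sqrtr_gt0 subr_gt0. Qed.

Lemma height2 u : ball1 u -> height u ^+ 2 = 1 - dot u u.
Proof. by move=> Bu; rewrite sqr_sqrtr // subr_ge0 ltW. Qed.

Lemma Cn_height k : Cn k ball1 (@height R m).
Proof.
have oB := open_ball1; apply: Cn_sqrt => //; first by move=> u; rewrite subr_gt0.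
have -> : (fun u : 'rV[R]_m => 1 - dot u u) = (cst 1 : _ -> R) \+ (fun u => (-1) * dot u u).
  by apply/funext => u; rewrite /= mulN1r.
apply: CnD => //; first exact: Cn_cst.
by apply: CnZ => //; apply: Cn_sqnorm.
Qed.

Lemma Cn_cap k : Cn k ball1 cap.
Proof.
have oB := open_ball1.
have -> : cap = (fun u => u *m La) \+ (fun u => height u *: cst ep u) by [].
apply: CnD => //; first by apply: Cn_mulmxr => //; apply: Cn_id.
by apply: CnZl => //; [exact: Cn_height|exact: Cn_cst].
Qed.

Lemma is_derive_height u X : ball1 u ->
  is_derive u X (@height R m) (- dot u X / height u).
Proof.
move=> Bu; have w0 := height_gt0 Bu.
have H1 := is_derive_dot (is_derive_id u X) (is_derive_id u X).
have H2 := is_deriveB (is_derive_cst (1 : R) u X) H1.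
have p0 : 0 < 1 - dot u u by rewrite subr_gt0.
have D2 : differentiable (cst 1 - (fun u : 'rV[R]_m => dot (id u) (id u))) u.
  apply: differentiableB => //; exact: (Cn_diff (Cn_sqnorm 0 openT)).
have [_ H3] := is_derive_comp1 D2 H2 (is_derive1_sqrt p0).
apply: (is_derive_eq H3); rewrite /= (dotC X u) /height; field.
by rewrite gt_eqF // sqrtr_gt0.
Qed.

Lemma is_derive_cap u X : ball1 u ->
  is_derive u X cap (X *m La - (dot u X / height u) *: ep).
Proof.
move=> Bu; have H1 := is_derive_mulmxr La (is_derive_id u X).
have H2 := is_derive_scale (is_derive_height X Bu) (is_derive_cst ep u X).
have H := is_deriveD H1 H2.
by apply: (is_derive_eq H); rewrite scaler0 addr0 mulNr scaleNr.
Qed.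

Lemma derive_cap u X : ball1 u ->
  'D_X cap u = X *m La - (dot u X / height u) *: ep.
Proof. by move=> Bu; have [_] := is_derive_cap X Bu. Qed.

Lemma is_derive2_cap u X Y : ball1 u ->
  is_derive u X ('D_Y cap) (- (cap_metric u X Y / height u) *: ep).
Proof.
move=> Bu; have w0 := height_gt0 Bu; have wn : height u != 0 by rewrite gt_eqF.
have E : {near u, (fun u => Y *m La - (dot u Y * (height u)^-1) *: ep) =1 'D_Y cap}.
  by apply: (open_near_eq open_ball1 _ Bu) => x Bx; rewrite derive_cap.
have H1 := is_derive_dot (is_derive_id u X) (is_derive_cst Y u X).
have [dw vw] := is_derive_height X Bu.
have H2 : is_derive u X (fun u => (height u)^-1)
    (- (height u) ^- 2 *: (- dot u X / height u)).
  by split; [exact: derivableV|rewrite deriveV // vw].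
have H3 := is_derive_scale (is_deriveM H1 H2) (is_derive_cst ep u X).
have H := is_deriveB (is_derive_cst (Y *m La) u X) H3.
apply: (near_eq_is_derive E); apply: (is_derive_eq H).
rewrite scaler0 addr0 sub0r -scaleNr; congr (_ *: _).
rewrite /= dot0r addr0 /cap_metric /GRing.scale /=; field.
by [].
Qed.

Hypothesis LL : La *m La^T = 1%:M.
Hypothesis Le : ep *m La^T = 0.
Hypothesis ee : dot ep ep = 1.

Lemma dot_LaLa X Y : dot (X *m La) (Y *m La) = dot X Y.
Proof. exact: dot_mulmx_id. Qed.

Lemma dot_epLa X : dot ep (X *m La) = 0.
Proof. by rewrite dotC dot_mulmx Le dot0r. Qed.

Lemma dot_Laep X : dot (X *m La) ep = 0.
Proof. by rewrite dotC dot_epLa. Qed.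

Lemma dot_cap u : ball1 u -> dot (cap u) (cap u) = 1.
Proof.
move=> Bu; rewrite !capE !(dotDl, dotDr, dotZl, dotZr) dot_LaLa dot_Laep dot_epLa ee.
by have := height2 Bu; rewrite expr2 => h2; lra.
Qed.

Lemma dot_derive_cap u X Y : ball1 u ->
  dot ('D_X cap u) ('D_Y cap u) = cap_metric u X Y.
Proof.
move=> Bu; have wn : height u != 0 by rewrite gt_eqF ?height_gt0.
rewrite !derive_cap // !(dotBl, dotBr, dotZl, dotZr) dot_LaLa dot_Laep dot_epLa ee.
by rewrite /cap_metric; field.
Qed.

Lemma dot_cap_derive u X : ball1 u -> dot (cap u) ('D_X cap u) = 0.
Proof.
move=> Bu; have wn : height u != 0 by rewrite gt_eqF ?height_gt0.
rewrite !derive_cap // !capE !(dotDl, dotBr, dotZl, dotZr) dot_LaLa dot_Laep dot_epLa ee.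
by field.
Qed.

(** Expresses [ep] by the position and the derivative along the radial field [u]. With
    [is_derive2_cap] it gives D_X D_Y cap = g(X, Y) (D_u cap - cap), an equation free of [La] and
    [ep]: the second derivatives of a cap lie in its tangent cone. *)
Lemma cap_sub_derive u : ball1 u -> cap u - 'D_u cap u = (height u)^-1 *: ep.
Proof.
move=> Bu; have wn : height u != 0 by rewrite gt_eqF ?height_gt0.
rewrite derive_cap // !capE opprB addrA addrAC [_ + _ - u *m La]addrAC subrr add0r -scalerDl.
by congr (_ *: _); apply: (mulIf wn); rewrite mulrDl divfK // mulVf // -expr2 height2 // subrK.
Qed.

Lemma cap_metric_gt0 u X : cap_metric u X X = 0 -> X = 0.
Proof.
move=> /eqP; rewrite /cap_metric -expr2 paddr_eq0 ?dot_ge0 //.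
  by rewrite dot_eq0 => /andP[/eqP].
by rewrite divr_ge0 // sqr_ge0.
Qed.

End CapDerivatives.

Section Hemisphere.
Context {R : realType} {k : nat} (i : 'I_k) (b : bool).

Definition hemi_La : 'M[R]_(k.-1, k) := \matrix_(j', j) (lift i j' == j)%:R.
Definition hemi_ep : 'rV[R]_k := (-1) ^+ b *: delta_mx 0 i.

Lemma hemisphereE : @hemisphere R k i b = cap hemi_La hemi_ep.
Proof.
apply/funext => u; apply/rowP => j; rewrite !mxE eqxx /=.
case: unliftP => [j' ->|->] /=.
  rewrite (bigD1 j') //= !mxE eqxx mulr1 big1 => [|l lj]; last first.
    by rewrite !mxE (inj_eq lift_inj) (negbTE lj) mulr0.
  by rewrite eq_sym (negbTE (neq_lift _ _)) /= !mulr0 !addr0.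
rewrite big1 ?add0r => [|l _]; first by rewrite eqxx mulr1 mulrC.
by rewrite !mxE eq_sym (negbTE (neq_lift _ _)) mulr0.
Qed.

Lemma hemi_LaLa : hemi_La *m hemi_La^T = 1%:M.
Proof.
apply/matrixP => a c; rewrite !mxE (bigD1 (lift i a)) //= !mxE eqxx mul1r.
rewrite big1 ?addr0 => [|l la]; last by rewrite !mxE eq_sym (negbTE la) mul0r.
by rewrite (inj_eq lift_inj) eq_sym.
Qed.

Lemma hemi_epLa : hemi_ep *m hemi_La^T = 0.
Proof.
apply/rowP => a; rewrite -scalemxAl -rowE !mxE.
by rewrite eq_sym (negbTE (neq_lift _ _)) mulr0.
Qed.

Lemma dot_hemi_ep : dot hemi_ep hemi_ep = 1.
Proof.
rewrite dotZl dotZr mulrA -expr2 sqrr_sign mul1r dotE (bigD1 i) //= big1.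
  by rewrite !mxE !eqxx mulr1 addr0.
by move=> l li; rewrite !mxE (negbTE li) mulr0.
Qed.

End Hemisphere.

(** * Projection to the normal space *)

Section NormalProjection.
Context {R : realType} {m N : nat} (phi : 'rV[R]_m -> 'rV[R]_N) (u : 'rV[R]_m).
Local Notation T := (tangent_cone phi u).

Lemma normal_tangent_direct : (Defs.normal_space phi u :&: <<T>> = 0)%MS.
Proof.
apply/eqP/rowV0P => v; rewrite sub_capmx genmxE => /andP[/sub_kermxP vT /submxP[c cT]].
apply/eqP; rewrite -dot_eq0 /dot {2}cT trmx_mul mulmxA vT mul0mx mxE //.
Qed.

(** Second fundamental forms are computed below by exhibiting such a decomposition of a second
    derivative; it determines the projection because the two spaces are in direct sum. *)
Lemma normal_projE (v t : 'rV[R]_N) :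
  v *m T^T = 0 -> (t <= T)%MS -> (v + t) *m normal_proj phi u = v.
Proof.
move=> /sub_kermxP vN tT; rewrite mulmxDl proj_mx_id ?normal_tangent_direct //.
by rewrite proj_mx_0 ?normal_tangent_direct ?genmxE // addr0.
Qed.

Lemma normal_tangent_full : row_full (Defs.normal_space phi u + <<T>>)%MS.
Proof.
rewrite /row_full; have := mxrank_sum_cap (Defs.normal_space phi u) <<T>>%MS.
rewrite normal_tangent_direct mxrank0 addn0 genmxE mxrank_ker mxrank_tr.
by move=> ->; rewrite subnK // rank_leq_col.
Qed.

Lemma normal_proj0 (v : 'rV[R]_N) : v *m normal_proj phi u = 0 -> (v <= T)%MS.
Proof.
move=> v0; have := @proj_mx_compl_sub _ _ _ (Defs.normal_space phi u) <<T>>%MS v.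
rewrite submx_full ?normal_tangent_full // => /(_ isT).
by rewrite -/(normal_proj phi u) v0 subr0 genmxE.
Qed.

Lemma tangent_coneP (v : 'rV[R]_N) : differentiable phi u -> (v <= T)%MS ->
  exists a Z, v = a *: phi u + 'D_Z phi u.
Proof.
move=> dphi /submxP[c ->]; exists (lsubmx c 0 0), (rsubmx c).
rewrite deriveEjacobian // -[in LHS](hsubmxK c) mul_row_col.
by rewrite [in LHS](mx11_scalar (lsubmx c)) mul_scalar_mx.
Qed.

Lemma tangent_cone_point : (phi u <= T)%MS.
Proof.
by apply/submxP; exists (row_mx 1%:M 0); rewrite mul_row_col mul1mx mul0mx addr0.
Qed.

Lemma tangent_cone_derive X : differentiable phi u -> ('D_X phi u <= T)%MS.
Proof.
move=> dphi; apply/submxP; exists (row_mx 0 X).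
by rewrite mul_row_col mul0mx add0r deriveEjacobian.
Qed.

Lemma normal_spaceP (v : 'rV[R]_N) : differentiable phi u ->
  dot v (phi u) = 0 -> (forall X, dot v ('D_X phi u) = 0) -> v *m T^T = 0.
Proof.
move=> dphi v0 vX; apply/rowP => j; rewrite tr_col_mx mul_mx_row [RHS]mxE.
rewrite mxE; case: splitP => i _.
  by rewrite ord1; exact: v0.
have := vX (delta_mx 0 i); rewrite deriveEjacobian // -rowE.
rewrite dotE mxE => H; apply: etrans H; apply: eq_bigr => l _; by rewrite !mxE.
Qed.

End NormalProjection.

(** * Rigidity of totally geodesic maps in a graph chart *)

Lemma koszul {R : realType} {V : Type} (k G : V -> V -> V -> R) :
  (forall a b c, k a b c = k b a c) ->
  (forall a b c, k a b c + k a c b = G a b c) ->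
  forall a b c, k a b c = (G a b c + G b a c - G c a b) / 2.
Proof.
move=> kS kG a b c; rewrite -!kG (kS c a b) (kS c b a) (kS b a c); lra.
Qed.

Lemma derive_sum_delta {R : realType} {m N : nat} (phi : 'rV[R]_m -> 'rV[R]_N) u X :
  differentiable phi u ->
  'D_X phi u = \sum_j X 0 j *: 'D_(delta_mx 0 j) phi u.
Proof.
move=> du; rewrite deriveEjacobian // {1}(row_sum_delta X) mulmx_suml.
by apply: eq_bigr => j _; rewrite -scalemxAl deriveEjacobian.
Qed.

Section Rigidity.
Context {R : realType} {m N : nat} (phi : 'rV[R]_m -> 'rV[R]_N).
Implicit Types u X Y Z W : 'rV[R]_m.
Hypothesis Cphi : forall k, Cn k ball1 phi.
Hypothesis unit_phi : forall u, ball1 u -> dot (phi u) (phi u) = 1.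
Hypothesis gram_phi : forall u X Y, ball1 u ->
  dot ('D_X phi u) ('D_Y phi u) = cap_metric u X Y.
Hypothesis flat_phi : forall u X Y, ball1 u -> second_ff phi u X Y = 0.
Let oB := @open_ball1 R m.

Let CD X k : Cn k ball1 ('D_X phi).
Proof. exact: (Cphi k.+1).2. Qed.

Let dphi u X : ball1 u -> is_derive u X phi ('D_X phi u).
Proof. exact: Cn_derive (Cphi 0). Qed.

Let ddphi u X Y : ball1 u -> is_derive u X ('D_Y phi) ('D_X ('D_Y phi) u).
Proof. exact: Cn_derive (CD Y 0). Qed.

Let dot_phi_derive u X : ball1 u -> dot (phi u) ('D_X phi u) = 0.
Proof.
move=> Bu; have [_ H] := is_derive_dot (dphi X Bu) (dphi X Bu).
have E : 'D_X (fun t => dot (phi t) (phi t)) u = 'D_X (cst (1 : R)) u.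
  exact: (derive_ext X oB unit_phi Bu).
move: H; rewrite E derive_cst dotC => H; lra.
Qed.

Let dot_phi_derive2 u X Y : ball1 u ->
  dot (phi u) ('D_X ('D_Y phi) u) = - cap_metric u X Y.
Proof.
move=> Bu; have [_ H] := is_derive_dot (dphi X Bu) (ddphi X Y Bu).
have E : 'D_X (fun t => dot (phi t) ('D_Y phi t)) u = 'D_X (cst (0 : R)) u.
  by apply: (derive_ext X oB _ Bu) => x Bx; exact: dot_phi_derive.
move: H; rewrite E derive_cst gram_phi // => H; lra.
Qed.

Let is_derive_metric u X Y W : ball1 u ->
  is_derive u X (fun u => cap_metric u Y W)
    ((cap_metric u X Y * dot u W + cap_metric u X W * dot u Y) / height u ^+ 2).
Proof.
move=> Bu; have wn : height u != 0 by rewrite gt_eqF ?height_gt0.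
have H1 Z := is_derive_dot (is_derive_id u X) (is_derive_cst Z u X).
have [dw vw] := is_derive_height X Bu.
have w2n : height u * height u != 0 by rewrite mulf_neq0.
have H2 : is_derive u X (fun u => (height u * height u)^-1)
    (- (height u * height u) ^- 2 *: (height u *: (- dot u X / height u) + height u *: (- dot u X / height u))).
  have [dww vww] := is_deriveM (is_derive_height X Bu) (is_derive_height X Bu).
  by split; [exact: derivableV|rewrite (deriveV (f := height * height)) // vww].
have H := is_deriveD (is_derive_cst (dot Y W) u X) (is_deriveM (is_deriveM (H1 Y) (H1 W)) H2).
have E : (cst (dot Y W) : 'rV[R]_m -> R) + (fun t => dot (id t) (cst Y t)) * (fun t => dot (id t) (cst W t)) *
   (fun u => (height u * height u)^-1) = (fun u => cap_metric u Y W).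
  by apply/funext => x; rewrite /cap_metric expr2.
rewrite E in H; apply: (is_derive_eq H).
rewrite !fctE /= !dot0r !addr0 /cap_metric /GRing.scale /=; field.
by [].
Qed.

(** The tangential part of the second derivatives is intrinsic: <D_A D_B phi, D_C phi> is symmetric
    in A and B, and its sum with the term where B and C are exchanged is a derivative of the metric,
    so [koszul] recovers it. *)
Let dot_derive2 u X Y W : ball1 u ->
  dot ('D_X ('D_Y phi) u) ('D_W phi u) =
    cap_metric u X Y * dot u W / height u ^+ 2.
Proof.
move=> Bu.
have K A B C : dot ('D_A ('D_B phi) u) ('D_C phi u) + dot ('D_A ('D_C phi) u) ('D_B phi u) =
   (cap_metric u A B * dot u C + cap_metric u A C * dot u B) / height u ^+ 2.
  have [_ H] := is_derive_dot (ddphi A B Bu) (ddphi A C Bu).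
  have [_ <-] := is_derive_metric A B C Bu.
  rewrite [X in _ + X]dotC -H; apply: (derive_ext A oB _ Bu) => x Bx.
  exact: gram_phi.
have S A B C : dot ('D_A ('D_B phi) u) ('D_C phi u) = dot ('D_B ('D_A phi) u) ('D_C phi u).
  exact: (congr1 (fun z => dot z ('D_C phi u)) (derive_comm_row A B oB (Cphi 2) Bu)).
have gC A B : cap_metric u A B = cap_metric u B A.
  by rewrite /cap_metric dotC (mulrC (dot u A)).
apply: etrans (@koszul _ _ (fun A B C => dot ('D_A ('D_B phi) u) ('D_C phi u))
  (fun A B C => (cap_metric u A B * dot u C + cap_metric u A C * dot u B) / height u ^+ 2) S K X Y W) _.
rewrite (gC W X) (gC W Y) (gC Y X); field.
by rewrite gt_eqF ?height_gt0.
Qed.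

(** Flatness puts the second derivative in the tangent cone, as a phi + D_Z phi. Pairing with [phi]
    gives a. Since [cap_metric u u W] equals [dot u W / height u ^+ 2], [dot_derive2] makes Z - g(X,
    Y) u orthogonal to itself for the metric, hence zero. *)
Let derive2_phi u X Y : ball1 u ->
  'D_X ('D_Y phi) u = cap_metric u X Y *: ('D_u phi u - phi u).
Proof.
move=> Bu; have wn : height u != 0 by rewrite gt_eqF ?height_gt0.
have du := Cn_diff (Cphi 0) Bu.
have [a [Z E]] := tangent_coneP du (normal_proj0 (flat_phi X Y Bu)).
have aE : a = - cap_metric u X Y.
  rewrite -dot_phi_derive2 // E dotDr dotZr unit_phi // dot_phi_derive //; lra.
suff ZE : Z = cap_metric u X Y *: u.
  rewrite E aE scalerBr ZE scaleNr addrC; congr (_ - _).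
  by rewrite !deriveEjacobian // -scalemxAl.
apply/eqP; rewrite -subr_eq0; apply/eqP.
apply: (@cap_metric_gt0 _ _ u); set V := Z - _.
have DV : 'D_V phi u = 'D_Z phi u - cap_metric u X Y *: 'D_u phi u.
  by rewrite !deriveEjacobian // mulmxBl -scalemxAl.
have h1 := dot_derive2 X Y V Bu.
have h2 := dot_phi_derive V Bu.
have h3 := gram_phi u V Bu.
apply: etrans (esym (gram_phi V V Bu)) _.
rewrite {1}DV; move: E h1 h2 h3; rewrite aE.
move: ('D_X ('D_Y phi) u) ('D_V phi u) ('D_u phi u) ('D_Z phi u) => p q r z ->.
rewrite !(dotDl, dotNl, dotZl) => h1 h2 h3; rewrite h3; rewrite h2 mulr0 add0r in h1.
rewrite h1 [cap_metric u u V]/cap_metric.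
have hd : dot u u = 1 - height u ^+ 2 by rewrite height2 //; lra.
rewrite hd; field.
by [].
Qed.

Let bvec u := phi u - 'D_u phi u.

(** The direction varies with the point, so the radial derivative is expanded in partial
    derivatives, with the coordinates of [v] as coefficients, and [derive2_phi] is applied to each
    of them. *)
Let is_derive_self u X : ball1 u ->
  is_derive u X (fun v => 'D_v phi v) ('D_X phi u + cap_metric u X u *: ('D_u phi u - phi u)).
Proof.
move=> Bu.
pose f := \sum_j (fun v : 'rV[R]_m => v 0 j *: 'D_(delta_mx 0 j) phi v).
have fE v : ball1 v -> f v = 'D_v phi v.
  move=> Bv; rewrite /f fct_sumE.
  exact: esym (derive_sum_delta v (Cn_diff (Cphi 0) Bv)).
apply: (near_eq_is_derive (open_near_eq oB fE Bu)).
have H : is_derive u X f (\sum_j (X 0 j *: 'D_(delta_mx 0 j) phi u +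
    u 0 j *: 'D_X ('D_(delta_mx 0 j) phi) u)).
  by apply: is_derive_sum => j; apply: is_derive_scale (ddphi _ _ Bu); apply: is_derive_coord.
apply: (is_derive_eq H); rewrite big_split /=; congr (_ + _).
  exact: esym (derive_sum_delta X (Cn_diff (Cphi 0) Bu)).
transitivity ((\sum_j u 0 j * cap_metric u X (delta_mx 0 j)) *: ('D_u phi u - phi u)).
  by rewrite scaler_suml; apply: eq_bigr => j _; rewrite derive2_phi // scalerA.
congr (_ *: _); rewrite /cap_metric.
have dE (v : 'rV[R]_m) : dot v u = \sum_j u 0 j * dot v (delta_mx 0 j).
  rewrite {1}(row_sum_delta u) /dot linear_sum mulmx_sumr summxE.
  by apply: eq_bigr => j _; rewrite linearZ /= -scalemxAr mxE.
rewrite [in RHS](dE X) [dot u u in RHS](dE u) mulr_sumr mulr_suml -big_split /=.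
apply: eq_bigr => j _; rewrite mulrDr; congr (_ + _).
by rewrite !mulrA (mulrC (dot u X)).
Qed.

(* With the metric of the round sphere and no second fundamental form, phi
   satisfies the same second order equation as cap.  The field
   height u (phi u - 'D_u phi u) is then constant, equal to phi 0, and what
   remains of phi after removing height u phi 0 is linear in u. *)
Lemma cap_rigidity : exists A, forall u, ball1 u -> phi u = cap A (phi 0) u.
Proof.
have du u : ball1 u -> differentiable phi u by exact: Cn_diff (Cphi 0).
pose c u := height u *: bvec u.
have dc u X : ball1 u -> is_derive u X c 0.
  move=> Bu; have wn : height u != 0 by rewrite gt_eqF ?height_gt0.
  have Hb := is_deriveB (dphi X Bu) (is_derive_self X Bu).
  have H := is_derive_scale (is_derive_height X Bu) Hb.
  apply: (is_derive_eq H); rewrite opprD addrA subrr add0r -scalerN opprB scalerA -scalerDl.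
  have -> : - dot u X / height u + height u * cap_metric u X u = 0; last by rewrite scale0r.
  have hd : dot u u = 1 - height u ^+ 2 by rewrite height2 //; lra.
  rewrite /cap_metric hd (dotC X u); field.
  by [].
have Dc u : ball1 u -> differentiable c u.
  move=> Bu; have Cb : Cn 0 ball1 c.
    have oB' := oB.
    apply: CnZl => //; first exact: Cn_height.
    apply: CnB => //.
    apply: (@Cn_ext _ _ _ _ _ (fun v => \sum_j v 0 j *: 'D_(delta_mx 0 j) phi v)) => //.
      by move=> v Bv; exact: esym (derive_sum_delta v (Cn_diff (Cphi 0) Bv)).
    by apply: Cn_sum => // j; apply: CnZl (CD _ _) => //; exact: Cn_coord.
  exact: Cn_diff Cb Bu.
have cE u : ball1 u -> c u = phi 0.
  move=> Bu; rewrite (derive0_star_cst (@ball1_star R m) Dc _ Bu); last first.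
    by move=> v X Bv; have [] := dc v X Bv.
  rewrite /c /bvec /height dot0l subr0 sqrtr1 scale1r deriveEjacobian ?mul0mx ?subr0 //.
  exact/du/ball1_0.
pose psi := phi \- cap 0 (phi 0).
have Cpsi k : Cn k ball1 psi.
  have oB' := oB.
  by apply: CnB => //; exact: Cn_cap.
have dpsi u X : ball1 u -> 'D_X psi u = 'D_X phi u - 'D_X (cap 0 (phi 0)) u.
  move=> Bu; apply: derive_val; apply: is_deriveB; first exact: dphi.
  exact: (Cn_derive X (Cn_cap 0 _ 0) Bu).
have ddpsi u X Y : ball1 u -> 'D_X ('D_Y psi) u = 0.
  move=> Bu; have wn : height u != 0 by rewrite gt_eqF ?height_gt0.
  have -> : 'D_X ('D_Y psi) u = 'D_X ('D_Y phi \- 'D_Y (cap 0 (phi 0))) u.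
    exact: (derive_ext X oB (fun u => @dpsi u Y) Bu).
  have [_ H] := is_deriveB (ddphi X Y Bu) (is_derive2_cap 0 (phi 0) X Y Bu).
  rewrite H derive2_phi // -(cE u Bu) /c /bvec scaleNr opprK scalerA divfK //.
  by rewrite -scalerDr addrC addrA subrK subrr scaler0.
have cst_dpsi u Y : ball1 u -> 'D_Y psi u = 'D_Y psi 0.
  move=> Bu; apply: (@derive0_star_cst _ _ ball1 _ ('D_Y psi) (@ball1_star R m) _ _ u Bu).
    by move=> v Bv; have C0 : Cn 0 ball1 ('D_Y psi) := (Cpsi 1).2 Y; exact: Cn_diff C0 Bv.
  by move=> v X; exact: ddpsi.
have dpsi0 : differentiable psi 0 by exact: Cn_diff (Cpsi 0) (@ball1_0 _ _).
exists ('J psi 0) => u Bu.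
have H : psi u - u *m 'J psi 0 = psi 0 - 0 *m 'J psi 0.
  apply: (@derive0_star_cst _ _ ball1 _ (psi \- mulmxr ('J psi 0)) (@ball1_star R m) _ _ u Bu).
    move=> v Bv; apply: differentiableB; first by exact: Cn_diff (Cpsi 0) Bv.
    exact: Cn_diff (Cn_mulmxr ('J psi 0) openT (Cn_id 0 openT)) _.
  move=> v X Bv.
  have [_ H] := is_deriveB (Cn_derive X (Cpsi 0) Bv) (is_derive_mulmxr ('J psi 0) (is_derive_id v X)).
  by apply: etrans H _; rewrite cst_dpsi // deriveEjacobian // subrr.
have psi0 : psi 0 = 0.
  by rewrite /psi /cap /= mul0mx add0r /height dot0l subr0 sqrtr1 scale1r subrr.
move: H; rewrite psi0 mul0mx subr0 => /eqP; rewrite subr_eq0 => /eqP H.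
by rewrite /cap -H /psi /cap /= mulmx0 add0r subrK.
Qed.

End Rigidity.

(** * Invariance of the geometric quantities under equality on an open set *)

Lemma is_derive_ext {R : realType} {m : nat} {W : normedModType R}
    (U : set 'rV[R]_m) (f g : 'rV[R]_m -> W) u X df :
  open U -> (forall u, U u -> f u = g u) -> U u ->
  is_derive u X f df -> is_derive u X g df.
Proof. by move=> oU fg Uu; apply: near_eq_is_derive (open_near_eq oU fg Uu). Qed.

Lemma mulmx_rV_inj {R : pzRingType} {m n : nat} (A B : 'M[R]_(m, n)) :
  (forall v : 'rV_m, v *m A = v *m B) -> A = B.
Proof. by move=> H; apply/row_matrixP => i; rewrite !rowE. Qed.

Section GeometryExt.
Context {R : realType} {m N : nat}.
Implicit Types (phi psi : 'rV[R]_m -> 'rV[R]_N) (U : set 'rV[R]_m).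

Lemma jacobian_ext U phi psi u : open U -> (forall u, U u -> phi u = psi u) ->
  U u -> differentiable phi u -> 'J phi u = 'J psi u.
Proof.
move=> oU E Uu dphi; have dpsi := differentiable_near_eq (open_near_eq oU E Uu) dphi.
apply: mulmx_rV_inj => v.
apply: etrans (esym (deriveEjacobian _ dphi)) (etrans _ (deriveEjacobian _ dpsi)).
exact: (derive_ext _ oU E Uu).
Qed.

Lemma dot_derive_gram phi u X Y : differentiable phi u ->
  dot ('D_X phi u) ('D_Y phi u) = (X *m gram phi u *m Y^T) 0 0.
Proof. by move=> du; rewrite !deriveEjacobian // /dot trmx_mul /gram !mulmxA. Qed.

Lemma gramE phi u i j : differentiable phi u ->
  gram phi u i j = dot ('D_(delta_mx 0 i) phi u) ('D_(delta_mx 0 j) phi u).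
Proof.
move=> du; rewrite dot_derive_gram // -rowE trmx_delta -colE !mxE //.
Qed.

Lemma gram_ext U phi psi u : open U -> (forall u, U u -> phi u = psi u) ->
  U u -> differentiable phi u -> gram phi u = gram psi u.
Proof. by move=> oU E Uu du; rewrite /gram (jacobian_ext oU E Uu du). Qed.

Lemma tangent_cone_ext U phi psi u : open U -> (forall u, U u -> phi u = psi u) ->
  U u -> differentiable phi u -> tangent_cone phi u = tangent_cone psi u.
Proof.
by move=> oU E Uu du; rewrite /tangent_cone (jacobian_ext oU E Uu du) E.
Qed.

Lemma second_ff_ext U phi psi u : open U -> (forall u, U u -> phi u = psi u) ->
  U u -> differentiable phi u -> second_ff phi u = second_ff psi u.
Proof.
move=> oU E Uu du; apply/funext => X; apply/funext => Y.
rewrite /second_ff /normal_proj /Defs.normal_space (tangent_cone_ext oU E Uu du).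
have H x : U x -> 'D_Y phi x = 'D_Y psi x by move=> Ux; exact: (derive_ext Y oU E Ux).
exact: (congr1 (fun z => z *m _) (derive_ext X oU H Uu)).
Qed.

End GeometryExt.

(** * Half spheres and linearity of totally geodesic inclusions *)

Section SpherePoints.
Context {R : realType} {k : nat}.
Implicit Types x y : sphere R k.

Lemma dot_spt x : dot (spt x) (spt x) = 1.
Proof. by have := set_valP x. Qed.

Lemma spt_inj : injective (@spt R k).
Proof. exact: val_inj. Qed.

Lemma spt_ex (v : 'rV[R]_k) : dot v v = 1 -> exists x, spt x = v.
Proof. by move=> v1; exists (exist _ v (mem_set v1)). Qed.

Lemma spt_delta_ex (i : 'I_k) : exists x : sphere R k, spt x = delta_mx 0 i.
Proof.
apply: spt_ex; rewrite dotE (bigD1 i) //= !mxE !eqxx mulr1.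
by rewrite big1 ?addr0 // => l li; rewrite !mxE (negbTE li) mulr0.
Qed.

Lemma spt_normalize (v : 'rV[R]_k) : v != 0 -> exists2 x, exists2 r : R, 0 < r & v = r *: spt x & True.
Proof.
move=> v0; have d0 : 0 < dot v v by rewrite lt_def dot_eq0 v0 dot_ge0.
have s0 : 0 < Num.sqrt (dot v v) by rewrite sqrtr_gt0.
have [x xE] : exists x, spt x = (Num.sqrt (dot v v))^-1 *: v.
  apply: spt_ex; rewrite dotZl dotZr mulrA -expr2 exprVn sqr_sqrtr ?mulVf ?gt_eqF //.
  exact: ltW.
exists x => //; exists (Num.sqrt (dot v v)) => //.
by rewrite xE scalerA mulfV ?scale1r // gt_eqF.
Qed.

Lemma hemi_chart i b : exists2 c, sphere_atlas R k c &
  dom c = ball1 /\ forall u, ball1 u -> spt (c u) = cap (hemi_La i) (hemi_ep i b) u.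
Proof.
(* [p0] is a default value for the chart map outside the unit ball. *)
have [p0 _] : exists x : sphere R k, spt x = hemi_ep i b by apply: spt_ex; exact: dot_hemi_ep.
have H u : exists x : sphere R k, ball1 u -> spt x = cap (hemi_La i) (hemi_ep i b) u.
  have [Bu|nBu] := pselect (ball1 u); last by exists p0.
  have [x xE] : exists x, spt x = cap (hemi_La i) (hemi_ep i b) u.
    by apply: spt_ex; apply: (dot_cap _ _ _ Bu);
      [exact: hemi_LaLa|exact: hemi_epLa|exact: dot_hemi_ep].
  by exists x.
have [c cE] := choice H.
exists (Param ball1 c) => //; split=> //=; exists i, b => u Bu.
by rewrite cE // hemisphereE.
Qed.

(** Forgetting the [i]-th coordinate inverts the chart: that coordinate is recovered from its sign
    and from the norm of [x]. *)
Lemma hemi_coords i (b : bool) (x : 'rV[R]_k) : dot x x = 1 -> 0 < (-1) ^+ b * x 0 i ->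
  ball1 (x *m (hemi_La i)^T) /\ cap (hemi_La i) (hemi_ep i b) (x *m (hemi_La i)^T) = x.
Proof.
move=> x1 xi; set u := _ *m _.
have LtL : (hemi_La i)^T *m hemi_La i = 1%:M - delta_mx i i :> 'M[R]_k.
  apply/matrixP => a c; rewrite !mxE.
  case: (unliftP i a) => [a' ->|->].
    rewrite (bigD1 a') //= !mxE eqxx mul1r big1 ?addr0 => [|l la]; last first.
      by rewrite !mxE (inj_eq lift_inj) (negbTE la) mul0r.
    by rewrite eq_sym (eq_sym _ i) (negbTE (neq_lift _ _)) /= subr0 eq_sym.
  rewrite big1 => [|l _]; last by rewrite !mxE eq_sym (negbTE (neq_lift _ _)) mul0r.
  by rewrite eqxx /= eq_sym subrr.
have uL : u *m hemi_La i = x - x 0 i *: delta_mx 0 i.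
  rewrite /u -mulmxA LtL mulmxBr mulmx1; congr (_ - _).
  apply/rowP => j; rewrite !mxE (bigD1 i) //= !mxE !eqxx /=.
  by rewrite big1 ?addr0 // => l li; rewrite !mxE (negbTE li) mulr0.
have uu : dot u u = 1 - x 0 i ^+ 2.
  rewrite -(dot_mulmx_id u u (hemi_LaLa i)) uL !(dotBl, dotBr) !(dotZl, dotZr) x1.
  have -> : dot x (delta_mx 0 i) = x 0 i.
    rewrite dotE (bigD1 i) //= !mxE !eqxx mulr1 big1 ?addr0 // => l li.
    by rewrite !mxE (negbTE li) mulr0.
  have -> : dot (delta_mx 0 i) x = x 0 i.
    rewrite dotE (bigD1 i) //= !mxE !eqxx mul1r big1 ?addr0 // => l li.
    by rewrite !mxE (negbTE li) mul0r.
  have -> : dot (delta_mx 0 i) (delta_mx 0 i) = 1 :> R.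
    rewrite dotE (bigD1 i) //= !mxE !eqxx mul1r big1 ?addr0 // => l li.
    by rewrite !mxE (negbTE li) mul0r.
  ring.
have xn : x 0 i != 0 by apply: contraTneq xi => ->; rewrite mulr0 ltxx.
have Bu : ball1 u by rewrite /ball1 /= uu gtrBl exprn_even_gt0.
split=> //; rewrite /cap uL /height uu opprB addrCA subrr addr0 sqrtr_sqr.
rewrite /hemi_ep scalerA.
have -> : `|x 0 i| * (-1) ^+ b = x 0 i.
  move: xi; case: b => /=; rewrite ?expr1 ?expr0 ?mul1r ?mulr1 ?mulN1r ?mulrN1 // => xi.
    by rewrite ltr0_norm ?opprK // -oppr_gt0.
  by rewrite gtr0_norm.
by rewrite subrK.
Qed.

End SpherePoints.

(** The cone over the intersection of two half spheres with different axes spans the space: it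
    contains [x0], the sum of the two signed axis vectors, and also [x0] plus each basis vector,
    with the sign [s] chosen so that neither of the two conditions is spoiled. *)
Lemma hemi_ext {R : realType} {k N : nat} (L1 L2 : 'M[R]_(k, N)) (i j : 'I_k) (b c : bool) :
  i != j ->
  (forall x : sphere R k, 0 < (-1) ^+ b * spt x 0 i -> 0 < (-1) ^+ c * spt x 0 j ->
    spt x *m L1 = spt x *m L2) -> L1 = L2.
Proof.
move=> ij H.
have Hv (v : 'rV[R]_k) : 0 < (-1) ^+ b * v 0 i -> 0 < (-1) ^+ c * v 0 j -> v *m L1 = v *m L2.
  move=> vi vj; have v0 : v != 0.
    by apply: contraTneq vi => ->; rewrite mxE mulr0 ltxx.
  have [x [r r0 vE] _] := spt_normalize v0.
  rewrite vE -!scalemxAl H //; [move: vi|move: vj];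
    by rewrite vE mxE mulrCA pmulr_rgt0.
pose x0 : 'rV[R]_k := (-1) ^+ b *: delta_mx 0 i + (-1) ^+ c *: delta_mx 0 j.
have x0i : (-1) ^+ b * x0 0 i = 1.
  by rewrite !mxE !eqxx (negbTE ij) mulr0 addr0 mulr1 -expr2 sqrr_sign.
have x0j : (-1) ^+ c * x0 0 j = 1.
  by rewrite !mxE !eqxx eq_sym (negbTE ij) mulr0 add0r mulr1 -expr2 sqrr_sign.
have Hx0 : x0 *m L1 = x0 *m L2 by apply: Hv; rewrite ?x0i ?x0j.
apply/row_matrixP => l; rewrite !rowE.
pose s : R := if l == i then (-1) ^+ b else (-1) ^+ c.
have s2 : s * s = 1 by rewrite /s; case: ifP => _; rewrite -expr2 sqrr_sign.
have : (x0 + s *: delta_mx 0 l) *m L1 = (x0 + s *: delta_mx 0 l) *m L2.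
  apply: Hv; rewrite mxE mulrDr ?x0i ?x0j ltr_wpDr //; rewrite !mxE eqxx /=.
    rewrite eq_sym /s; case: eqP => _; last by rewrite !mulr0.
    by rewrite mulr1 -expr2 sqrr_sign.
  rewrite eq_sym /s; case: eqP => [->|_]; first by rewrite (negbTE ij) !mulr0.
  by rewrite mulrA -expr2 sqrr_sign mul1r ler0n.
rewrite 2!(mulmxDl x0) Hx0 => /addrI; rewrite -!scalemxAl => E.
by rewrite -[LHS]scale1r -[RHS]scale1r -s2 -!scalerA E.
Qed.

(** The matrix [La^T *m A + ep^T *m e] sends the orthonormal rows of [La] and [ep] to those of [A]
    and [e]. Thus a map of the form [cap A e], as rigidity provides, is linear in the point of the
    half sphere. *)
Lemma cap_mulmx {R : realType} {m k N : nat} (La : 'M[R]_(m, k)) (ep : 'rV[R]_k)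
    (A : 'M[R]_(m, N)) (e : 'rV[R]_N) u :
  La *m La^T = 1%:M -> ep *m La^T = 0 -> dot ep ep = 1 ->
  cap La ep u *m (La^T *m A + ep^T *m e) = cap A e u.
Proof.
move=> LL Le ee; have eL : La *m ep^T = 0 by rewrite -[LHS]trmxK trmx_mul trmxK Le trmx0.
have e1 : ep *m ep^T = 1%:M by rewrite [LHS]mx11_scalar -/(dot _ _) ee.
rewrite /cap mulmxDr !mulmxDl -!scalemxAl; congr (_ + _).
  by rewrite !mulmxA Le -(mulmxA u) LL mulmx1 mul0mx scaler0 addr0.
by rewrite !mulmxA e1 mul1mx -(mulmxA u) eL mulmx0 mul0mx add0r.
Qed.

(** Rigidity gives one matrix for each half sphere x_i > 0 or x_i < 0. Half spheres with different
    axes overlap enough for [hemi_ext] to identify their matrices; the two opposite ones with the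
    same axis are disjoint and are compared through a second axis, which exists because [1 < k]. *)
Lemma totally_geodesic_linear {R : realType} {k N : nat} (iota : 'rV[R]_k -> 'rV[R]_N) :
  (1 < k)%N -> totally_geodesic_inclusion iota ->
  exists2 L : 'M[R]_(k, N), L *m L^T = 1%:M &
    forall x : sphere R k, iota (spt x) = spt x *m L.
Proof.
move=> k1 [unit_f _ [smooth_f gram_f] flat_f]; set f := _ \o _ in unit_f smooth_f gram_f flat_f.
have local i (b : bool) : exists L : 'M[R]_(k, N), forall x : sphere R k,
    0 < (-1) ^+ b * spt x 0 i -> f x = spt x *m L.
  have [c Ac [dc cE]] := @hemi_chart R k i b.
  have sf := smooth_f c Ac; rewrite dc in sf.
  have Cf := (smooth_onP _ _).1 sf.
  have oB := @open_ball1 R k.-1.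
  have Cs := Cn_cap (@hemi_La R k i) (hemi_ep i b).
  have [A AE] : exists A, forall u, ball1 u -> (f \o c) u = cap A ((f \o c) 0) u.
    apply: cap_rigidity => //.
    - by move=> u Bu; exact: unit_f.
    - move=> u X Y Bu; rewrite (dot_derive_gram _ _ (Cn_diff (Cf 0%N) Bu)).
      rewrite gram_f // ?dc //.
      rewrite -(gram_ext oB (fun u Bu => esym (cE u Bu)) Bu (Cn_diff (Cs 0%N) Bu)).
      rewrite -dot_derive_gram; last exact: Cn_diff (Cs 0%N) Bu.
      by apply: dot_derive_cap => //; [exact: hemi_LaLa|exact: hemi_epLa|exact: dot_hemi_ep].
    by move=> u X Y Bu; apply: flat_f; rewrite // dc.
  exists ((hemi_La i)^T *m A + (hemi_ep i b)^T *m (f \o c) 0) => x xi.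
  have [Bu xE] := hemi_coords (dot_spt x) xi.
  set u := _ *m _ in Bu xE.
  have -> : x = c u by apply: spt_inj; rewrite cE.
  rewrite -[LHS]/((f \o c) u) AE // cE // cap_mulmx //;
    [exact: hemi_LaLa|exact: hemi_epLa|exact: dot_hemi_ep].
have [L LE] : exists L : 'I_k * bool -> 'M[R]_(k, N), forall (ib : 'I_k * bool) (x : sphere R k),
    0 < (-1) ^+ ib.2 * spt x 0 ib.1 -> f x = spt x *m L ib.
  by have [L LE] := choice (fun ib : 'I_k * bool => local ib.1 ib.2); exists L.
have Leq i (b : bool) j (c : bool) : i != j -> L (i, b) = L (j, c).
  move=> ij; apply: (hemi_ext ij (b := b) (c := c)) => x xi xj.
  by rewrite -(LE (i, b)) // -(LE (j, c)).
have i0 : 'I_k := Ordinal (ltnW k1).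
have [j0 j0i0] : exists j0 : 'I_k, j0 != i0.
  have [e|ne] := eqVneq i0 (Ordinal (ltnW k1)); last by exists (Ordinal (ltnW k1)); rewrite eq_sym.
  by exists (Ordinal k1); rewrite e.
have Lall i (b : bool) : L (i, b) = L (i0, false).
  have [->|ii0] := eqVneq i i0; last exact: Leq.
  by rewrite (Leq i0 b j0 false) 1?eq_sym // (Leq j0 false i0 false).
have fE x : f x = spt x *m L (i0, false).
  have /eqP xn : spt x != 0.
    by apply/eqP => x0; have := dot_spt x; rewrite x0 dot0l => /eqP; rewrite eq_sym oner_eq0.
  have [i xi] : exists i, spt x 0 i != 0.
    apply/existsP; apply: contra_notT xn => /existsPn H; apply/rowP => i.
    by rewrite mxE; apply/eqP; have := H i; rewrite negbK.
  case: (ltgtP (spt x 0 i) 0) xi => // [xi|xi] _.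
    by rewrite (LE (i, true)) ?Lall //= expr1 mulN1r oppr_gt0.
  by rewrite (LE (i, false)) ?Lall //= expr0 mul1r.
exists (L (i0, false)) => //; set M := L _.
(* Norms are preserved on the sphere, then everywhere by scaling; polarization passes to inner
   products. *)
have M1 v : dot (v *m M) (v *m M) = dot v v.
  have [->|v0] := eqVneq v 0; first by rewrite mul0mx !dot0l.
  have [x [r r0 ->] _] := spt_normalize v0.
  by rewrite -scalemxAl !dotZl !dotZr -fE unit_f dot_spt.
have M2 v w : dot (v *m M) (w *m M) = dot v w.
  have := M1 (v + w); rewrite mulmxDl !(dotDl, dotDr) !M1.
  by rewrite (dotC (w *m M)) (dotC w) => H; lra.
apply: mulmx_rV_inj => v; apply: dot_inj => w.
by rewrite mulmxA mulmx1 dotC -dot_mulmx M2 dotC.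
Qed.

(** * Frames and the fundamental matrix *)

(** Two triangular reductions of the same block matrix [K]: one shows that its determinant is
    [char_poly (M *m P)], the other that ['X^n] times it is ['X^q * char_poly (P *m M)]. It reduces
    the spectrum of a fundamental matrix of any size to that of a small diagonal matrix. *)
Lemma char_poly_mulmxC {R : comNzRingType} {q n : nat} (M : 'M[R]_(q, n)) (P : 'M[R]_(n, q)) :
  'X^n * char_poly (M *m P) = 'X^q * char_poly (P *m M).
Proof.
pose M' := map_mx polyC M; pose P' := map_mx polyC P.
pose K : 'M[{poly R}]_(q + n) := block_mx 'X%:M M' P' 1%:M.
have K1 : K *m block_mx 1%:M 0 (- P') 1%:M = block_mx (char_poly_mx (M *m P)) M' 0 1%:M.
  rewrite mulmx_block !mulmx1 !mulmx0 !add0r mul1mx subrr /char_poly_mx map_mxM.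
  by rewrite mulmxN.
have K2 : block_mx 1%:M 0 (- P') 'X%:M *m K = block_mx 'X%:M M' 0 (char_poly_mx (P *m M)).
  rewrite mulmx_block !mul1mx !mul0mx !addr0 mulmx1 /char_poly_mx map_mxM.
  rewrite mulNmx mul_mx_scalar mul_scalar_mx addNr addrC; congr block_mx.
  by rewrite mulNmx.
have d1 : \det K = char_poly (M *m P).
  have := congr1 determinant K1.
  by rewrite det_mulmx det_lblock det_ublock !det1 !mulr1.
have := congr1 determinant K2.
by rewrite det_mulmx det_lblock det_ublock det1 mul1r !det_scalar d1.
Qed.

(** Gram-Schmidt by dimension count: as long as [k] is less than the rank of [V], the row space of
    [V] meets the orthogonal of the rows already found, and a normalized vector of the intersection
    is added. *)
Lemma orthonormal_rows {R : realType} {p N : nat} (V : 'M[R]_(p, N)) k :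
  (k <= \rank V)%N ->
  exists2 nu : 'M[R]_(k, N), nu *m nu^T = 1%:M & (nu <= V)%MS.
Proof.
elim: k => [|k IH] kV.
  by exists 0; [apply/matrixP => -[]|exact: sub0mx].
have [nu nu1 nuV] := IH (ltnW kV).
pose W := (V :&: kermx nu^T)%MS.
have W0 : W != 0.
  rewrite -mxrank_eq0 -lt0n -(ltn_add2l (\rank (V *m nu^T))) mxrank_mul_ker addn0.
  exact: leq_ltn_trans (rank_leq_col _) kV.
pose v := nz_row W.
have v0 : v != 0 by rewrite nz_row_eq0.
have /andP[vV vk] : ((v <= V) && (v <= kermx nu^T))%MS by rewrite -sub_capmx nz_row_sub.
have [x [r r0 vE] _] := spt_normalize v0.
have xv : spt x = r^-1 *: v by rewrite vE scalerA mulVf ?scale1r ?gt_eqF.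
have xnu : spt x *m nu^T = 0 by apply/sub_kermxP; rewrite xv scalemx_sub.
have H1 : col_mx (spt x) nu *m (col_mx (spt x) nu)^T = 1%:M :> 'M[R]_(1 + k).
  rewrite tr_col_mx mul_col_row xnu nu1.
  have -> : nu *m (spt x)^T = 0 by rewrite -[LHS]trmxK trmx_mul trmxK xnu trmx0.
  have -> : spt x *m (spt x)^T = 1%:M by rewrite [LHS]mx11_scalar -/(dot _ _) dot_spt.
  by rewrite -scalar_mx_block.
have H2 : (col_mx (spt x) nu <= V)%MS by rewrite col_mx_sub nuV xv scalemx_sub.
by exists (col_mx (spt x) nu).
Qed.

Lemma normal_frame_ex {R : realType} {m N q : nat} (phi : 'rV[R]_m -> 'rV[R]_N) u :
  \rank (Defs.normal_space phi u) = q ->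
  exists nu : 'M[R]_(q, N), normal_frame phi u nu.
Proof.
move=> rk; have [nu nu1 nuN] := @orthonormal_rows _ _ _ (Defs.normal_space phi u) q (eq_leq (esym rk)).
exists nu; split=> //; apply/andP; split=> //.
suff rnu : \rank nu = q by have := mxrank_leqif_sup nuN; rewrite rnu rk => -[_ <-].
apply/eqP; rewrite eqn_leq rank_leq_row /=.
have := mxrankM_maxl nu nu^T; rewrite nu1 mxrank1 //.
Qed.

Lemma dot_suml {R : realType} {N : nat} {I : Type} (r : seq I) (P : pred I)
    (f : I -> 'rV[R]_N) v :
  dot (\sum_(i <- r | P i) f i) v = \sum_(i <- r | P i) dot (f i) v.
Proof. by rewrite /dot mulmx_suml summxE. Qed.

Section Frames.
Context {R : realType} {m N : nat} (phi : 'rV[R]_m -> 'rV[R]_N) (U : set 'rV[R]_m).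
Hypothesis oU : open U.
Hypothesis Cphi : Cn 1 U phi.
Variables (u : 'rV[R]_m) (Uu : U u).

Let e (i : 'I_m) : 'rV[R]_m := delta_mx 0 i.

Lemma derive2_sum X Y :
  'D_X ('D_Y phi) u = \sum_i \sum_j (X 0 i * Y 0 j) *: 'D_(e i) ('D_(e j) phi) u.
Proof.
have C0 j : Cn 0 U ('D_(e j) phi) := Cphi.2 (e j).
have H v : U v -> (\sum_j (Y 0 j \*: 'D_(e j) phi)) v = 'D_Y phi v.
  by move=> Uv; rewrite fct_sumE; exact: esym (derive_sum_delta Y (Cn_diff Cphi Uv)).
have H2 : is_derive u X (\sum_j (Y 0 j \*: 'D_(e j) phi)) (\sum_j Y 0 j *: 'D_X ('D_(e j) phi) u).
  by apply: is_derive_sum => j; apply: is_deriveZ; exact: Cn_derive (C0 j) Uu.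
have [_ H3] := is_derive_ext oU H Uu H2.
apply: etrans H3 _; rewrite exchange_big /=; apply: eq_bigr => j _.
rewrite (derive_sum_delta X (Cn_diff (C0 j) Uu)) scaler_sumr.
by apply: eq_bigr => i _; rewrite scalerA mulrC.
Qed.

Lemma second_ff_sum X Y :
  second_ff phi u X Y = \sum_i \sum_j (X 0 i * Y 0 j) *: second_ff phi u (e i) (e j).
Proof.
rewrite /second_ff derive2_sum mulmx_suml; apply: eq_bigr => i _.
by rewrite mulmx_suml; apply: eq_bigr => j _; rewrite -scalemxAl.
Qed.

Lemma shape_mxE (E : 'M[R]_m) xi :
  shape_mx phi u E xi = E *m shape_mx phi u 1%:M xi *m E^T.
Proof.
apply/matrixP => a b; rewrite mxE second_ff_sum dot_suml [RHS]mxE.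
under [RHS]eq_bigr do rewrite mxE big_distrl /=.
rewrite [RHS]exchange_big /=; apply: eq_bigr => i _; rewrite dot_suml.
apply: eq_bigr => j _; rewrite dotZl !mxE !row1 mulrAC.
by [].
Qed.

(** Two orthonormal tangent frames differ by an orthogonal matrix [P], which conjugates all shape
    matrices at once and leaves the traces of their products unchanged. The spectrum may thus be
    computed in one adapted frame. *)
Lemma fundamental_mx_frame {q : nat} (E E0 : 'M[R]_m) (nu : 'M[R]_(q, N)) :
  tangent_frame phi u E -> tangent_frame phi u E0 ->
  fundamental_mx phi u E nu = fundamental_mx phi u E0 nu.
Proof.
rewrite /tangent_frame => tE tE0.
have u0 : E0 \in unitmx by have [] := mulmx1_unit (etrans (mulmxA _ _ _) tE0).
pose P := E *m invmx E0.
have EP : E = P *m E0 by rewrite /P mulmxKV.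
have F_mulmxE : gram phi u = invmx E0 *m (invmx E0)^T.
  have ut0 : E0^T \in unitmx by rewrite unitmx_tr.
  by rewrite trmx_inv -[LHS](mulKmx u0) -[E0 *m _ in LHS](mulmxK ut0) tE0 mul1mx.
have PP : P *m P^T = 1%:M.
  by rewrite /P trmx_mul mulmxA -(mulmxA E) -F_mulmxE.
have PtP : P^T *m P = 1%:M by apply: mulmx1C.
have SE xi : shape_mx phi u E xi = P *m shape_mx phi u E0 xi *m P^T.
  by rewrite shape_mxE EP [shape_mx _ _ E0 _]shape_mxE trmx_mul !mulmxA.
clearbody P; apply/matrixP => a b; rewrite [LHS]mxE [RHS]mxE !SE.
move: (shape_mx phi u E0 _) (shape_mx phi u E0 _) => S S'.
rewrite !trmx_mul trmxK !mulmxA -(mulmxA _ P^T P) PtP mulmx1.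
by rewrite mxtrace_mulC !mulmxA PtP mul1mx.
Qed.

(** For an orthonormal frame [E] the inverse of the Gram matrix is [E^T *m E], which turns the
    contraction with the inverse metric into a trace over the frame. *)
Lemma mean_curvature_frame (E : 'M[R]_m) : tangent_frame phi u E ->
  mean_curvature phi u = \sum_a second_ff phi u (row a E) (row a E).
Proof.
rewrite /tangent_frame => tE.
have uE : E \in unitmx by have [] := mulmx1_unit (etrans (mulmxA _ _ _) tE).
have iG : invmx (gram phi u) = E^T *m E.
  have /mulmx1C H : (E *m gram phi u) *m E^T = 1%:M by [].
  rewrite mulmxA in H; have [_ uG] := mulmx1_unit H.
  by rewrite -[RHS](mulmxK uG) H mul1mx.
rewrite /mean_curvature iG.
under [RHS]eq_bigr do rewrite second_ff_sum.
rewrite [RHS]exchange_big /=; apply: eq_bigr => i _.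
rewrite [RHS]exchange_big /=; apply: eq_bigr => j _.
have -> : (E^T *m E) i j = \sum_a row a E 0 i * row a E 0 j.
  by rewrite mxE; apply: eq_bigr => a _; rewrite !mxE.
exact: scaler_suml.
Qed.

End Frames.

(** * The local form of the immersions *)

(** Multiplication of the frame [A] by exp(it), with [B] in the role of iA. Differentiation in [t]
    replaces (A, B) by (B, -A), so all derivatives keep this form. *)
Definition rotmx {R : realType} {p N : nat} (A B : 'M[R]_(p, N)) (t : R) : 'M[R]_(p, N) :=
  cos t *: A + sin t *: B.

Definition angle {R : realType} {m : nat} (v : 'rV[R]_(1 + m)) : R := lsubmx v 0 0.

Lemma rot_mul_tr {R : realType} {p p' N : nat} (A B : 'M[R]_(p, N)) (C D : 'M[R]_(p', N)) t t' :
  rotmx A B t *m (rotmx C D t')^T =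
  (cos t * cos t') *: (A *m C^T) + (cos t * sin t') *: (A *m D^T) +
  ((sin t * cos t') *: (B *m C^T) + (sin t * sin t') *: (B *m D^T)).
Proof.
rewrite /rotmx [(_ + _)^T]linearD /= ![(_ *: _)^T]linearZ /= mulmxDl !mulmxDr.
by rewrite -!scalemxAl -!scalemxAr !scalerA.
Qed.

Lemma rotN {R : realType} {p N : nat} (A B : 'M[R]_(p, N)) t :
  rotmx (- A) (- B) t = - rotmx A B t.
Proof. by rewrite /rotmx !scalerN opprD. Qed.

Lemma is_derive_rot {R : realType} {m p N : nat} (A B : 'M[R]_(p, N)) (l : R)
    (v X : 'rV[R]_(1 + m)) :
  is_derive v X (fun v => rotmx A B (l * angle v))
    ((l * angle X) *: rotmx B (- A) (l * angle v)).
Proof.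
have aE (w : 'rV[R]_(1 + m)) : angle w = w 0 (lshift m 0) by rewrite /angle mxE.
have H1 : is_derive v X (fun v => l * angle v) (l * angle X).
  rewrite aE; under eq_fun do rewrite aE.
  exact: (is_deriveZ l (is_derive_coord v X 0 (lshift m 0))).
have D1 : differentiable (fun v => l * angle v) v.
  under eq_fun do rewrite aE.
  exact: Cn_diff (CnZ l openT (Cn_coord 0 0 (lshift m 0) openT)) _.
have [_ H2] := is_derive_comp1 D1 H1 (is_derive_cos (l * angle v)).
have [_ H3] := is_derive_comp1 D1 H1 (is_derive_sin (l * angle v)).
have H := is_deriveD (is_derive_scale H2 (is_derive_cst A v X))
  (is_derive_scale H3 (is_derive_cst B v X)).
apply: (is_derive_eq H); rewrite !scaler0 !addr0 /rotmx scalerDr !scalerA scalerN.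
by rewrite addrC [cos _ * _]mulrC -scaleNr -mulNr [- sin _ * _]mulrC mulrN mulNr.
Qed.

Lemma Cn_rot {R : realType} {m N : nat} k (U : set 'rV[R]_(1 + m)) (f g : 'rV[R]_(1 + m) -> 'rV[R]_N) (l : R) :
  open U -> Cn k U f -> Cn k U g -> Cn k U (fun v => rotmx (f v) (g v) (l * angle v)).
Proof.
move=> oU Cf Cg.
have Ca : Cn k U (fun v => l * angle v).
  apply: (@Cn_ext _ _ _ _ _ (fun v => l * v 0 (lshift m 0))) => //.
    by move=> v _; rewrite /angle mxE.
  by apply: CnZ => //; exact: Cn_coord.
by apply: CnD => //; apply: CnZl => //; [exact: Cn_cos|exact: Cn_sin].
Qed.

(** The 2n + 2 rows are orthonormal; the condition is split into blocks because inner products are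
    later evaluated block against block. *)
Record orthoframe {R : realType} {n N : nat} (p0 q0 : 'rV[R]_N) (P Q : 'M[R]_(n, N)) : Prop :=
  Orthoframe {
    of_pp : p0 *m p0^T = 1%:M; of_qq : q0 *m q0^T = 1%:M; of_pq : p0 *m q0^T = 0;
    of_PP : P *m P^T = 1%:M; of_QQ : Q *m Q^T = 1%:M; of_PQ : P *m Q^T = 0;
    of_pP : p0 *m P^T = 0; of_pQ : p0 *m Q^T = 0; of_qP : q0 *m P^T = 0; of_qQ : q0 *m Q^T = 0 }.

Lemma trmxN {R : realType} {p N : nat} (A : 'M[R]_(p, N)) : (- A)^T = - A^T.
Proof. exact: linearN. Qed.

Lemma mulmx_tr0 {R : realType} {p p' N : nat} (A : 'M[R]_(p, N)) (B : 'M[R]_(p', N)) :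
  A *m B^T = 0 -> B *m A^T = 0.
Proof. by move=> AB; rewrite -[LHS]trmxK trmx_mul trmxK AB trmx0. Qed.

Lemma rot_diag1 {R : realType} {p N : nat} (A B : 'M[R]_(p, N)) t :
  A *m A^T = 1%:M -> B *m B^T = 1%:M -> A *m B^T = 0 ->
  rotmx A B t *m (rotmx A B t)^T = 1%:M.
Proof.
move=> AA BB AB; rewrite rot_mul_tr AA BB AB (mulmx_tr0 AB) !scaler0 addr0 add0r -scalerDl.
by rewrite -!expr2 cos2Dsin2 scale1r.
Qed.

Lemma rot_diag0 {R : realType} {p N : nat} (A B : 'M[R]_(p, N)) t :
  A *m A^T = 1%:M -> B *m B^T = 1%:M -> A *m B^T = 0 ->
  rotmx A B t *m (rotmx B (- A) t)^T = 0.
Proof.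
move=> AA BB AB; rewrite rot_mul_tr trmxN !mulmxN AA BB AB (mulmx_tr0 AB).
rewrite oppr0 !scaler0 add0r addr0 scalerN.
by rewrite mulrC addNr.
Qed.

Lemma rot_cross {R : realType} {p p' N : nat} (A B : 'M[R]_(p, N)) (C D : 'M[R]_(p', N)) t t' :
  A *m C^T = 0 -> A *m D^T = 0 -> B *m C^T = 0 -> B *m D^T = 0 ->
  rotmx A B t *m (rotmx C D t')^T = 0.
Proof. by move=> h1 h2 h3 h4; rewrite rot_mul_tr h1 h2 h3 h4 !scaler0 !addr0. Qed.

(** The angles are independent because the two factors of the immersion turn at the different speeds
    [l0] and [l1]. *)
Lemma orthoframe_rot {R : realType} {n N : nat} (p0 q0 : 'rV[R]_N) (P Q : 'M[R]_(n, N)) t t' :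
  orthoframe p0 q0 P Q ->
  orthoframe (rotmx p0 q0 t) (rotmx q0 (- p0) t) (rotmx P Q t') (rotmx Q (- P) t').
Proof.
move=> [pp qq pq PP QQ PQ pP pQ qP qQ1].
have negneg (p p' : nat) (A : 'M[R]_(p, N)) (B : 'M[R]_(p', N)) : (- A) *m (- B)^T = A *m B^T.
  by rewrite trmxN mulmxN mulNmx opprK.
have negr0 (p p' : nat) (A : 'M[R]_(p, N)) (B : 'M[R]_(p', N)) : A *m B^T = 0 -> A *m (- B)^T = 0.
  by move=> AB; rewrite trmxN mulmxN AB oppr0.
have negl0 (p p' : nat) (A : 'M[R]_(p, N)) (B : 'M[R]_(p', N)) : A *m B^T = 0 -> (- A) *m B^T = 0.
  by move=> AB; rewrite mulNmx AB oppr0.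
split.
- exact: rot_diag1.
- by apply: rot_diag1; rewrite ?negneg //; apply/negr0/mulmx_tr0.
- exact: rot_diag0.
- exact: rot_diag1.
- by apply: rot_diag1; rewrite ?negneg //; apply/negr0/mulmx_tr0.
- exact: rot_diag0.
- exact: rot_cross.
- by apply: rot_cross => //; apply: negr0.
- by apply: rot_cross => //; apply: negl0.
- by apply: rot_cross; rewrite ?negneg //; [apply: negr0|apply: negl0].
Qed.

Section OrthoframeDot.
Context {R : realType} {n N : nat} (p q : 'rV[R]_N) (P Q : 'M[R]_(n, N)).
Hypothesis F : orthoframe p q P Q.
Implicit Types y z : 'rV[R]_n.

Lemma of_dot_pp : dot p p = 1. Proof. by rewrite /dot (of_pp F) mxE. Qed.
Lemma of_dot_qq : dot q q = 1. Proof. by rewrite /dot (of_qq F) mxE. Qed.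
Lemma of_dot_pq : dot p q = 0. Proof. by rewrite /dot (of_pq F) mxE. Qed.
Lemma of_dot_qp : dot q p = 0. Proof. by rewrite dotC of_dot_pq. Qed.
Lemma of_dot_PP y z : dot (y *m P) (z *m P) = dot y z.
Proof. by apply: dot_mulmx_id; exact: of_PP F. Qed.
Lemma of_dot_QQ y z : dot (y *m Q) (z *m Q) = dot y z.
Proof. by apply: dot_mulmx_id; exact: of_QQ F. Qed.
Lemma of_dot_PQ y z : dot (y *m P) (z *m Q) = 0.
Proof. by rewrite /dot trmx_mul mulmxA -(mulmxA y) (of_PQ F) mulmx0 mul0mx mxE. Qed.
Lemma of_dot_QP y z : dot (y *m Q) (z *m P) = 0.
Proof. by rewrite dotC of_dot_PQ. Qed.
Lemma of_dot_pP y : dot p (y *m P) = 0.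
Proof. by rewrite /dot trmx_mul mulmxA (of_pP F) mul0mx mxE. Qed.
Lemma of_dot_Pp y : dot (y *m P) p = 0. Proof. by rewrite dotC of_dot_pP. Qed.
Lemma of_dot_pQ y : dot p (y *m Q) = 0.
Proof. by rewrite /dot trmx_mul mulmxA (of_pQ F) mul0mx mxE. Qed.
Lemma of_dot_Qp y : dot (y *m Q) p = 0. Proof. by rewrite dotC of_dot_pQ. Qed.
Lemma of_dot_qP y : dot q (y *m P) = 0.
Proof. by rewrite /dot trmx_mul mulmxA (of_qP F) mul0mx mxE. Qed.
Lemma of_dot_Pq y : dot (y *m P) q = 0. Proof. by rewrite dotC of_dot_qP. Qed.
Lemma of_dot_qQ y : dot q (y *m Q) = 0.
Proof. by rewrite /dot trmx_mul mulmxA (of_qQ F) mul0mx mxE. Qed.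
Lemma of_dot_Qq y : dot (y *m Q) q = 0. Proof. by rewrite dotC of_dot_qQ. Qed.

Definition of_dots := (of_dot_pp, of_dot_qq, of_dot_pq, of_dot_qp, of_dot_PP,
  of_dot_QQ, of_dot_PQ, of_dot_QP, of_dot_pP, of_dot_Pp, of_dot_pQ, of_dot_Qp,
  of_dot_qP, of_dot_Pq, of_dot_qQ, of_dot_Qq).

End OrthoframeDot.

Definition dot_lin := (@dotDl, @dotDr, @dotNl, @dotNr, @dotZl, @dotZr).

Lemma dot_comb0 {R : realType} {n : nat} (d1 d2 y : 'rV[R]_n) (t1 t2 : R) :
  dot d1 y = 0 -> dot d2 y = 0 -> dot (t1 *: d1 + t2 *: d2) y = 0.
Proof. by move=> h1 h2; rewrite dotDl !dotZl h1 h2 !mulr0 addr0. Qed.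

(** * First and second fundamental forms of the local expression *)

Section Torus.
Context {R : realType} {m n N : nat}.
Variables (La : 'M[R]_(m, n)) (ep : 'rV[R]_n) (l0 l1 r s : R).
Variables (a b : 'rV[R]_N) (A B : 'M[R]_(n, N)).
Hypothesis LL : La *m La^T = 1%:M.
Hypothesis Le : ep *m La^T = 0.
Hypothesis ee : dot ep ep = 1.
Hypothesis Fab : orthoframe a b A B.
Hypothesis rs1 : r ^+ 2 + s ^+ 2 = 1.
Implicit Types u v X Y : 'rV[R]_(1 + m).

Definition torus v : 'rV[R]_N :=
  r *: rotmx a b (l0 * angle v) + s *: (cap La ep (rsubmx v) *m rotmx A B (l1 * angle v)).

Definition torus_dom : set 'rV[R]_(1 + m) := [set v | ball1 (rsubmx v)].

Lemma open_torus_dom : open torus_dom.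
Proof.
apply: (@open_comp _ _ (rsubmx : 'rV[R]_(1 + m) -> 'rV[R]_m)); last exact: open_ball1.
by move=> v _; exact/differentiable_continuous/differentiable_rsubmx.
Qed.

Let oU := open_torus_dom.

Lemma Cn_torus k : Cn k torus_dom torus.
Proof.
have oU' := oU.
have Cc : Cn k torus_dom (cap La ep \o rsubmx).
  by apply: Cn_rsubmx; [exact: open_ball1|exact: Cn_cap].
have C1 : Cn k torus_dom (fun v => rotmx a b (l0 * angle v)).
  by apply: (Cn_rot (f := cst a) (g := cst b)) => //; exact: Cn_cst.
have C2 : Cn k torus_dom (fun v => rotmx (cap La ep (rsubmx v) *m A) (cap La ep (rsubmx v) *m B) (l1 * angle v)).
  by apply: (@Cn_rot _ _ _ _ _ (fun v => cap La ep (rsubmx v) *m A) (fun v => cap La ep (rsubmx v) *m B)) => //; exact: Cn_mulmxr.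
apply: (@Cn_ext _ _ _ _ _ ((fun v => cst r v *: rotmx a b (l0 * angle v)) \+ (fun v => cst s v *:
  rotmx (cap La ep (rsubmx v) *m A) (cap La ep (rsubmx v) *m B) (l1 * angle v)))) => //.
  by move=> v _; rewrite /torus /rotmx /= mulmxDr !scalemxAr.
by apply: CnD => //; apply: CnZl => //; exact: Cn_cst.
Qed.

Let x v := cap La ep (rsubmx v).
Let dx X v := 'D_(rsubmx X) (cap La ep) (rsubmx v).
Let p v := rotmx a b (l0 * angle v).
Let q v := rotmx b (- a) (l0 * angle v).
Let P v := rotmx A B (l1 * angle v).
Let Q v := rotmx B (- A) (l1 * angle v).

Let is_derive_x v X : torus_dom v -> is_derive v X x (dx X v).
Proof.
move=> Uv; have H := Cn_derive (rsubmx X) (Cn_cap La ep 0) Uv.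
exact: (@is_derive_inner_linear _ _ _ _ rsubmx _ _ _ _ H).
Qed.

Let is_derive_dx v X Y : torus_dom v ->
  is_derive v X (dx Y) (- (cap_metric (rsubmx v) (rsubmx X) (rsubmx Y)) *: (x v - dx v v)).
Proof.
move=> Uv; have := is_derive2_cap La ep (rsubmx X) (rsubmx Y) Uv.
rewrite scaleNr -scalerA -(cap_sub_derive La ep Uv) -scaleNr => H.
exact: (@is_derive_inner_linear _ _ _ _ rsubmx _ _ _ _ H).
Qed.

Let is_derive_p v X : is_derive v X p ((l0 * angle X) *: q v).
Proof. exact: is_derive_rot. Qed.

Let is_derive_q v X : is_derive v X q ((l0 * angle X) *: - p v).
Proof. by have := is_derive_rot b (- a) l0 v X; rewrite rotN. Qed.

Let is_derive_P v X : is_derive v X P ((l1 * angle X) *: Q v).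
Proof. exact: is_derive_rot. Qed.

Let is_derive_Q v X : is_derive v X Q ((l1 * angle X) *: - P v).
Proof. by have := is_derive_rot B (- A) l1 v X; rewrite rotN. Qed.

Let derive_torus v X : torus_dom v -> 'D_X torus v =
  r *: ((l0 * angle X) *: q v) +
  s *: (dx X v *m P v + x v *m ((l1 * angle X) *: Q v)).
Proof.
move=> Uv; have H := is_deriveD (is_deriveZ r (is_derive_p v X))
  (is_deriveZ s (is_derive_mulmx (is_derive_x X Uv) (is_derive_P v X))).
by have [_ E] := H; exact: E.
Qed.

Let derive2_torus v X Y : torus_dom v -> 'D_X ('D_Y torus) v =
  - (angle X * angle Y) *: ((r * l0 ^+ 2) *: p v + (s * l1 ^+ 2) *: (x v *m P v)) +
  (s * l1) *: ((angle X *: dx Y v + angle Y *: dx X v) *m Q v) -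
  (s * cap_metric (rsubmx v) (rsubmx X) (rsubmx Y)) *: ((x v - dx v v) *m P v).
Proof.
move=> Uv.
have E w : torus_dom w -> r *: ((l0 * angle Y) *: q w) +
  s *: (dx Y w *m P w + x w *m ((l1 * angle Y) *: Q w)) = 'D_Y torus w.
  by move=> Uw; rewrite derive_torus.
have H := is_deriveD (is_deriveZ r (is_deriveZ (l0 * angle Y) (is_derive_q v X)))
  (is_deriveZ s (is_deriveD (is_derive_mulmx (is_derive_dx X Y Uv) (is_derive_P v X))
     (is_derive_mulmx (is_derive_x X Uv) (is_deriveZ (l1 * angle Y) (is_derive_Q v X))))).
have [_ H2] := is_derive_ext oU E Uv H.
transitivity (r *: ((l0 * angle Y) *: ((l0 * angle X) *: - p v)) +
  s *: ((- (cap_metric (rsubmx v) (rsubmx X) (rsubmx Y)) *: (x v - dx v v)) *m P v +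
        dx Y v *m ((l1 * angle X) *: Q v) +
        (dx X v *m ((l1 * angle Y) *: Q v) +
         x v *m ((l1 * angle Y) *: ((l1 * angle X) *: - P v))))); first exact: H2.
move: (x v) (dx Y v) (dx X v) (dx v v) (p v) (P v) (Q v) => X0 dY dX dV p0 P0 Q0.
move: (cap_metric _ _ _) (angle X) (angle Y) => g tx ty.
rewrite !mulmxDl !mulNmx -!scalemxAl !mulmxBl -!scalemxAr !mulmxN.
move: (X0 *m P0) (dV *m P0) (dY *m Q0) (dX *m Q0) => v1 v2 v3 v4.
by apply/rowP => j; rewrite !mxE; ring.
Qed.

Section AtPoint.
Variables (v : 'rV[R]_(1 + m)) (Uv : torus_dom v).
Local Notation g X Y := (cap_metric (rsubmx v) (rsubmx X) (rsubmx Y)).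

Let F : orthoframe (p v) (q v) (P v) (Q v).
Proof. exact: orthoframe_rot. Qed.

Let dot_xx : dot (x v) (x v) = 1.
Proof. exact: dot_cap. Qed.

Let dot_xd X : dot (x v) (dx X v) = 0.
Proof. exact: dot_cap_derive. Qed.

Let dot_dx X : dot (dx X v) (x v) = 0.
Proof. by rewrite dotC dot_xd. Qed.

Let dot_dd X Y : dot (dx X v) (dx Y v) = g X Y.
Proof. exact: dot_derive_cap. Qed.

Let w2 := r ^+ 2 * l0 ^+ 2 + s ^+ 2 * l1 ^+ 2.

Lemma dot_torus : dot (torus v) (torus v) = 1.
Proof.
rewrite /torus -/(p v) -/(P v) -/(x v).
move: F dot_xx; move: (p v) (q v) (P v) (Q v) (x v) => p0 q0 P0 Q0 x0 F0 xx.
rewrite !dot_lin !(of_dots F0) xx -[RHS]rs1; ring.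
Qed.

(** The induced metric is a product: the angular derivative is a combination of [q] and [x *m Q],
    while the sphere directions give vectors [dx *m P], and the blocks P and Q are orthogonal. [w2]
    is the squared speed in the angular direction. *)
Lemma dot_derive_torus X Y :
  dot ('D_X torus v) ('D_Y torus v) = angle X * angle Y * w2 + s ^+ 2 * g X Y.
Proof.
rewrite !derive_torus // -!scalemxAr /w2.
move: F dot_xx (dot_xd X) (dot_xd Y) (dot_dx X) (dot_dx Y) (dot_dd X Y).
move: (p v) (q v) (P v) (Q v) (x v) (dx X v) (dx Y v) => p0 q0 P0 Q0 x0 dX dY F0 xx xX xY Xx Yx XY.
rewrite !dot_lin !(of_dots F0) xx ?xX ?xY ?Xx ?Yx XY; ring.
Qed.

Definition torus_normal : 'rV[R]_N :=
  s *: rotmx a b (l0 * angle v) - r *: (cap La ep (rsubmx v) *m rotmx A B (l1 * angle v)).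

Definition torus_normal_side (y : 'rV[R]_n) : 'rV[R]_N := y *m rotmx B (- A) (l1 * angle v).

Lemma dot_torus_normal : dot torus_normal torus_normal = 1.
Proof.
rewrite /torus_normal -/(p v) -/(P v) -/(x v).
move: F dot_xx; move: (p v) (q v) (P v) (Q v) (x v) => p0 q0 P0 Q0 x0 F0 xx.
by rewrite !dot_lin !(of_dots F0) xx -[RHS]rs1; ring.
Qed.

Lemma dot_torus_normal_side y : dot torus_normal (torus_normal_side y) = 0.
Proof.
rewrite /torus_normal /torus_normal_side -/(p v) -/(P v) -/(x v) -/(Q v).
move: F dot_xx; move: (p v) (q v) (P v) (Q v) (x v) => p0 q0 P0 Q0 x0 F0 xx.
by rewrite !dot_lin !(of_dots F0) !mulr0 subr0.
Qed.

Lemma dot_torus_side_side y z :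
  dot (torus_normal_side y) (torus_normal_side z) = dot y z.
Proof. by rewrite /torus_normal_side (of_dot_QQ F). Qed.

Lemma torus_normal_normal : torus_normal *m (tangent_cone torus v)^T = 0.
Proof.
have dtor := Cn_diff (Cn_torus 0) Uv.
apply: (normal_spaceP dtor).
  rewrite /torus /torus_normal -/(p v) -/(P v) -/(x v).
  move: F dot_xx; move: (p v) (q v) (P v) (Q v) (x v) => p0 q0 P0 Q0 x0 F0 xx.
  rewrite !dot_lin !(of_dots F0) xx; ring.
move=> X; rewrite derive_torus // /torus_normal -/(p v) -/(P v) -/(x v) -scalemxAr.
move: F dot_xx (dot_xd X) (dot_dx X); move: (p v) (q v) (P v) (Q v) (x v) (dx X v) => p0 q0 P0 Q0 x0 dX F0 xx xd dx0.
rewrite !dot_lin !(of_dots F0) xd; ring.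
Qed.

(** The condition [y] orthogonal to [x] is what makes the vector orthogonal to the angular
    derivative, whose component in the block Q is [s * l1] times [x *m Q]. The plane of [q] and
    [x *m Q] contains this tangent direction and the one remaining normal direction, in which the
    second fundamental form has no component. *)
Lemma torus_side_normal y : dot y (cap La ep (rsubmx v)) = 0 ->
  torus_normal_side y *m (tangent_cone torus v)^T = 0.
Proof.
have dtor := Cn_diff (Cn_torus 0) Uv.
move=> yx; apply: (normal_spaceP dtor).
  rewrite /torus /torus_normal_side -/(p v) -/(P v) -/(x v) -/(Q v).
  move: F dot_xx; move: (p v) (q v) (P v) (Q v) (x v) => p0 q0 P0 Q0 x0 F0 xx.
  rewrite !dot_lin !(of_dots F0); ring.
move=> X; rewrite derive_torus // /torus_normal_side -/(p v) -/(P v) -/(x v) -/(Q v) -scalemxAr.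
rewrite -/(x v) in yx; move: yx.
move: F dot_xx (dot_xd X) (dot_dx X); move: (p v) (q v) (P v) (Q v) (x v) (dx X v) => p0 q0 P0 Q0 x0 dX F0 xx xd dx0 yx.
rewrite !dot_lin !(of_dots F0) yx; ring.
Qed.

Lemma second_ff_torus X Y : second_ff torus v X Y =
  (r * s * (g X Y - (l0 ^+ 2 - l1 ^+ 2) * (angle X * angle Y))) *: torus_normal +
  (s * l1) *: torus_normal_side
    (angle X *: 'D_(rsubmx Y) (cap La ep) (rsubmx v) +
     angle Y *: 'D_(rsubmx X) (cap La ep) (rsubmx v)).
Proof.
have dtor := Cn_diff (Cn_torus 0) Uv.
(* The part of the second derivative in the tangent cone: [c], minus the inner product of
   [dot_derive_torus], is the coefficient of the position vector, and [Z] is the tangential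
   correction, coming from the graph coordinates of the sphere. *)
pose c := - (angle X * angle Y * w2) - s ^+ 2 * g X Y.
pose Z : 'rV[R]_(1 + m) := row_mx 0 (g X Y *: rsubmx v).
have aZ : angle Z = 0 by rewrite /angle /Z row_mxKl mxE.
have dZ : dx Z v = g X Y *: dx v v.
  have dc := Cn_diff (Cn_cap La ep 0) Uv.
  rewrite /dx /Z row_mxKr.
  apply: etrans (deriveEjacobian _ dc) _; rewrite -scalemxAl; congr (_ *: _).
  exact: esym (deriveEjacobian _ dc).
set n1 := RHS.
have E : 'D_X ('D_Y torus) v = n1 + (c *: torus v + 'D_Z torus v).
  rewrite derive2_torus // derive_torus // aZ dZ /n1 /torus_normal /torus_normal_side.
  rewrite /torus -/(p v) -/(P v) -/(x v) -/(Q v) -/(dx X v) -/(dx Y v) /c /w2.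
  move: (x v) (dx Y v) (dx X v) (dx v v) (p v) (P v) (Q v) (q v) => X0 dY dX dV p0 P0 Q0 q0.
  move: (cap_metric _ _ _) (angle X) (angle Y) => gg tx ty.
  rewrite !mulr0 !scale0r mulmx0 scaler0 add0r addr0 !mulmxBl -!scalemxAl.
  move: ((_ + _) *m Q0) (X0 *m P0) (dV *m P0) => v1 v2 v3.
  apply/rowP => j; rewrite !mxE.
  have rE : r ^+ 2 = 1 - s ^+ 2 by rewrite -rs1; ring.
  ring: rE.
rewrite /second_ff E normal_projE //.
  rewrite /n1 mulmxDl -!scalemxAl torus_normal_normal torus_side_normal ?scaler0 ?addr0 //.
  exact: dot_comb0 (dot_dx Y) (dot_dx X).
apply: addmx_sub; first exact/scalemx_sub/tangent_cone_point.
exact: tangent_cone_derive.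
Qed.

End AtPoint.

End Torus.

(** * The spectrum of a fundamental matrix that is diagonal on a partial frame *)

Lemma prod_nseq {R : comNzRingType} k (x : R) (f : R -> {poly R}) :
  \prod_(a <- nseq k x) f a = f x ^+ k.
Proof. by rewrite big_nseq; elim: k => //= k ->; rewrite exprS. Qed.

Lemma sorted_nseq_cat {R : realType} k (x : R) s : sorted >=%R s ->
  (forall y, y \in s -> y <= x) -> sorted >=%R (nseq k x ++ s).
Proof.
move=> ss sx; elim: k => // k IH.
have tr : transitive (>=%R : rel R) by move=> a b c ab bc; exact: le_trans bc ab.
rewrite /= (path_sortedE tr) IH andbT all_cat; apply/andP; split.
  by apply/allP => y; rewrite mem_nseq => /andP[_ /eqP ->]; exact: lexx.
by apply/allP => y /sx.
Qed.

Section Spectrum.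
Context {R : realType} {m q N : nat} (nu : 'M[R]_(q, N)) (W : 'M[R]_(1 + m, N)) (d0 d1 : R).
Hypothesis m2 : (2 <= m)%N.
Hypothesis mq : (m < q)%N.
Hypothesis nu1 : nu *m nu^T = 1%:M.
Hypothesis W1 : W *m W^T = 1%:M.
Hypothesis Wnu : (W <= nu)%MS.
Hypothesis d0_ge0 : 0 <= d0.
Hypothesis d1_ge0 : 0 <= d1.

Let d : 'rV[R]_(1 + m) := row_mx d0%:M (const_mx d1).
Let B : 'M[R]_q := nu *m W^T *m diag_mx d *m (nu *m W^T)^T.

(** The orthonormal rows of [W] lie in the span of the orthonormal rows of [nu], so their
    coordinates in [nu] are again orthonormal. *)
Let MM : (nu *m W^T)^T *m (nu *m W^T) = 1%:M.
Proof.
have [c Wc] := submxP Wnu.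
rewrite trmx_mul trmxK [W in LHS]Wc [X in X *m _ = _](_ : _ = c); last first.
  by rewrite -mulmxA nu1 mulmx1.
by rewrite mulmxA -Wc W1.
Qed.

Let spec := d0 :: nseq m d1 ++ nseq (q - m.+1) 0.

(** [B] has the form M D M^T with M^T M = 1, so [char_poly_mulmxC] gives it the characteristic
    polynomial of D times a power of X. *)
Let char_B : char_poly B = \prod_(a <- spec) ('X - a%:P).
Proof.
have trB : char_poly (diag_mx d) = ('X - d0%:P) * ('X - d1%:P) ^+ m.
  have dE i : diag_mx d i i = d 0 i by rewrite mxE eqxx mulr1n.
  rewrite char_poly_trig ?diag_mx_is_trig // big_ord_recl dE.
  have -> : d 0 ord0 = d0.
    have -> : (ord0 : 'I_m.+1) = lshift m (0 : 'I_1) by apply: val_inj.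
    by rewrite /d row_mxEl mxE eqxx mulr1n.
  congr (_ * _); transitivity (\prod_(i < m) ('X - d1%:P)).
    apply: eq_bigr => i _; rewrite dE.
    have -> : lift ord0 i = rshift 1 i :> 'I_m.+1 by apply: val_inj.
    by rewrite /d row_mxEr mxE.
  by rewrite prodr_const card_ord.
have := char_poly_mulmxC (nu *m W^T) (diag_mx d *m (nu *m W^T)^T).
rewrite mulmxA -/B -mulmxA MM mulmx1 trB => H.
rewrite /spec big_cons big_cat /= !prod_nseq subr0.
have Xn : 'X^(1 + m) != 0 :> {poly R} by rewrite expf_neq0 // polyX_eq0.
apply: (mulfI Xn); rewrite H -[in LHS](subnKC mq) exprD -!mulrA; congr (_ * _).
by rewrite mulrC -!mulrA.
Qed.

Let tr_B : \tr B = d0 + d1 *+ m.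
Proof.
rewrite /B mxtrace_mulC mulmxA MM mul1mx mxtrace_diag big_split_ord /= big_ord1.
by rewrite row_mxEl mxE eqxx mulr1n; under eq_bigr do rewrite row_mxEr mxE; rewrite sumr_const card_ord.
Qed.

(** Either of [d0] and [d1] may be the larger. The ordered list starts with [d0], [d1] in one case
    and with [d1], [d1] in the other, since [d1] occurs at least twice; its entry of index 1 is [d1]
    in both. *)
Lemma spectrum_diag : exists s, [/\ ordered_eigenvalues B s, perm_eq s spec,
  \tr B = d0 + d1 *+ m & \tr B + s`_1 = d0 + d1 *+ m + d1].
Proof.
have zs : sorted >=%R (nseq (q - m.+1) (0 : R)).
  by have := @sorted_nseq_cat R (q - m.+1) 0 [::] isT; rewrite cats0; apply.
have z0 x (y : R) : 0 <= x -> y \in nseq (q - m.+1) 0 -> y <= x.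
  by move=> x0; rewrite mem_nseq => /andP[_ /eqP ->].
have [d10|d01] := leP d1 d0.
  exists spec; rewrite tr_B; split=> //.
    split=> //; rewrite /spec.
    apply: (@sorted_nseq_cat R 1 d0).
      by apply: sorted_nseq_cat => // y; apply: z0.
    move=> y; rewrite mem_cat => /orP[|]; last exact: z0.
    by rewrite mem_nseq => /andP[_ /eqP ->].
  by rewrite /spec /=; case: (m) m2.
exists (nseq m d1 ++ d0 :: nseq (q - m.+1) 0).
have pe : perm_eq (nseq m d1 ++ d0 :: nseq (q - m.+1) 0) spec.
  by rewrite /spec -cat1s perm_catCA.
rewrite tr_B; split=> //; last by case: (m) m2 => [|[]].
split; last by rewrite char_B; apply: perm_big; rewrite perm_sym.
apply: sorted_nseq_cat.
  by apply: (@sorted_nseq_cat R 1 d0) => // y; apply: z0.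
move=> y; rewrite in_cons => /orP[/eqP ->|]; first exact: ltW.
exact: z0.
Qed.

End Spectrum.

(** * Adapted frames, minimality and the fundamental matrix *)

Lemma mulmx3_entry {R : pzRingType} {m n : nat} (E : 'M[R]_(m, n)) (G : 'M[R]_n) i j :
  (E *m G *m E^T) i j = (row i E *m G *m (row j E)^T) 0 0.
Proof.
by rewrite tr_row -row_mul !mxE; apply: eq_bigr => k _; rewrite !mxE.
Qed.

Lemma tangent_frameP {R : realType} {m N : nat} (phi : 'rV[R]_m -> 'rV[R]_N) u (E : 'M[R]_m) :
  differentiable phi u ->
  (forall i j, dot ('D_(row i E) phi u) ('D_(row j E) phi u) = (i == j)%:R) ->
  tangent_frame phi u E.
Proof.
move=> du H; apply/matrixP => i j; rewrite [RHS]mxE.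
apply: etrans (H i j); apply: etrans _ (esym (dot_derive_gram _ _ du)).
exact: mulmx3_entry.
Qed.

Lemma tangent_frame_row_free {R : realType} {m N : nat} (phi : 'rV[R]_m -> 'rV[R]_N) u (E : 'M[R]_m) :
  tangent_frame phi u E -> row_free ('J phi u).
Proof.
rewrite /tangent_frame /gram -mulmxA => /mulmx1C; rewrite -!mulmxA => H.
by apply/row_freeP; exists (('J phi u)^T *m (E^T *m E)).
Qed.

Section CapFrame.
Context {R : realType} {m n : nat} (La : 'M[R]_(m, n)) (ep : 'rV[R]_n).
Hypothesis LL : La *m La^T = 1%:M.
Hypothesis Le : ep *m La^T = 0.
Hypothesis ee : dot ep ep = 1.

(** The Jacobian has full rank because the metric is definite; an orthonormal basis of its row space
    is written in coordinates. *)
Lemma cap_frame u : ball1 u -> exists e : 'M[R]_m,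
  forall i j, cap_metric u (row i e) (row j e) = (i == j)%:R.
Proof.
move=> Bu; have dc := Cn_diff (Cn_cap La ep 0) Bu.
have rf : row_free ('J (cap La ep) u).
  apply: inj_row_free => v vJ; apply: (@cap_metric_gt0 _ _ u).
  rewrite -(dot_derive_cap LL Le ee v v Bu).
  have -> : 'D_v (cap La ep) u = 0 by apply: etrans (deriveEjacobian _ dc) vJ.
  exact: dot0l.
have [nu nu1 /submxP[e nuE]] := @orthonormal_rows _ _ _ ('J (cap La ep) u) m (eq_leq (esym (eqP rf))).
exists e => i j; rewrite -(dot_derive_cap LL Le ee _ _ Bu).
have rE k : 'D_(row k e) (cap La ep) u = row k nu.
  by apply: etrans (deriveEjacobian _ dc) _; rewrite nuE row_mul.
rewrite !rE; have := congr1 (fun M : 'M[R]_m => M i j) nu1; rewrite !mxE => <-.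
by rewrite dotE; apply: eq_bigr => k _; rewrite !mxE.
Qed.

End CapFrame.

Lemma cap_metricZ {R : realType} {m : nat} (u X Y : 'rV[R]_m) (a b : R) :
  cap_metric u (a *: X) (b *: Y) = a * b * cap_metric u X Y.
Proof. by rewrite /cap_metric !dotZl !dotZr; ring. Qed.

Lemma cap_metric0l {R : realType} {m : nat} (u Y : 'rV[R]_m) : cap_metric u 0 Y = 0.
Proof. by rewrite /cap_metric dot0l dot0r !mul0r addr0. Qed.

Lemma cap_metric0r {R : realType} {m : nat} (u Y : 'rV[R]_m) : cap_metric u Y 0 = 0.
Proof. by rewrite /cap_metric !dot0r mulr0 mul0r addr0. Qed.

Lemma sum2_split {V : nmodType} {m : nat} (f : 'I_(1 + m) -> 'I_(1 + m) -> V) :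
  \sum_k \sum_l f k l = f (lshift m 0) (lshift m 0) + \sum_l f (lshift m 0) (rshift 1 l) +
    \sum_k (f (rshift 1 k) (lshift m 0) + \sum_l f (rshift 1 k) (rshift 1 l)).
Proof.
rewrite big_split_ord /= big_ord1 big_split_ord /= big_ord1; congr (_ + _).
by apply: eq_bigr => k _; rewrite big_split_ord /= big_ord1.
Qed.

Section TorusCurvature.
Context {R : realType} {m n N : nat}.
Variables (La : 'M[R]_(m, n)) (ep : 'rV[R]_n) (l0 l1 r s : R).
Variables (a b : 'rV[R]_N) (A B : 'M[R]_(n, N)).
Hypothesis LL : La *m La^T = 1%:M.
Hypothesis Le : ep *m La^T = 0.
Hypothesis ee : dot ep ep = 1.
Hypothesis Fab : orthoframe a b A B.
Hypothesis rs1 : r ^+ 2 + s ^+ 2 = 1.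
Let w2 := r ^+ 2 * l0 ^+ 2 + s ^+ 2 * l1 ^+ 2.
Hypothesis s_gt0 : 0 < s.
Hypothesis w2_gt0 : 0 < w2.
Let w := Num.sqrt w2.
Variables (v : 'rV[R]_(1 + m)) (Uv : torus_dom v).
Local Notation phi := (torus La ep l0 l1 r s a b A B).
Let u := rsubmx v.
Let x := cap La ep u.

(** The angular vector divided by its length [w], and a frame [e] orthonormal for the unit sphere
    divided by the radius [s] of the sphere factor. *)
Definition torus_frame (e : 'M[R]_m) : 'M[R]_(1 + m) :=
  block_mx w^-1%:M 0 0 (s^-1 *: e).

Variable e : 'M[R]_m.
Hypothesis e1 : forall i j, cap_metric u (row i e) (row j e) = (i == j)%:R.
Let E := torus_frame e.

Let sn : s != 0. Proof. by rewrite gt_eqF. Qed.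
Let w2n : w2 != 0. Proof. by rewrite gt_eqF. Qed.
Let ww : w ^+ 2 = w2. Proof. by rewrite sqr_sqrtr // ltW. Qed.
Let wn : w != 0. Proof. by rewrite gt_eqF // sqrtr_gt0. Qed.

Let rowE0 : row (lshift m 0) E = row_mx w^-1%:M 0.
Proof. by rewrite /E /torus_frame /block_mx rowKu row_row_mx !row_id. Qed.

Let rowES i : row (rshift 1 i) E = row_mx 0 (s^-1 *: row i e).
Proof.
rewrite /E /torus_frame /block_mx rowKd row_row_mx; congr row_mx; first exact: row0.
by rewrite linearZ.
Qed.

Let angle0 : angle (row (lshift m 0) E) = w^-1.
Proof. by rewrite rowE0 /angle row_mxKl mxE eqxx mulr1n. Qed.
Let angleS i : angle (row (rshift 1 i) E) = 0.
Proof. by rewrite rowES /angle row_mxKl mxE. Qed.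
Let rsub0 : rsubmx (row (lshift m 0) E) = 0.
Proof. by rewrite rowE0 row_mxKr. Qed.
Let rsubS i : rsubmx (row (rshift 1 i) E) = s^-1 *: row i e.
Proof. by rewrite rowES row_mxKr. Qed.

Let dphi : differentiable phi v.
Proof. exact: Cn_diff (Cn_torus _ _ _ _ _ _ _ _ _ _ 0) Uv. Qed.

Lemma torus_tangent_frame : tangent_frame phi v E.
Proof.
apply: (tangent_frameP dphi) => i j.
apply: etrans (dot_derive_torus l0 l1 r s LL Le ee Fab Uv _ _) _.
case: (split_ordP i) => i' ->; case: (split_ordP j) => j' ->; rewrite ?ord1.
- rewrite angle0 rsub0 cap_metric0l mulr0 addr0 eqxx -/w2 -ww.
  by rewrite -invfM -expr2 mulVf // expf_neq0.
- by rewrite angleS rsub0 cap_metric0l !(mulr0, mul0r) addr0 eq_lrshift.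
- by rewrite angleS rsub0 cap_metric0r !(mulr0, mul0r) addr0 eq_rlshift.
rewrite !angleS !rsubS cap_metricZ e1 eq_rshift !mul0r add0r.
by rewrite mulrA -invfM -expr2 mulfV ?mul1r // expf_neq0.
Qed.

Let nu0 := torus_normal La ep l0 l1 r s a b A B v.
Let side (y : 'rV[R]_n) := torus_normal_side l1 A B v y.
Let V : 'M[R]_(m, n) := \matrix_i 'D_(row i e) (cap La ep) u.

Let derive_cap0 : 'D_0 (cap La ep) u = 0.
Proof. exact: derive0. Qed.

Let derive_capZ c X : 'D_(c *: X) (cap La ep) u = c *: 'D_X (cap La ep) u.
Proof.
have dc := Cn_diff (Cn_cap La ep 0) Uv.
apply: etrans (deriveEjacobian _ dc) _; rewrite -scalemxAl; congr (_ *: _).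
exact: esym (deriveEjacobian _ dc).
Qed.

Let sideZ c y : side (c *: y) = c *: side y.
Proof. exact: esym (scalemxAl _ _ _). Qed.

Let side0 : side 0 = 0.
Proof. exact: mul0mx. Qed.

Let h X Y := second_ff phi v X Y.

Let hE X Y : h X Y =
  (r * s * (cap_metric u (rsubmx X) (rsubmx Y) - (l0 ^+ 2 - l1 ^+ 2) * (angle X * angle Y))) *: nu0 +
  (s * l1) *: side
    (angle X *: 'D_(rsubmx Y) (cap La ep) u + angle Y *: 'D_(rsubmx X) (cap La ep) u).
Proof. exact: second_ff_torus. Qed.

Let h00 : h (row (lshift m 0) E) (row (lshift m 0) E) =
  - (r * s * (l0 ^+ 2 - l1 ^+ 2) / w2) *: nu0.
Proof.
rewrite hE rsub0 angle0 cap_metric0l derive_cap0 !scaler0 addr0 side0 scaler0 addr0.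
by congr (_ *: _); rewrite -ww; field.
Qed.

Let h0S i : h (row (lshift m 0) E) (row (rshift 1 i) E) = (l1 / w) *: side (row i V).
Proof.
rewrite hE rsub0 angle0 angleS rsubS cap_metric0l derive_capZ scale0r addr0.
rewrite !sideZ !scalerA !mulr0 subrr mulr0 scale0r add0r rowK.
by congr (_ *: _); field; apply/andP.
Qed.

Let hS0 i : h (row (rshift 1 i) E) (row (lshift m 0) E) = (l1 / w) *: side (row i V).
Proof.
rewrite hE rsub0 angle0 angleS rsubS cap_metric0r derive_cap0 derive_capZ scale0r !add0r.
rewrite !sideZ !scalerA !mul0r mulr0 oppr0 mulr0 scale0r add0r rowK.
by congr (_ *: _); field; apply/andP.
Qed.

Let hSS i j : h (row (rshift 1 i) E) (row (rshift 1 j) E) = ((i == j)%:R * (r / s)) *: nu0.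
Proof.
rewrite hE !angleS !rsubS cap_metricZ e1.
have -> d1 d2 : (0 : R) *: d1 + (0 : R) *: d2 = 0 :> 'rV[R]_n by rewrite !scale0r addr0.
rewrite side0 scaler0 addr0; congr (_ *: _); field.
by [].
Qed.

(** Vanishing of the trace: by [h00] the angular direction contributes - r s (l0^2 - l1^2) / w2
    along [nu0], by [hSS] each of the [m] sphere directions contributes r / s, and these must
    cancel. *)
Hypothesis hmin : s ^+ 2 * (l0 ^+ 2 - l1 ^+ 2) = m%:R * w2.

Let kappaE : r * s * (l0 ^+ 2 - l1 ^+ 2) / w2 = m%:R * (r / s).
Proof.
have -> : m%:R = s ^+ 2 * (l0 ^+ 2 - l1 ^+ 2) / w2 by rewrite hmin mulfK.
by field; apply/andP.
Qed.

Lemma torus_minimal : mean_curvature phi v = 0.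
Proof.
have oU := @open_torus_dom R m.
apply: etrans (mean_curvature_frame oU (Cn_torus _ _ _ _ _ _ _ _ _ _ 1) Uv torus_tangent_frame) _.
rewrite big_split_ord /= big_ord1 -/(h _ _) h00 kappaE.
under eq_bigr do rewrite -/(h _ _) hSS eqxx mul1r.
by rewrite sumr_const card_ord -(scaler_nat m (_ *: nu0)) scalerA scaleNr addNr.
Qed.

Let W : 'M[R]_(1 + m, N) := col_mx nu0 (V *m rotmx B (- A) (l1 * angle v)).

Let V1 : V *m V^T = 1%:M.
Proof.
apply/matrixP => i j; rewrite [RHS]mxE -e1.
rewrite -(dot_derive_cap LL Le ee _ _ Uv) dotE mxE; apply: eq_bigr => k _.
by rewrite !mxE.
Qed.

Let rowW0 : row (lshift m 0) W = nu0.
Proof. by rewrite rowKu row_id. Qed.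

Let rowWS i : row (rshift 1 i) W = side (row i V).
Proof. by rewrite rowKd row_mul. Qed.

Let WE i j : (W *m W^T) i j = dot (row i W) (row j W).
Proof. by rewrite mxE dotE; apply: eq_bigr => k _; rewrite !mxE. Qed.

Lemma torus_W1 : W *m W^T = 1%:M.
Proof.
apply/matrixP => i j; rewrite WE [RHS]mxE.
case: (split_ordP i) => i' ->; case: (split_ordP j) => j' ->; rewrite ?ord1 ?rowW0 ?rowWS.
- by rewrite eqxx; apply: dot_torus_normal.
- by rewrite eq_lrshift; apply: dot_torus_normal_side.
- by rewrite eq_rlshift dotC; apply: dot_torus_normal_side.
apply: etrans (@dot_torus_side_side _ _ _ _ l0 l1 a b A B Fab v _ _) _.
by rewrite eq_rshift !rowK (dot_derive_cap LL Le ee _ _ Uv) e1.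
Qed.

Lemma torus_W_normal : (W <= Defs.normal_space phi v)%MS.
Proof.
apply/sub_kermxP; rewrite mul_col_mx (@torus_normal_normal _ _ _ _ La ep l0 l1 r s a b A B LL Le ee Fab v Uv).
suff -> : V *m rotmx B (- A) (l1 * angle v) *m (tangent_cone phi v)^T = 0 by rewrite col_mx0.
apply/row_matrixP => i; rewrite row0 !row_mul.
apply: torus_side_normal => //.
by rewrite rowK dotC (dot_cap_derive LL Le ee _ Uv).
Qed.

(** Along [nu0] the angular direction contributes (m r / s)^2 and each of the [m] sphere directions
    (r / s)^2, whence the factor m (m + 1). Each side normal occurs twice, in h(T, X) and in h(X,
    T), with coefficient [l1 / w], whence 2 l1^2 / w2. *)
Lemma torus_fundamental q (nu : 'M[R]_(q, N)) :
  fundamental_mx phi v E nu =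
  nu *m W^T *m diag_mx (row_mx (m%:R * (m%:R + 1) * (r / s) ^+ 2)%:M (const_mx (2 * l1 ^+ 2 / w2)))
    *m (nu *m W^T)^T.
Proof.
pose c0 i := dot nu0 (row i nu); pose cS k i := dot (side (row k V)) (row i nu).
have MW i k : (nu *m W^T) i k = dot (row k W) (row i nu).
  by rewrite mxE dotE; apply: eq_bigr => l _; rewrite !mxE mulrC.
have M0 i : (nu *m W^T) i (lshift m 0) = c0 i by rewrite MW rowW0.
have MS i k : (nu *m W^T) i (rshift 1 k) = cS k i by rewrite MW rowWS.
apply/matrixP => i j; rewrite [LHS]mxE.
pose f k l := dot (h (row k E) (row l E)) (row i nu) * dot (h (row k E) (row l E)) (row j nu).
have -> : \tr ((shape_mx phi v E (row i nu))^T *m shape_mx phi v E (row j nu)) =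
    \sum_k \sum_l f k l.
  rewrite exchange_big /mxtrace; apply: eq_bigr => l _.
  by rewrite mxE; apply: eq_bigr => k _; rewrite [_^T _ _]mxE [shape_mx _ _ _ _ _ _]mxE [shape_mx _ _ _ _ _ _]mxE.
have S00 : f (lshift m 0) (lshift m 0) = (m%:R * (r / s)) ^+ 2 * (c0 i * c0 j).
  by rewrite /f h00 kappaE !dotZl -/(c0 i) -/(c0 j); ring.
have S0S l : f (lshift m 0) (rshift 1 l) = (l1 ^+ 2 / w2) * (cS l i * cS l j).
  by rewrite /f h0S !dotZl -/(cS l i) -/(cS l j) -ww; field.
have SS0 l : f (rshift 1 l) (lshift m 0) = (l1 ^+ 2 / w2) * (cS l i * cS l j).
  by rewrite /f hS0 !dotZl -/(cS l i) -/(cS l j) -ww; field.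
have SSS k l : f (rshift 1 k) (rshift 1 l) = (k == l)%:R * ((r / s) ^+ 2 * (c0 i * c0 j)).
  by rewrite /f hSS !dotZl -/(c0 i) -/(c0 j); case: (k == l) => /=; rewrite ?mul0r //; field.
clearbody f; rewrite sum2_split S00 (eq_bigr _ (fun l _ => S0S l)).
rewrite [X in _ + X = _](eq_bigr (fun k => (l1 ^+ 2 / w2) * (cS k i * cS k j) + (r / s) ^+ 2 * (c0 i * c0 j))); last first.
  move=> k _; rewrite SS0 (bigD1 k) //= SSS eqxx mul1r big1 ?addr0 // => l lk.
  by rewrite SSS eq_sym (negbTE lk) mul0r.
rewrite big_split /= sumr_const card_ord.
rewrite [RHS]mxE big_split_ord /= big_ord1.
have -> : (nu *m W^T *m diag_mx (row_mx (m%:R * (m%:R + 1) * (r / s) ^+ 2)%:M (const_mx (2 * l1 ^+ 2 / w2)))) i (lshift m 0) =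
   c0 i * (m%:R * (m%:R + 1) * (r / s) ^+ 2).
  by rewrite mul_mx_diag mxE M0 row_mxEl mxE eqxx mulr1n.
rewrite [_^T (lshift _ _) _]mxE M0.
have -> : \sum_(k < m) (nu *m W^T *m diag_mx (row_mx (m%:R * (m%:R + 1) * (r / s) ^+ 2)%:M (const_mx (2 * l1 ^+ 2 / w2)))) i (rshift 1 k) *
   (nu *m W^T)^T (rshift 1 k) j = \sum_(k < m) (2 * l1 ^+ 2 / w2) * (cS k i * cS k j).
  by apply: eq_bigr => k _; rewrite mul_mx_diag mxE MS row_mxEr mxE [_^T _ _]mxE MS; ring.
rewrite -!mulr_sumr -mulr_natl.
by field; apply/andP.
Qed.

End TorusCurvature.

(** * From the map F to its local expression *)

Section Blocks.
Context {R : realType} {n N : nat} (L : 'M[R]_((1 + n) + (1 + n), N)).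

(** [realify] lists real parts before imaginary parts: the rows of [L] are the images of the
    standard basis of C + C^n ([blk_a], [blk_A]) followed by those of its multiples by i ([blk_b],
    [blk_B]). *)
Definition blk_a : 'rV[R]_N := usubmx (usubmx L).
Definition blk_A : 'M[R]_(n, N) := dsubmx (usubmx L).
Definition blk_b : 'rV[R]_N := usubmx (dsubmx L).
Definition blk_B : 'M[R]_(n, N) := dsubmx (dsubmx L).

Lemma blkE : L = col_mx (col_mx blk_a blk_A) (col_mx blk_b blk_B).
Proof. by rewrite !vsubmxK. Qed.

Lemma blk_orthoframe : L *m L^T = 1%:M -> orthoframe blk_a blk_b blk_A blk_B.
Proof.
have E (p q : nat) (X : 'M[R]_(p, N)) (Y : 'M[R]_(q, N)) :
    col_mx X Y *m (col_mx X Y)^T = 1%:M ->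
    [/\ X *m X^T = 1%:M, X *m Y^T = 0, Y *m X^T = 0 & Y *m Y^T = 1%:M].
  by rewrite tr_col_mx mul_col_row scalar_mx_block => /eq_block_mx.
have C (p q k : nat) (X : 'M[R]_(p, N)) (Y : 'M[R]_(q, N)) (Z : 'M[R]_(k, N)) :
    Z *m (col_mx X Y)^T = 0 -> Z *m X^T = 0 /\ Z *m Y^T = 0.
  by rewrite tr_col_mx mul_mx_row -[RHS]row_mx0 => /eq_row_mx.
have D (p q k l : nat) (X : 'M[R]_(p, N)) (Y : 'M[R]_(q, N)) (Z : 'M[R]_(k, N)) (T : 'M[R]_(l, N)) :
    col_mx X Y *m (col_mx Z T)^T = 0 ->
    [/\ X *m Z^T = 0, X *m T^T = 0, Y *m Z^T = 0 & Y *m T^T = 0].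
  by rewrite mul_col_mx -[RHS]col_mx0 => /eq_col_mx [/C[-> ->] /C[-> ->]].
rewrite blkE => /E[/E[aa aA Aa AA] /D[ab aB Ab AB] /D[ba bA Ba BA] /E[bb bB _ BB]].
by split.
Qed.

End Blocks.

Section FTorus.
Context {R : realType} {n N : nat}.

Lemma F_torus (L : 'M[R]_((1 + n) + (1 + n), N)) l0 l1 t (x : sphere R n) :
  F l0 l1 (circle_pi t, x) *m L =
  radius_r R n l0 l1 *: rotmx (blk_a L) (blk_b L) (l0%:R * t) +
  radius_s R n l0 l1 *: (spt x *m rotmx (blk_A L) (blk_B L) (l1%:R * t)).
Proof.
rewrite FE /realify /F_formula [in LHS](blkE L) mul_row_col.
set r := radius_r _ _ _ _; set s := radius_s _ _ _ _.
have -> : map_mx (@complex.Re R) (row_mx (r%:C%C * cis (l0%:R * t))%:M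
     ((s%:C%C * cis (l1%:R * t)) *: map_mx (real_complex R) (spt x))) =
     row_mx (r * cos (l0%:R * t))%:M ((s * cos (l1%:R * t)) *: spt x).
  rewrite map_row_mx; congr row_mx; apply/rowP => j; rewrite !mxE ?ord1 ?eqxx ?mulr1n /=.
    by rewrite mul0r subr0.
  by rewrite !mul0r !mulr0 !subr0.
have -> : map_mx (@complex.Im R) (row_mx (r%:C%C * cis (l0%:R * t))%:M
     ((s%:C%C * cis (l1%:R * t)) *: map_mx (real_complex R) (spt x))) =
     row_mx (r * sin (l0%:R * t))%:M ((s * sin (l1%:R * t)) *: spt x).
  rewrite map_row_mx; congr row_mx; apply/rowP => j; rewrite !mxE ?ord1 ?eqxx ?mulr1n /=.
    by rewrite mul0r addr0.
  by rewrite !mul0r !mulr0 ?addr0 ?add0r.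
rewrite !mul_row_col !mul_scalar_mx /rotmx mulmxDr -!scalemxAl -!scalemxAr.
by rewrite !scalerDr !scalerA addrACA.
Qed.

Lemma domainF_chart c : domainF_atlas R n c ->
  exists i b, [/\ open (dom c), dom c `<=` torus_dom &
    forall u, dom c u -> exists x : sphere R n,
      c u = (circle_pi (angle u), x) /\
      spt x = cap (hemi_La i) (hemi_ep i b) (rsubmx u)].
Proof.
move=> [c1 [c2 [[a [d1 E1]] [d2 [i [b E2]]] ->]]] /=; exists i, b; split.
- rewrite d1 d2.
  have -> : [set u : 'rV[R]_(1 + n.-1) | [set u : 'rV[R]_1 | a < u 0 0 < a + 2 * pi] (lsubmx u) /\
     [set u : 'rV[R]_n.-1 | dot u u < 1] (rsubmx u)] =
     ((fun u : 'rV[R]_(1 + n.-1) => u 0 (lshift n.-1 0)) @^-1` [set x | a < x] `&`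
      (fun u : 'rV[R]_(1 + n.-1) => u 0 (lshift n.-1 0)) @^-1` [set x | x < a + 2 * pi]) `&` torus_dom.
    apply/seteqP; split => u /=; rewrite mxE.
      by move=> [/andP[h1 h2] h3].
    by move=> [[h1 h2] h3]; rewrite h1 h2.
  apply: openI; last exact: open_torus_dom.
  by apply: openI; apply: open_comp; do ?[by move=> ? _; exact: coord_continuous];
    [exact: open_gt|exact: open_lt].
- by move=> u [_]; rewrite d2.
move=> u [u1 u2]; exists (c2 (rsubmx u)); split; first by rewrite E1.
by rewrite E2 // hemisphereE.
Qed.

End FTorus.

(** * The radii and the eigenvalues *)

Section Arithmetic.
Context {R : realType} (n l0 l1 : nat).
Hypothesis hn : (3 <= n)%N.
Hypothesis adm : admissible R n l0 l1.
Local Notation rho := (rho R l0 l1).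
Local Notation r := (radius_r R n l0 l1).
Local Notation s := (radius_s R n l0 l1).
Let nR : R := n%:R.

Let n3 : 3 <= nR. Proof. by rewrite /nR ler_nat. Qed.
Let n0 : 0 < nR. Proof. exact: lt_le_trans n3. Qed.
Let l0_gt0 : 0 < l0%:R :> R. Proof. by case: adm => -[h _ _ _ _]; rewrite ltr0n. Qed.
Let l1_gt0 : 0 < l1%:R :> R. Proof. by case: adm => -[_ h _ _ _]; rewrite ltr0n. Qed.
Let rho0 : 0 < rho. Proof. by case: adm => _ _ _ /andP[]. Qed.
Let nrho : nR * rho < 1.
Proof. by case: adm => _ _ _ /andP[_]; rewrite -(ltr_pM2l n0) mulfV // gt_eqF. Qed.
Let n1 : 1 < nR. Proof. by apply: lt_le_trans n3; rewrite ltr1n. Qed.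
Let rho1 : rho < 1. Proof. by apply: lt_trans nrho; rewrite ltr_pMl. Qed.
Let rhoE : l1%:R ^+ 2 = rho * l0%:R ^+ 2 :> R.
Proof. by rewrite /Defs.rho divfK // expf_neq0 // gt_eqF. Qed.

Lemma radius_r2 : r ^+ 2 = (1 - nR * rho) / (nR * (1 - rho)).
Proof. by rewrite sqr_sqrtr // divr_ge0 ?mulr_ge0 ?subr_ge0 ?ltW. Qed.

Lemma radius_s2 : s ^+ 2 = (nR - 1) / (nR * (1 - rho)).
Proof. by rewrite sqr_sqrtr // divr_ge0 ?mulr_ge0 ?subr_ge0 ?ltW. Qed.

Lemma radius_r_gt0 : 0 < r.
Proof. by rewrite sqrtr_gt0 divr_gt0 ?mulr_gt0 // subr_gt0. Qed.

Lemma radius_s_gt0 : 0 < s.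
Proof. by rewrite sqrtr_gt0 divr_gt0 ?mulr_gt0 ?subr_gt0. Qed.

Let d0 : nR * (1 - rho) != 0.
Proof. by rewrite gt_eqF // mulr_gt0 // subr_gt0. Qed.

Let n_neq0 : nR != 0. Proof. by rewrite gt_eqF. Qed.
Let rho_neq1 : 1 - rho != 0. Proof. by rewrite gt_eqF // subr_gt0. Qed.

Lemma radii1 : r ^+ 2 + s ^+ 2 = 1.
Proof. by rewrite radius_r2 radius_s2; field; apply/andP. Qed.

Lemma speed2 : r ^+ 2 * l0%:R ^+ 2 + s ^+ 2 * l1%:R ^+ 2 = l0%:R ^+ 2 / nR.
Proof. by rewrite radius_r2 radius_s2 rhoE; field; apply/andP. Qed.

Lemma speed2_gt0 : 0 < r ^+ 2 * l0%:R ^+ 2 + s ^+ 2 * l1%:R ^+ 2.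
Proof. by rewrite speed2 divr_gt0 // exprn_gt0. Qed.

Let predn : n.-1%:R = nR - 1.
Proof. by rewrite /nR -[in RHS](prednK (leq_trans _ hn)) // -natr1 addrK. Qed.

(** Divided by l0^2, the equation reads s^2 (1 - n rho) = (n - 1) r^2; together with [radii1] it
    determines the radii, which is the origin of their formulas. *)
Lemma minimal_radii : s ^+ 2 * (l0%:R ^+ 2 - l1%:R ^+ 2) =
  n.-1%:R * (r ^+ 2 * l0%:R ^+ 2 + s ^+ 2 * l1%:R ^+ 2).
Proof. by rewrite speed2 radius_s2 rhoE predn; field; apply/andP. Qed.

Lemma eigenvalue0 : n.-1%:R * (n.-1%:R + 1) * (r / s) ^+ 2 = nR * (1 - nR * rho).
Proof.
rewrite expr_div_n radius_r2 radius_s2 predn; field.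
by rewrite rho_neq1 n_neq0 /= subr_eq0 gt_eqF.
Qed.

Lemma eigenvalue1 :
  2 * l1%:R ^+ 2 / (r ^+ 2 * l0%:R ^+ 2 + s ^+ 2 * l1%:R ^+ 2) = 2 * nR * rho.
Proof. by rewrite speed2 rhoE; field; rewrite n_neq0 gt_eqF. Qed.

Lemma eigenvalue0_ge0 : 0 <= nR * (1 - nR * rho).
Proof. by rewrite mulr_ge0 ?subr_ge0 // ltW. Qed.

Lemma eigenvalue1_ge0 : 0 <= 2 * nR * rho.
Proof. by rewrite !mulr_ge0 // ltW. Qed.

Lemma S_value : nR * (1 - nR * rho) + (2 * nR * rho) *+ n.-1 = nR + nR * (nR - 2) * rho.
Proof. by rewrite -mulr_natl predn; ring. Qed.

Lemma Q_value : nR + nR * (nR - 2) * rho + 2 * nR * rho = nR + nR ^+ 2 * rho.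
Proof. by ring. Qed.

End Arithmetic.

(** * The charts cover the sphere, the circle and their product *)

Section Cover.
Context {R : realType}.

Lemma sphere_coord_neq0 {k : nat} (x : sphere R k) : exists i (b : bool), 0 < (-1) ^+ b * spt x 0 i.
Proof.
have /eqP xn : spt x != 0.
  by apply/eqP => x0; have := dot_spt x; rewrite x0 dot0l => /eqP; rewrite eq_sym oner_eq0.
have [i xi] : exists i, spt x 0 i != 0.
  apply/existsP; apply: contra_notT xn => /existsPn H; apply/rowP => i.
  by rewrite mxE; apply/eqP; have := H i; rewrite negbK.
exists i; case: (ltgtP (spt x 0 i) 0) xi => // [xi|xi] _.
  by exists true; rewrite expr1 mulN1r oppr_gt0.
by exists false; rewrite expr0 mul1r.
Qed.

Lemma sphere_cover {k : nat} (x : sphere R k) :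
  exists c u, [/\ sphere_atlas R k c, dom c u & c u = x].
Proof.
have [i [b xi]] := sphere_coord_neq0 x.
have [c Ac [dc cE]] := @hemi_chart R k i b.
have [Bu uE] := hemi_coords (dot_spt x) xi.
exists c, (spt x *m (hemi_La i)^T); split=> //; first by rewrite dc.
by apply: spt_inj; rewrite cE.
Qed.

Lemma circle_pi_repr (z : circle R) : circle_pi (circle_repr z) = z.
Proof. exact: reprK. Qed.

Lemma circle_piP (t t' : R) : circle_pi t = circle_pi t' <-> circle_eq t t'.
Proof. by split=> [/eqmodP//|h]; apply/eqmodP. Qed.

Definition arc (a : R) : param R 1 (circle R) :=
  Param [set u | a < u 0 0 < a + 2 * pi] (fun u => circle_pi (u 0 0)).

Lemma arc_atlas a : circle_atlas R (arc a).
Proof. by exists a. Qed.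

Lemma circle_cover (z : circle R) :
  exists c u, [/\ circle_atlas R c, dom c u & c u = z].
Proof.
exists (arc (circle_repr z - pi)), (const_mx (circle_repr z)); split.
- exact: arc_atlas.
- by rewrite /= mxE; have := pi_gt0 R => h; apply/andP; split; lra.
by rewrite /= mxE circle_pi_repr.
Qed.

Lemma domainF_cover {n : nat} (z : domainF R n) :
  exists c u, [/\ domainF_atlas R n c, dom c u & c u = z].
Proof.
have [c1 [u1 [A1 d1 E1]]] := circle_cover z.1.
have [c2 [u2 [A2 d2 E2]]] := sphere_cover z.2.
exists (Param [set u | dom c1 (lsubmx u) /\ dom c2 (rsubmx u)]
  (fun u => (c1 (lsubmx u), c2 (rsubmx u)))), (row_mx u1 u2); split.
- by exists c1, c2.
- by rewrite /= row_mxKl row_mxKr.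
by rewrite /= row_mxKl row_mxKr E1 E2; case: (z).
Qed.

End Cover.

(** * Immersion, minimality and spectrum for the maps F L *)

Lemma dot_unit_derive {R : realType} {m N : nat} (U : set 'rV[R]_m) (phi : 'rV[R]_m -> 'rV[R]_N) u X :
  open U -> (forall u, U u -> dot (phi u) (phi u) = 1) -> U u -> differentiable phi u ->
  dot (phi u) ('D_X phi u) = 0.
Proof.
move=> oU phi1 Uu du; have dX : is_derive u X phi ('D_X phi u) by exact/derivableP/diff_derivable.
have [_ H] := is_derive_dot dX dX.
have E : 'D_X (fun t => dot (phi t) (phi t)) u = 'D_X (cst (1 : R)) u.
  exact: (derive_ext X oU phi1 Uu).
move: H; rewrite E derive_cst dotC => H; lra.
Qed.

Lemma rank_normal_space {R : realType} {m N : nat} (phi : 'rV[R]_m -> 'rV[R]_N) u :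
  differentiable phi u -> dot (phi u) (phi u) = 1 ->
  (forall X, dot (phi u) ('D_X phi u) = 0) -> row_free ('J phi u) ->
  \rank (Defs.normal_space phi u) = (N - m.+1)%N.
Proof.
move=> du phi1 phiX rf.
suff /eqP rT : row_free (tangent_cone phi u) by rewrite mxrank_ker mxrank_tr rT.
apply: inj_row_free => c; rewrite -[c]hsubmxK mul_row_col => E.
have c0 : lsubmx c = 0.
  rewrite [lsubmx c]mx11_scalar.
  have : dot (phi u) (lsubmx c *m phi u + rsubmx c *m 'J phi u) = 0 by rewrite E dot0r.
  rewrite [lsubmx c]mx11_scalar mul_scalar_mx dotDr dotZr phi1 mulr1.
  have -> : dot (phi u) (rsubmx c *m 'J phi u) = 0.
    by apply: etrans (phiX (rsubmx c)); congr dot; exact: esym (deriveEjacobian _ du).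
  by rewrite addr0 => ->; apply/matrixP => i j; rewrite !mxE mul0rn.
move: E; rewrite c0 mul0mx add0r => /eqP; rewrite (mulmx_free_eq0 _ rf) => /eqP ->.
by rewrite row_mx0.
Qed.

Section MeanCurvatureExt.
Context {R : realType} {m N : nat} (phi psi : 'rV[R]_m -> 'rV[R]_N) (U : set 'rV[R]_m) (u : 'rV[R]_m).
Hypothesis oU : open U.
Hypothesis E : forall u, U u -> phi u = psi u.
Hypothesis Uu : U u.
Hypothesis du : differentiable phi u.

Lemma mean_curvature_ext : mean_curvature phi u = mean_curvature psi u.
Proof.
by rewrite /mean_curvature (gram_ext oU E Uu du) (second_ff_ext oU E Uu du).
Qed.

Lemma tangent_frame_ext (Y : 'M[R]_m) : tangent_frame phi u Y <-> tangent_frame psi u Y.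
Proof. by rewrite /tangent_frame (gram_ext oU E Uu du). Qed.

Lemma normal_space_ext : Defs.normal_space phi u = Defs.normal_space psi u.
Proof. by rewrite /Defs.normal_space (tangent_cone_ext oU E Uu du). Qed.

Lemma fundamental_mx_ext q (Y : 'M[R]_m) (nu : 'M[R]_(q, N)) :
  fundamental_mx phi u Y nu = fundamental_mx psi u Y nu.
Proof.
have H xi : shape_mx phi u Y xi = shape_mx psi u Y xi.
  by rewrite /shape_mx (second_ff_ext oU E Uu du).
by apply/matrixP => i j; rewrite [LHS]mxE [RHS]mxE !H.
Qed.

End MeanCurvatureExt.

Section Immersion.
Context {R : realType} (n l0 l1 : nat).
Hypothesis hn : (3 <= n)%N.
Hypothesis adm : admissible R n l0 l1.
Context {N : nat} (L : 'M[R]_((1 + n) + (1 + n), N)).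
Hypothesis LL : L *m L^T = 1%:M.
Let G (z : domainF R n) : 'rV[R]_N := F l0 l1 z *m L.
Local Notation r := (radius_r R n l0 l1).
Local Notation s := (radius_s R n l0 l1).
Local Notation torus_in i b :=
  (torus (hemi_La i) (hemi_ep i b) l0%:R l1%:R r s (blk_a L) (blk_b L) (blk_A L) (blk_B L)).

Let FL := blk_orthoframe LL.

Lemma chart_torus c : domainF_atlas R n c ->
  exists i b, [/\ open (dom c), dom c `<=` torus_dom &
    forall u, dom c u -> torus_in i b u = (G \o c) u].
Proof.
move=> Ac; have [i [b [oc cU cE]]] := domainF_chart Ac; exists i, b; split=> // u cu.
by have [x [E xE]] := cE u cu; rewrite /G /= E F_torus xE.
Qed.

Lemma dot_F_mulmx z : dot (G z) (G z) = 1.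
Proof.
have [c [u [Ac cu <-]]] := domainF_cover z.
have [i [b [oc cU cE]]] := chart_torus Ac.
rewrite -[G (c u)]/((G \o c) u) -cE //.
apply: dot_torus;
  [exact: hemi_LaLa|exact: hemi_epLa|exact: dot_hemi_ep|exact: FL|exact: radii1|exact: cU].
Qed.

Lemma smooth_F_mulmx : smooth_map (domainF_atlas R n) G.
Proof.
move=> c Ac; have [i [b [oc cU cE]]] := chart_torus Ac.
apply/smooth_onP => k; apply: Cn_ext cE _ => //.
by apply: (Cn_sub cU); exact: Cn_torus.
Qed.

Let torus_diff i b u : torus_dom u -> differentiable (torus_in i b) u.
Proof. exact: Cn_diff (Cn_torus _ _ _ _ _ _ _ _ _ _ 0). Qed.

Let frame i b u (Uu : torus_dom u) : exists e,
  (forall j k, cap_metric (rsubmx u) (row j e) (row k e) = (j == k)%:R) /\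
  tangent_frame (torus_in i b) u (torus_frame l0%:R l1%:R r s e).
Proof.
have [e e1] := cap_frame (hemi_LaLa i) (hemi_epLa i b) (dot_hemi_ep i b) Uu.
exists e; split=> //.
by apply: torus_tangent_frame => //; [exact: hemi_LaLa|exact: hemi_epLa|exact: dot_hemi_ep
  |exact: radius_s_gt0|exact: speed2_gt0].
Qed.

Lemma immersion_F_mulmx : immersion (domainF_atlas R n) G.
Proof.
split; first exact: smooth_F_mulmx.
move=> c u Ac cu; have [i [b [oc cU cE]]] := chart_torus Ac.
have [e [_ tf]] := frame i b (cU _ cu).
rewrite -(jacobian_ext oc cE cu (torus_diff i b (cU _ cu))).
exact: tangent_frame_row_free tf.
Qed.

Lemma minimal_F_mulmx : minimal (domainF_atlas R n) G.
Proof.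
move=> c u Ac cu; have [i [b [oc cU cE]]] := chart_torus Ac.
have [e [e1 tf]] := frame i b (cU _ cu).
rewrite -(mean_curvature_ext oc cE cu (torus_diff i b (cU _ cu))).
apply: torus_minimal e1 (minimal_radii hn adm) => //;
  [exact: hemi_LaLa|exact: hemi_epLa|exact: dot_hemi_ep|exact: radii1
  |exact: radius_s_gt0|exact: speed2_gt0|exact: cU].
Qed.

(** The target is the unit sphere of dimension n + q, so [q] is the codimension. The n normals of
    [torus_fundamental] carry the nonzero eigenvalues, and q - n zeros remain. *)
Lemma constant_spectrum_F_mulmx q : N = (n + q).+1 -> (n < q)%N ->
  constant_spectrum q (domainF_atlas R n) G
    (n%:R * (1 - n%:R * rho R l0 l1) :: nseq n.-1 (2 * n%:R * rho R l0 l1) ++ nseq (q - n) 0)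
    (n%:R + n%:R * (n%:R - 2) * rho R l0 l1) (n%:R + n%:R ^+ 2 * rho R l0 l1).
Proof.
move=> Nq nq z.
have n1E : n.-1.+1 = n by rewrite prednK // (leq_trans _ hn).
split.
  have [c [u [Ac cu E]]] := domainF_cover z.
  have [i [b [oc cU cE]]] := chart_torus Ac.
  have [e [e1 tf]] := frame i b (cU _ cu).
  have dt := torus_diff i b (cU _ cu).
  have rk : \rank (Defs.normal_space (torus_in i b) u) = q.
    rewrite rank_normal_space //.
    - by rewrite Nq add1n n1E subSS addKn.
    - by rewrite cE // dot_F_mulmx.
    - move=> X; apply: (dot_unit_derive X oc _ cu dt) => x cx.
      by rewrite cE // dot_F_mulmx.
    exact: tangent_frame_row_free tf.
  have [nu [nu1 nuN]] := normal_frame_ex rk.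
  exists (fundamental_mx (G \o c) u (torus_frame l0%:R l1%:R r s e) nu).
  exists c, u, (torus_frame l0%:R l1%:R r s e), nu; split; first by split.
  split; last exact: erefl.
    exact: (tangent_frame_ext oc cE cu dt _).1 tf.
  by split; [exact: nu1|rewrite -(normal_space_ext oc cE cu dt); exact: nuN].
move=> B [c [u [E [nu [[Ac cu zE] [tE [nu1 nuN] ->]]]]]].
have [i [b [oc cU cE]]] := chart_torus Ac.
have [e [e1 tf]] := frame i b (cU _ cu).
have dt := torus_diff i b (cU _ cu).
have oU := @open_torus_dom R n.-1.
rewrite -(fundamental_mx_ext oc cE cu dt).
have {}tE := (tangent_frame_ext oc cE cu dt _).2 tE.
rewrite -(normal_space_ext oc cE cu dt) in nuN.
(* The given tangent frame is replaced by the adapted one, whereas [nu] stays arbitrary: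
   [torus_fundamental] holds for every matrix [nu]. *)
rewrite (fundamental_mx_frame oU (Cn_torus _ _ _ _ _ _ _ _ _ _ 1) (cU _ cu) nu tE tf).
rewrite (torus_fundamental (hemi_LaLa i) (hemi_epLa i b) (dot_hemi_ep i b) FL (radii1 hn adm)
  (radius_s_gt0 hn adm) (speed2_gt0 hn adm) (cU _ cu) e1 (minimal_radii hn adm)).
rewrite (eigenvalue0 hn adm) (eigenvalue1 hn adm).
have W1 := torus_W1 l0%:R l1%:R (hemi_LaLa i) (hemi_epLa i b) (dot_hemi_ep i b) FL
  (radii1 hn adm) (cU _ cu) e1.
have WN := torus_W_normal l0%:R l1%:R r s (hemi_LaLa i) (hemi_epLa i b) (dot_hemi_ep i b) FL
  (cU _ cu) e.
move: W1 WN; set W := col_mx _ _ => W1 WN.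
have Wnu : (W <= nu)%MS by rewrite (eqmxP nuN).
have m2 : (2 <= n.-1)%N by rewrite -ltnS n1E.
have mq : (n.-1 < q)%N by rewrite n1E ltnW.
have [s' [h1 h2 h3 h4]] := spectrum_diag m2 mq nu1 W1 Wnu (eigenvalue0_ge0 hn adm)
  (@eigenvalue1_ge0 R n l0 l1).
rewrite h3 (@S_value R n l0 l1 hn) in h4; rewrite (@S_value R n l0 l1 hn) in h3.
exists s'; split=> //; first by rewrite n1E in h2.
by rewrite h3 h4 Q_value.
Qed.

End Immersion.

(** * Topology of the domain *)

Section CompactEmbedding.
Context {X Y : topologicalType} (f : X -> Y).
Hypothesis cf : continuous f.
Hypothesis inj_f : injective f.
Hypothesis hY : hausdorff_space Y.

Lemma injective_hausdorff : hausdorff_space X.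
Proof.
rewrite open_hausdorff => x y xy; move: hY; rewrite open_hausdorff => H.
have fxy : f x != f y by apply: contra_neq xy => /inj_f.
have [[U V] /= [xU yV] [oU oV UV]] := H _ _ fxy.
exists (f @^-1` U, f @^-1` V) => /=.
  by split; rewrite inE; [rewrite inE in xU|rewrite inE in yV].
have /continuousP c := cf; split; [exact: c|exact: c|].
by rewrite -preimage_setI (eqP UV) preimage_set0.
Qed.

Hypothesis cX : compact [set: X].

Lemma compact_closed_image (C : set X) : closed C -> closed (f @` C).
Proof.
move=> clC; apply: (compact_closed hY); apply: continuous_compact.
  exact: continuous_subspaceT.
by apply: subclosed_compact clC cX _.
Qed.

(** A continuous map from a compact space to a Hausdorff space is closed; the open set wanted is the
    complement of the image of the complement of [O], and injectivity keeps it disjoint from nothing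
    but that image. *)
Lemma compact_open_image (O : set X) : open O ->
  exists2 V : set Y, open V & f @` O = range f `&` V.
Proof.
move=> oO; exists (~` (f @` (~` O))).
  by apply: closed_openC; apply: compact_closed_image; exact: open_closedC.
apply/seteqP; split => y /=.
  move=> [x Ox <-]; split; first by exists x.
  by move=> [x' nOx' /inj_f E]; apply: nOx'; rewrite E.
by move=> [[x _ <-] H]; exists x => //; apply: contrapT => nOx; apply: H; exists x.
Qed.

Lemma compact_bijection_homeo : (forall y, exists x, f x = y) ->
  exists g : Y -> X, [/\ continuous g, cancel f g & cancel g f].
Proof.
move=> sf; have [g gK] := choice sf.
have fK : cancel f g by move=> x; apply: inj_f; rewrite gK.
exists g; split=> //; apply/continuousP => O oO.
have [V oV E] := compact_open_image oO.
suff -> : g @^-1` O = V by [].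
apply/seteqP; split => y /=.
  move=> Ogy; have : (f @` O) y by exists (g y).
  by rewrite E => -[].
move=> Vy; have : (f @` O) y by rewrite E; split=> //; exists (g y).
by move=> [x Ox <-]; rewrite fK.
Qed.

End CompactEmbedding.

Section RowTopology.
Context {R : realType} {N : nat}.

Lemma continuous_rowP {X : topologicalType} (f : X -> 'rV[R]_N) :
  (forall j, continuous (fun x => f x 0 j)) -> continuous f.
Proof.
move=> cj x; apply/cvg_ballP => e e0.
have H : forall j : 'I_N, \forall y \near x, ball (f x 0 j) e (f y 0 j).
  by move=> j; have /cvg_ballP := cj j x; apply.
have H2 : \forall y \near x, forall j, ball (f x 0 j) e (f y 0 j) by apply: filter_forall.
apply: filterS H2 => y Hy.
by split=> // i j; rewrite ord1; apply: Hy.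
Qed.

(** The base consists of the preimages of balls with rational centre and radius 1 / (k + 1). Balls
    are those of the sup norm, so a rational centre is chosen entry by entry. *)
Lemma second_countable_of_row {X : topologicalType} (f : X -> 'rV[R]_N) :
  continuous f -> injective f ->
  (forall O : set X, open O -> exists2 V, open V & f @` O = range f `&` V) ->
  @second_countable X.
Proof.
move=> cf inj_f emb.
pose Bs (qk : 'rV[rat]_N * nat) : set X :=
  f @^-1` (ball (map_mx (fun x : rat => ratr x : R) qk.1) (qk.2.+1%:R^-1)).
exists (Bs @` [set: 'rV[rat]_N * nat]).
  by apply: card_le_trans (card_image_le _ _) _; exact: countableP.
split.
  move=> _ [qk _ <-]; have /continuousP := cf; apply; exact: ball_open.
move=> x U; rewrite nbhsE => -[ O [oO Ox] sOU].
have [V oV E] := emb O oO.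
have Vfx : V (f x).
  have : (f @` O) (f x) by exists x.
  by rewrite E => -[].
have := open_nbhs_nbhs (conj oV Vfx) => /nbhs_ballP[e /= e0 eV].
have [k ke] : exists k, k.+1%:R^-1 < e / 2 :> R.
  have e2 : 0 < e / 2 by rewrite divr_gt0.
  exists (Num.truncn (e / 2)^-1); rewrite invf_plt ?posrE //.
  exact: truncnS_gt.
pose k0 : R := k.+1%:R^-1; have k00 : 0 < k0 by rewrite invr_gt0.
have [q qE] : exists q : 'I_N -> rat, forall j, f x 0 j - k0 < ratr (q j) < f x 0 j + k0.
  suff H j : exists q : rat, f x 0 j - k0 < ratr q < f x 0 j + k0 by have [q qE] := choice H; exists q.
  have [|q] := @rat_in_itvoo R (f x 0 j - k0) (f x 0 j + k0); first lra.
  by rewrite in_itv /= => qi; exists q.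
have bq : ball (map_mx (fun x : rat => ratr x : R) (\row_j q j)) k0 (f x).
  split=> // i j; rewrite ord1 !mxE /ball /= ltr_distl; have /andP[h1 h2] := qE j.
  by apply/andP; split; lra.
exists (Bs (\row_j q j, k)); first by split; [exists (\row_j q j, k)|].
move=> y By; apply: sOU.
have Vy : V (f y).
  apply: eV; have -> : e = e / 2 + e / 2 by lra.
  apply: (@ball_triangle _ _ (map_mx (fun x : rat => ratr x : R) (\row_j q j))).
    by apply: ball_sym; apply: le_ball bq; exact: ltW.
  by apply: le_ball By; exact: ltW.
have : (f @` O) (f y) by rewrite E; split => //; exists y.
by move=> [x' Ox' /inj_f <-].
Qed.

End RowTopology.

Section SphereTopology.
Context {R : realType}.

Lemma spt_continuous {k} : continuous (@spt R k).
Proof. exact: initial_continuous. Qed.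

Lemma to_sphere_continuous {k} {X : topologicalType} (f : X -> sphere R k) :
  continuous (fun x => spt (f x)) -> continuous f.
Proof. by move=> cf; apply: continuous_comp_initial. Qed.

Lemma dot_continuous {k} : continuous (fun x : 'rV[R]_k => dot x x).
Proof. by move=> x; apply/differentiable_continuous/(Cn_diff (Cn_sqnorm 0 openT)). Qed.

Lemma rV_hausdorff {k} : hausdorff_space 'rV[R]_k.
Proof. exact: norm_hausdorff. Qed.

Lemma sphere_hausdorff k : hausdorff_space (sphere R k).
Proof. exact: injective_hausdorff spt_continuous (@spt_inj R k) rV_hausdorff. Qed.

Lemma sphere_compact k : compact [set: sphere R k].
Proof.
have [[x0]|n0] := pselect (inhabited (sphere R k)); last first.
  have -> : [set: sphere R k] = set0 by apply/seteqP; split => x // _; apply: n0.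
  exact: compact0.
pose A : set 'rV[R]_k := @unit_sphere R k.
(* A retraction of sets onto the sphere, with default value [x0] elsewhere; an empty sphere has been
   treated separately. *)
pose f (x : 'rV[R]_k) : sphere R k := if pselect (dot x x = 1) is left h then exist _ x (mem_set h) else x0.
have fE (x : sphere R k) : f (spt x) = x.
  apply: spt_inj; rewrite /f; case: pselect => // h; exfalso; exact: (h (dot_spt x)).
have cA : compact A.
  apply: bounded_closed_compact.
    exists 1; split=> // M M1 x /= x1; apply: (le_trans _ (ltW M1)).
    rewrite /Num.Def.normr /= mx_normrE; apply: bigmax_le => // -[i j] _ /=.
    rewrite ord1 -(@ler_pXn2r _ 2) ?nnegrE // expr1n real_normK ?num_real // expr2.
    by rewrite -x1 dotE (bigD1 j) //= lerDl; apply: sumr_ge0 => l _; rewrite -expr2 sqr_ge0.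
  have -> : A = (fun x : 'rV[R]_k => dot x x) @^-1` [set 1] by [].
  apply: closed_comp; first by move=> x _; exact: dot_continuous.
  exact: closed_eq.
have -> : [set: sphere R k] = f @` A.
  apply/seteqP; split => x // _; exists (spt x); last exact: fE.
  exact: dot_spt.
apply: continuous_compact cA; apply/subspace_sigL_continuousP.
have -> : sigL A f = (fun x : A => (x : sphere R k)) by apply/funext => x; exact: fE.
by move=> x; exact: cvg_id.
Qed.

End SphereTopology.

Lemma fst_continuous {X Y : topologicalType} : continuous (@fst X Y).
Proof. by move=> z; exact: cvg_fst. Qed.

Lemma snd_continuous {X Y : topologicalType} : continuous (@snd X Y).
Proof. by move=> z; exact: cvg_snd. Qed.

(** * The circle as a quotient of the line *)

Section Circle.
Context {R : realType}.
Implicit Types t : R.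

Lemma pi2_gt0 : 0 < 2 * pi :> R. Proof. by rewrite mulr_gt0 // pi_gt0. Qed.
Lemma pi2_neq0 : 2 * pi != 0 :> R. Proof. by rewrite gt_eqF // pi2_gt0. Qed.

Lemma circle_eqP t t' : circle_eq t t' <-> exists k : int, t = t' + k%:~R * (2 * pi).
Proof.
split=> [/intrP[k hk]|[k ->]].
  by exists k; rewrite -hk divfK ?pi2_neq0 // addrC subrK.
by apply/intrP; exists k; rewrite addrC addKr mulfK ?pi2_neq0.
Qed.

Lemma circle_eq_cos t t' (l : nat) : circle_eq t t' -> cos (l%:R * t) = cos (l%:R * t').
Proof. by move=> /(cis_periodic l) []. Qed.

Lemma circle_eq_sin t t' (l : nat) : circle_eq t t' -> sin (l%:R * t) = sin (l%:R * t').
Proof. by move=> /(cis_periodic l) []. Qed.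

Lemma circle_reduce t : exists2 t', circle_eq t t' & 0 <= t' < 2 * pi.
Proof.
have p0 := pi2_gt0.
exists (t - (Num.floor (t / (2 * pi)))%:~R * (2 * pi)).
  by apply/circle_eqP; exists (Num.floor (t / (2 * pi))); rewrite subrK.
have h1 : (Num.floor (t / (2 * pi)))%:~R <= t / (2 * pi) by exact: floor_le_tmp.
have h2 : t / (2 * pi) < (Num.floor (t / (2 * pi)) + 1)%:~R by exact: floorD1_gt.
rewrite subr_ge0 -ler_pdivlMr // h1 /= ltrBlDl.
by rewrite -[X in _ < _ + X]mul1r -mulrDl -ltr_pdivrMr // -[1]/(1%:~R) -intrD.
Qed.

(** After reduction to [0, 2 pi), the cosine is 1 - 2 sin^2 (t' / 2), and the sine of the half angle
    is positive unless t' = 0. *)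
Lemma cos_eq1 t : cos t = 1 -> circle_eq t 0.
Proof.
move=> ct; have [t' tt' /andP[t0 t2]] := circle_reduce t.
have ct' : cos t' = 1 by have := circle_eq_cos 1 tt'; rewrite !mul1r => <-.
suff t'0 : t' = 0 by rewrite -t'0.
apply/eqP; rewrite eq_le t0 andbT leNgt; apply/negP => t'0.
have s0 : 0 < sin (t' / 2) by apply: sin_gt0_pi; apply/andP; split; lra.
have : cos t' = 1 - 2 * sin (t' / 2) ^+ 2.
  have tE : t' = (t' / 2) *+ 2 by rewrite -mulr_natr divfK.
  rewrite {1}tE cos_mulr2n cos2sin2 -mulr_natr; lra.
rewrite ct' => H; have : 0 < sin (t' / 2) ^+ 2 by rewrite exprn_gt0.
lra.
Qed.

Lemma cos_sin_eq t t' : cos t = cos t' -> sin t = sin t' -> circle_eq t t'.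
Proof.
move=> ct st; have : cos (t - t') = 1 by rewrite cosB ct st -!expr2 cos2Dsin2.
by move=> /cos_eq1; rewrite /circle_eq subr0.
Qed.

Lemma sin_eq0_circle t : sin t = 0 -> circle_eq (2 * t) 0.
Proof.
move=> st; apply: cos_eq1; rewrite mulr_natl cos_mulr2n cos2sin2 st expr0n subr0 -mulr_natr; lra.
Qed.

Lemma circle_pi_continuous : continuous (@circle_pi R).
Proof. exact: pi_continuous. Qed.

(** The preimage of the image of [O] is the union of the translates of [O] by multiples of 2 pi. *)
Lemma circle_pi_open (O : set R) : open O -> open (@circle_pi R @` O).
Proof.
move=> oO; rewrite /open /= /quotient_open.
have -> : (\pi_{eq_quot (circle_equiv R)}%qT) @^-1` (@circle_pi R @` O) =
    \bigcup_(k in [set: int]) ((fun t => t - k%:~R * (2 * pi)) @^-1` O).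
  apply/seteqP; split => t /=.
    move=> [t' Ot' E]; have /circle_piP/circle_eqP[k tE] : circle_pi t = circle_pi t' by rewrite E.
    by exists k => //=; rewrite tE addrK.
  move=> [k _ Ot] /=; exists (t - k%:~R * (2 * pi)) => //.
  by apply/circle_piP/circle_eqP; exists (- k); rewrite mulrNz mulNr.
apply: bigcup_open => k _; apply: open_comp => // t _.
by apply: cvgB; [exact: cvg_id|exact: cvg_cst].
Qed.

Lemma circle_fun_continuous (f : R -> R) : continuous f ->
  (forall t t', circle_eq t t' -> f t = f t') ->
  continuous (fun z : circle R => f (circle_repr z)).
Proof.
move=> cf fE; apply: (@repr_comp_continuous R _ R f cf) => t t' /eqP/circle_piP h.
by apply/eqP/fE.
Qed.

Lemma circle_cos_continuous (l : nat) : continuous (fun z : circle R => cos (l%:R * circle_repr z)).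
Proof.
apply: (circle_fun_continuous (f := fun t => cos (l%:R * t))).
  move=> t; apply: (@continuous_comp _ _ _ (fun t => l%:R * t) cos); last exact: continuous_cos.
  exact: mulrl_continuous.
by move=> t t'; exact: circle_eq_cos.
Qed.

Lemma circle_sin_continuous (l : nat) : continuous (fun z : circle R => sin (l%:R * circle_repr z)).
Proof.
apply: (circle_fun_continuous (f := fun t => sin (l%:R * t))).
  move=> t; apply: (@continuous_comp _ _ _ (fun t => l%:R * t) sin); last exact: continuous_sin.
  exact: mulrl_continuous.
by move=> t t'; exact: circle_eq_sin.
Qed.

Lemma circle_compact : compact [set: circle R].
Proof.
have -> : [set: circle R] = @circle_pi R @` `[0, 2 * pi].
  apply/seteqP; split => z // _; have [t zt /andP[t0 t2]] := circle_reduce (circle_repr z).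
  exists t; first by rewrite /= in_itv /= t0 ltW.
  by rewrite -(circle_pi_repr z); apply/esym/circle_piP.
apply: continuous_compact; last exact: segment_compact.
exact/continuous_subspaceT/circle_pi_continuous.
Qed.

(** The map (cos, sin). Compactness of the circle turns it into a homeomorphism by
    [compact_bijection_homeo]; for surjectivity the angle is plus or minus [acos a], according to
    the sign of the second coordinate. *)
Lemma circle_sphere2 : exists f : circle R -> sphere R 2,
  [/\ continuous f, injective f & forall y, exists z, f z = y].
Proof.
pose v t : 'rV[R]_2 := \row_j (if j == 0 then cos t else sin t).
have v1 t : dot (v t) (v t) = 1.
  by rewrite dotE !big_ord_recl big_ord0 !mxE /= addr0 -!expr2 cos2Dsin2.
have [f fE] := choice (fun z : circle R => spt_ex (v1 (circle_repr z))).
exists f; split.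
- apply: to_sphere_continuous; apply: continuous_rowP => j.
  under eq_fun do rewrite fE mxE.
  case: (j == 0).
    by have := @circle_cos_continuous 1; under eq_fun do rewrite mul1r.
  by have := @circle_sin_continuous 1; under eq_fun do rewrite mul1r.
- move=> z z' /(congr1 spt); rewrite !fE => /rowP E.
  rewrite -(circle_pi_repr z) -(circle_pi_repr z'); apply/circle_piP/cos_sin_eq.
    by have := E 0; rewrite !mxE.
  by have := E 1; rewrite !mxE.
move=> y; have := dot_spt y; rewrite dotE !big_ord_recl big_ord0 /= addr0 -!expr2 => y1.
set a := spt y 0 0 in y1 *; set b := spt y 0 _ in y1 *.
have b2 : b ^+ 2 = 1 - a ^+ 2 by rewrite -y1 addrC addKr.
have a1 : -1 <= a <= 1 by rewrite -ler_norml -(@ler_pXn2r _ 2) ?nnegrE // expr1n real_normK ?num_real // -y1 lerDl sqr_ge0.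
have [t ct st] : exists2 t, cos t = a & sin t = b.
  have [b0|b0] := leP 0 b.
    exists (acos a); first by rewrite acosK // in_itv.
    by rewrite sin_acos // -b2 sqrtr_sqr ger0_norm.
  exists (- acos a); first by rewrite cosN acosK // in_itv.
  by rewrite sinN sin_acos // -b2 sqrtr_sqr ltr0_norm // opprK.
exists (circle_pi t); apply: spt_inj; rewrite fE.
have h : circle_eq (circle_repr (circle_pi t)) t by apply/circle_piP; exact: circle_pi_repr.
apply/rowP => j; rewrite mxE.
have := circle_eq_cos 1 h; have := circle_eq_sin 1 h; rewrite !mul1r => -> ->.
rewrite ct st /a /b; case: (unliftP 0 j) => [j' ->|->] /=.
  by congr (spt y 0 _); apply: val_inj; rewrite /= ord1.
by [].
Qed.

Lemma domainF_homeo n : homeomorphic (domainF R n) (sphere R 2 * sphere R n)%type.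
Proof.
have [f [cf inj_f sf]] := circle_sphere2.
have [g [cg fK gK]] := compact_bijection_homeo cf inj_f (@sphere_hausdorff R 2) circle_compact sf.
exists (fun z => (f z.1, z.2)), (fun z => (g z.1, z.2)); split.
- move=> z.
  have h1 : f z'.1 @[z' --> z] --> f z.1.
    by apply: (@continuous_comp _ _ _ fst f); [exact: fst_continuous|exact: cf].
  have h2 : z'.2 @[z' --> z] --> z.2 by exact: snd_continuous.
  exact: cvg_pair h1 h2.
- move=> z.
  have h1 : g z'.1 @[z' --> z] --> g z.1.
    by apply: (@continuous_comp _ _ _ fst g); [exact: fst_continuous|exact: cg].
  have h2 : z'.2 @[z' --> z] --> z.2 by exact: snd_continuous.
  exact: cvg_pair h1 h2.
- by move=> [z x] /=; rewrite fK.
by move=> [z x] /=; rewrite gK.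
Qed.

End Circle.

(** * Connectedness of the domain and the embedding property *)

Lemma connected_paths {R : realType} {X : topologicalType} (x0 : X) :
  (forall x, exists g : R -> X, [/\ continuous g, g 0 = x0 & g 1 = x]) ->
  connected [set: X].
Proof.
move=> H; have [g gP] := choice H.
have -> : [set: X] = \bigcup_(x in [set: X]) (g x @` [set: R]).
  apply/seteqP; split => x // _; exists x => //; exists 1 => //.
  by have [] := gP x.
apply: bigcup_connected.
  by exists x0 => x _; exists 0 => //; have [] := gP x.
move=> x _; apply: connected_continuous_connected.
  by apply/connected_intervalP => a b _ _ c _.
by apply: continuous_subspaceT; have [] := gP x.
Qed.

Section SpherePaths.
Context {R : realType} {k : nat}.
Hypothesis k2 : (2 <= k)%N.

Lemma great_circle (e x : 'rV[R]_k) : dot e e = 1 -> dot x x = 1 ->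
  exists y b, [/\ dot y y = 1, dot e y = 0 & x = cos b *: e + sin b *: y].
Proof.
move=> e1 x1; pose c := dot e x; pose z := x - c *: e.
have ez : dot e z = 0 by rewrite dotBr dotZr e1 mulr1 subrr.
have zz : dot z z = 1 - c ^+ 2.
  rewrite /z !(dotBl, dotBr) !dotZl !dotZr x1 e1 (dotC x e) -/c; ring.
have c1 : -1 <= c <= 1.
  rewrite -ler_norml -(@ler_pXn2r _ 2) ?nnegrE // expr1n real_normK ?num_real //.
  by rewrite -subr_ge0 -zz dot_ge0.
(* If [z] vanishes, [x] is [e] or its antipode and the great circle is not determined; any unit
   vector orthogonal to [e] serves, and one exists because [2 <= k]. *)
have [z0|zn] := eqVneq z 0.
  have [nu nu1 nue] : exists2 nu : 'M[R]_(1, k), nu *m nu^T = 1%:M & (nu <= kermx e^T)%MS.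
    apply: orthonormal_rows; rewrite mxrank_ker mxrank_tr.
    by rewrite subn_gt0; apply: leq_ltn_trans (rank_leq_row e) k2.
  exists nu, (acos c); split; first by rewrite /dot nu1 mxE.
    by rewrite dotC /dot (sub_kermxP nue) mxE.
  rewrite sin_acos // -zz z0 dot0l sqrtr0 scale0r addr0 acosK ?in_itv //.
  by apply/eqP; rewrite -subr_eq0 -/z z0.
have [y [r r0 zE] _] := spt_normalize zn.
exists (spt y), (acos c); split; first exact: dot_spt.
  by move: ez; rewrite zE dotZr => /eqP; rewrite mulf_eq0 gt_eqF //= => /eqP.
rewrite sin_acos // -zz acosK ?in_itv // zE dotZl dotZr dot_spt mulr1 -expr2 sqrtr_sqr gtr0_norm //.
by rewrite -zE /z addrC subrK.
Qed.

Lemma sphere_path (x0 x : sphere R k) :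
  exists g : R -> sphere R k, [/\ continuous g, g 0 = x0 & g 1 = x].
Proof.
have [y [b [y1 xy xE]]] := great_circle (dot_spt x0) (dot_spt x).
pose v t := cos (b * t) *: spt x0 + sin (b * t) *: y.
have v1 t : dot (v t) (v t) = 1.
  rewrite /v !(dotDl, dotDr) !dotZl !dotZr dot_spt y1 xy dotC xy.
  by rewrite !mulr0 !mulr1 addr0 add0r -!expr2 cos2Dsin2.
have [g gE] := choice (fun t => spt_ex (v1 t)).
exists g; split.
- apply: to_sphere_continuous; apply: continuous_rowP => j.
  under eq_fun do rewrite gE !mxE.
  have cb : continuous (fun t : R => b * t) by exact: mulrl_continuous.
  move=> t; apply: cvgD; apply: cvgM; try exact: cvg_cst.
    by apply: (@continuous_comp _ _ _ (fun t => b * t) cos); [exact: cb|exact: continuous_cos].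
  by apply: (@continuous_comp _ _ _ (fun t => b * t) sin); [exact: cb|exact: continuous_sin].
- by apply: spt_inj; rewrite gE /v mulr0 cos0 sin0 scale1r scale0r addr0.
by apply: spt_inj; rewrite gE /v mulr1 -xE.
Qed.

End SpherePaths.

Section DomainTopology.
Context {R : realType} (n : nat).
Hypothesis hn : (3 <= n)%N.

Lemma domainF_connected : connected [set: domainF R n].
Proof.
have [x0 _] := @spt_delta_ex R n (Ordinal (ltnW (ltnW hn))).
apply: (@connected_paths R _ (circle_pi 0, x0)) => -[z x].
have [g [cg g0 g1]] := sphere_path (ltnW hn) x0 x.
exists (fun t => (circle_pi (circle_repr z * t), g t)); split.
- move=> t.
  have h1 : circle_pi (circle_repr z * s) @[s --> t] --> circle_pi (circle_repr z * t).
    apply: (@continuous_comp _ _ _ (fun s => circle_repr z * s) circle_pi).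
      exact: mulrl_continuous.
    exact: circle_pi_continuous.
  exact: cvg_pair h1 (cg t).
- by rewrite mulr0 g0.
by rewrite mulr1 g1 circle_pi_repr.
Qed.

Lemma domainF_compact : compact [set: domainF R n].
Proof.
have -> : [set: domainF R n] = [set: circle R] `*` [set: sphere R n].
  by apply/seteqP; split => // -[].
by apply: compact_setX; [exact: circle_compact|exact: sphere_compact].
Qed.

Variables (l0 l1 : nat).
Hypothesis adm : admissible R n l0 l1.
Context {N : nat} (L : 'M[R]_((1 + n) + (1 + n), N)).
Hypothesis LL : L *m L^T = 1%:M.
Let G (z : domainF R n) : 'rV[R]_N := F l0 l1 z *m L.
Local Notation r := (radius_r R n l0 l1).
Local Notation s := (radius_s R n l0 l1).

Lemma F_mulmxE z : G z = r *: rotmx (blk_a L) (blk_b L) (l0%:R * circle_repr z.1) +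
  s *: (spt z.2 *m rotmx (blk_A L) (blk_B L) (l1%:R * circle_repr z.1)).
Proof. by case: z => z x; rewrite -F_torus /G /= circle_pi_repr. Qed.

Lemma continuous_F_mulmx : continuous G.
Proof.
have c1 (f : circle R -> R) : continuous f -> continuous (fun z : domainF R n => f z.1).
  by move=> cf z; apply: (@continuous_comp _ _ _ fst f); [exact: fst_continuous|exact: cf].
have cc l := c1 _ (@circle_cos_continuous R l).
have cs l := c1 _ (@circle_sin_continuous R l).
have cx k : continuous (fun z : domainF R n => spt z.2 0 k).
  move=> z; apply: (@continuous_comp _ _ _ (fun z : domainF R n => spt z.2) (fun v : 'rV[R]_n => v 0 k)).
    by apply: (@continuous_comp _ _ _ snd spt); [exact: snd_continuous|exact: spt_continuous].
  exact: coord_continuous.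
apply: continuous_rowP => j.
have -> : (fun z => G z 0 j) = (fun z =>
   r * (cos (l0%:R * circle_repr z.1) * blk_a L 0 j + sin (l0%:R * circle_repr z.1) * blk_b L 0 j) +
   s * \sum_k spt z.2 0 k * (cos (l1%:R * circle_repr z.1) * blk_A L k j + sin (l1%:R * circle_repr z.1) * blk_B L k j)).
  apply/funext => z; rewrite F_mulmxE /rotmx !mxE; congr (_ + _ * _).
  by apply: eq_bigr => k _; rewrite !mxE.
have comb (f g : domainF R n -> R) (u v : R) : continuous f -> continuous g ->
    continuous (fun z => f z * u + g z * v).
  by move=> cf cg z; apply: cvgD; apply: cvgM; [exact: cf|exact: cvg_cst|exact: cg|exact: cvg_cst].
move=> z; apply: cvgD; apply: cvgM; [exact: cvg_cst| |exact: cvg_cst|].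
  by apply: comb; [exact: cc|exact: cs].
move: z; rewrite -[X in continuous X]fct_sumE; elim/big_ind: _ => [|f g cf cg|k _] z.
- exact: cvg_cst.
- by apply: cvgD; [exact: cf|exact: cg].
by apply: cvgM; [exact: cx|apply: comb; [exact: cc|exact: cs]].
Qed.

(** Pairing with the four blocks separates the components. The first gives l0 (t - t') = 2 pi k. The
    second is exp(i l1 t) x = exp(i l1 t') x' with real unit vectors, hence sin (l1 (t - t')) = 0
    and 2 l1 (t - t') = 2 pi j. So 2 l1 k = j l0; as [l0] is odd and prime to [l1], it divides k,
    and t - t' is a multiple of 2 pi. *)
Lemma injective_F_mulmx : injective G.
Proof.
have rn : r != 0 by rewrite gt_eqF ?radius_r_gt0.
have sn : s != 0 by rewrite gt_eqF ?radius_s_gt0.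
have [l0_gt0 l1_gt0] : (0 < l0)%N /\ (0 < l1)%N by case: adm.
move=> [z x] [z' x']; rewrite !F_mulmxE /=.
move: (circle_pi_repr z) (circle_pi_repr z'); set t := circle_repr z; set t' := circle_repr z'.
move=> <- <- E; have FL := blk_orthoframe LL.
have Ea (v : 'rV[R]_N) : (r *: rotmx (blk_a L) (blk_b L) (l0%:R * t) +
    s *: (spt x *m rotmx (blk_A L) (blk_B L) (l1%:R * t))) *m v^T =
   (r *: rotmx (blk_a L) (blk_b L) (l0%:R * t') +
    s *: (spt x' *m rotmx (blk_A L) (blk_B L) (l1%:R * t'))) *m v^T by rewrite E.
have proj (y : 'rV[R]_n) a b : 
    [/\ (r *: rotmx (blk_a L) (blk_b L) a + s *: (y *m rotmx (blk_A L) (blk_B L) b)) *m (blk_a L)^T = (r * cos a)%:M,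
     (r *: rotmx (blk_a L) (blk_b L) a + s *: (y *m rotmx (blk_A L) (blk_B L) b)) *m (blk_b L)^T = (r * sin a)%:M,
     (r *: rotmx (blk_a L) (blk_b L) a + s *: (y *m rotmx (blk_A L) (blk_B L) b)) *m (blk_A L)^T = (s * cos b) *: y &
     (r *: rotmx (blk_a L) (blk_b L) a + s *: (y *m rotmx (blk_A L) (blk_B L) b)) *m (blk_B L)^T = (s * sin b) *: y].
  case: FL => pp qq pq PP QQ PQ pP pQ qP qQ.
  have qp := mulmx_tr0 pq; have QP := mulmx_tr0 PQ; have Pp := mulmx_tr0 pP.
  have Qp := mulmx_tr0 pQ; have Pq := mulmx_tr0 qP; have Qq := mulmx_tr0 qQ.
  split; rewrite /rotmx mulmxDl -!scalemxAl -mulmxA !mulmxDl -!scalemxAl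
    ?(pp, qq, pq, PP, QQ, PQ, pP, pQ, qP, qQ, qp, QP, Pp, Qp, Pq, Qq) ?mulmxDr -?scalemxAr
    ?(mulmx0, mulmx1, scaler0, addr0, add0r) ?scalerA ?mul_mx_scalar ?scale_scalar_mx ?mulr1 //.
have [a1 a2 a3 a4] := proj (spt x) (l0%:R * t) (l1%:R * t).
have [b1 b2 b3 b4] := proj (spt x') (l0%:R * t') (l1%:R * t').
have ct : cos (l0%:R * t) = cos (l0%:R * t').
  apply: (mulfI rn); have := congr1 (fun M : 'M[R]_1 => M 0 0) (etrans (esym a1) (etrans (congr1 (fun v => v *m (blk_a L)^T) E) b1)).
  by rewrite !mxE eqxx !mulr1n.
have st : sin (l0%:R * t) = sin (l0%:R * t').
  apply: (mulfI rn); have := congr1 (fun M : 'M[R]_1 => M 0 0) (etrans (esym a2) (etrans (congr1 (fun v => v *m (blk_b L)^T) E) b2)).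
  by rewrite !mxE eqxx !mulr1n.
have cx : cos (l1%:R * t) *: spt x = cos (l1%:R * t') *: spt x'.
  apply: (scalerI sn); rewrite !scalerA.
  exact: (etrans (esym a3) (etrans (congr1 (fun v => v *m (blk_A L)^T) E) b3)).
have sx : sin (l1%:R * t) *: spt x = sin (l1%:R * t') *: spt x'.
  apply: (scalerI sn); rewrite !scalerA.
  exact: (etrans (esym a4) (etrans (congr1 (fun v => v *m (blk_B L)^T) E) b4)).
have tt' : circle_eq t t'.
  have s0 : sin (l1%:R * t - l1%:R * t') = 0.
    pose c := dot (spt x') (spt x).
    have h1 : cos (l1%:R * t) = cos (l1%:R * t') * c.
      by have := congr1 (fun v => dot v (spt x)) cx; rewrite !dotZl dot_spt mulr1.
    have h2 : sin (l1%:R * t) = sin (l1%:R * t') * c.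
      by have := congr1 (fun v => dot v (spt x)) sx; rewrite !dotZl dot_spt mulr1.
    by rewrite sinB h1 h2; ring.
  have /circle_eqP[j jE] := sin_eq0_circle s0.
  have /circle_eqP[k kE] := cos_sin_eq ct st.
  have l0R : l0%:R != 0 :> R by rewrite pnatr_eq0 -lt0n.
  have pn := @pi2_neq0 R.
  have jk : (2 * l1%:Z * k = j * l0%:Z)%R.
    apply: (@intr_inj R); rewrite !intrM -!pmulrn.
    apply: (mulIf pn).
    have d0 : l0%:R * (t - t') = k%:~R * (2 * pi) by rewrite mulrBr kE addrC addKr.
    rewrite add0r in jE.
    transitivity (2 * l1%:R * (l0%:R * (t - t'))); first by rewrite d0; ring.
    by rewrite [RHS]mulrAC -jE; ring.
  have dk : (l0 %| k)%Z.
    have co : coprimez l0 (2 * l1%:Z).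
      rewrite coprimezE abszM /= coprimeMr.
      by case: adm => _ co od _; rewrite co coprimen2 od.
    by rewrite -(Gauss_dvdzr _ co); apply/dvdzP; exists j; rewrite jk.
  have /dvdzP[k' kk'] := dk.
  apply/circle_eqP; exists k'; apply: (mulfI l0R).
  by rewrite kE kk' intrM -pmulrn; ring.
have E1 : circle_pi t = circle_pi t' by apply/circle_piP.
rewrite E1; congr (_, _); apply: spt_inj.
rewrite (circle_eq_cos l1 tt') in cx; rewrite (circle_eq_sin l1 tt') in sx.
(* Either the cosine or the sine may vanish, so neither equation can be divided out; they are added
   with cosine and sine as weights. *)
rewrite -[LHS]scale1r -[RHS]scale1r -(cos2Dsin2 (l1%:R * t')) !scalerDl !expr2 -!scalerA.
by rewrite cx sx.
Qed.

Lemma embedding_F_mulmx : embedding (domainF_atlas R n) G.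
Proof.
split; [exact: immersion_F_mulmx|exact: injective_F_mulmx|exact: continuous_F_mulmx|].
by apply: compact_open_image; [exact: continuous_F_mulmx|exact: injective_F_mulmx|exact: rV_hausdorff|exact: domainF_compact].
Qed.

End DomainTopology.

(** * The manifold structure of the domain *)

Lemma cap_left_inverse {R : realType} {m n : nat} (La : 'M[R]_(m, n)) (ep : 'rV[R]_n) u :
  La *m La^T = 1%:M -> ep *m La^T = 0 -> cap La ep u *m La^T = u.
Proof.
by move=> LL Le; rewrite /cap mulmxDl -mulmxA LL mulmx1 -scalemxAl Le scaler0 addr0.
Qed.

Section Manifold.
Context {R : realType} (n : nat).

Lemma arc_injective (a t t' : R) : a < t < a + 2 * pi -> a < t' < a + 2 * pi ->
  circle_eq t t' -> t = t'.
Proof.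
move=> /andP[h1 h2] /andP[h3 h4] /circle_eqP[k tE].
have p0 := @pi2_gt0 R.
suff k0 : k = 0 by rewrite tE k0 mul0r addr0.
have [k1 k2] : (k%:~R : R) * (2 * pi) < 1 * (2 * pi) /\ (-1 : R) * (2 * pi) < k%:~R * (2 * pi).
  move: tE h1 h2 h3 h4; set x := _%:~R * _; set y := 2 * pi => tE h1 h2 h3 h4.
  by split; lra.
rewrite !ltr_pM2r // in k1 k2.
have {}k1 : k < 1 by rewrite -(ltr_int R).
have {}k2 : -1 < k by rewrite -(ltr_int R) rmorphN.
by move: k1 k2; clear; case: k => [[|k]|k].
Qed.

Lemma hemi_injective (i : 'I_n) (b : bool) (u u' : 'rV[R]_n.-1) :
  cap (hemi_La i) (hemi_ep i b) u = cap (hemi_La i) (hemi_ep i b) u' -> u = u'.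
Proof.
move=> /(congr1 (fun v => v *m (hemi_La i)^T)).
by rewrite !(cap_left_inverse _ (hemi_LaLa i) (hemi_epLa i b)).
Qed.

Lemma hemi_left_inverse (i : 'I_n) (b : bool) (u : 'rV[R]_n.-1) :
  cap (hemi_La i) (hemi_ep i b) u *m (hemi_La i)^T = u.
Proof.
exact: cap_left_inverse (hemi_LaLa i) (hemi_epLa i b).
Qed.

Lemma hemi_coord (i : 'I_n) (b : bool) (u : 'rV[R]_n.-1) :
  (-1) ^+ b * cap (hemi_La i) (hemi_ep i b) u 0 i = height u.
Proof.
rewrite -hemisphereE mxE unlift_none mulrA -expr2 sqrr_sign mul1r //.
Qed.

(** What the arguments below use of a chart: the start [a] of its arc, and the axis [i] and sign [b]
    of its half sphere. *)
Definition chart_data (c : param R (1 + n.-1) (domainF R n)) (a : R) (i : 'I_n) (b : bool) : Prop :=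
  (forall u, dom c u <-> a < angle u < a + 2 * pi /\ ball1 (rsubmx u)) /\
  forall u, dom c u -> (c u).1 = circle_pi (angle u) /\
    spt (c u).2 = cap (hemi_La i) (hemi_ep i b) (rsubmx u).

Lemma chart_dataP c : domainF_atlas R n c -> exists a i b, chart_data c a i b.
Proof.
move=> [c1 [c2 [[a [d1 E1]] [d2 [i [b E2]]] ->]]] /=; exists a, i, b; split=> /= [u|u [u1 u2]].
  by rewrite d1 d2.
by rewrite E1 // E2 // hemisphereE.
Qed.

Lemma chart_open c : domainF_atlas R n c -> open (dom c).
Proof. by move=> /domainF_chart [i [b []]]. Qed.

Lemma angle_continuous {m} : continuous (@angle R m).
Proof.
have -> : @angle R m = fun v => v 0 (lshift m 0) by apply/funext => v; rewrite /angle mxE.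
exact: coord_continuous.
Qed.

Lemma chart_injective c : domainF_atlas R n c -> {in dom c &, injective c}.
Proof.
move=> /chart_dataP [a [i [b [dE cE]]]] u u'; rewrite !inE => cu cu' E.
have [E1 E2] := cE u cu; have [E1' E2'] := cE u' cu'.
have [au _] := (dE u).1 cu; have [au' _] := (dE u').1 cu'.
rewrite -[u]hsubmxK -[u']hsubmxK; congr row_mx.
  rewrite [LHS]mx11_scalar [RHS]mx11_scalar; congr (_%:M).
  apply: (arc_injective au au'); apply/circle_piP.
  by rewrite -E1 -E1' E.
by apply: (@hemi_injective i b); rewrite -E2 -E2' E.
Qed.

Lemma chart_continuous c : domainF_atlas R n c -> {within dom c, continuous c}.
Proof.
move=> Ac; have oc := chart_open Ac.
rewrite continuous_open_subspace //.
have [a [i [b [dE cE]]]] := chart_dataP Ac.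
move=> u; rewrite inE => cu.
have ncu : \forall x \near u, dom c x by exact: open_nbhs_nbhs (conj oc cu).
have h1 : (c x).1 @[x --> u] --> (c u).1.
  have [-> _] := cE u cu.
  apply: (@cvg_trans _ (circle_pi (angle x) @[x --> u])).
    have nE : \forall x \near u, circle_pi (angle x) = (c x).1.
      by apply: filterS ncu => x cx; have [-> _] := cE x cx.
    exact: near_eq_cvg nE.
  apply: (@continuous_comp _ _ _ angle circle_pi); first exact: angle_continuous.
  exact: circle_pi_continuous.
have h2 : (c x).2 @[x --> u] --> (c u).2.
  move=> V /=; rewrite nbhsE => -[ W [[W' oW' WE] Wu] WV].
  have cc : {for u, continuous (fun x => cap (@hemi_La R n i) (hemi_ep i b) (rsubmx x))}.
    apply: (@continuous_comp _ _ _ (rsubmx : 'rV[R]_(1 + n.-1) -> _) (cap (hemi_La i) (hemi_ep i b))).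
      exact/differentiable_continuous/differentiable_rsubmx.
    have [_ Bu] := (dE u).1 cu.
    exact/differentiable_continuous/(Cn_diff (Cn_cap _ _ 0) Bu).
  have W'u : W' (cap (hemi_La i) (hemi_ep i b) (rsubmx u)).
    by have [_ <-] := cE u cu; move: Wu; rewrite -WE.
  have := cc _ (open_nbhs_nbhs (conj oW' W'u)).
  rewrite !near_simpl /=; apply: filterS2 ncu => x cx W'x; apply: WV.
  have [_ E] := cE x cx.
  by rewrite -WE; change (W' (spt (c x).2)); rewrite E.
have H : ((c x).1, (c x).2) @[x --> u] --> ((c u).1, (c u).2) by exact: cvg_pair h1 h2.
have E : (fun x => ((c x).1, (c x).2)) = c by apply/funext => x; case: (c x).
by rewrite E -surjective_pairing in H.
Qed.

(** Around an image point the product [A] x [B] is found inside the image: [A] is the image of a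
    small arc, and [B] is cut out by the sign of the [i]-th coordinate and by the projection that
    inverts the chart of the half sphere. *)
Lemma chart_open_map c O : domainF_atlas R n c -> open O -> O `<=` dom c -> open (c @` O).
Proof.
move=> Ac oO Oc; have [a [i [b [dE cE]]]] := chart_dataP Ac.
rewrite openE => _ [u Ou <-]; have cu := Oc u Ou.
have [E1 E2] := cE u cu; have [_ Bu] := (dE u).1 cu.
have := open_nbhs_nbhs (conj oO Ou) => /nbhs_ballP[e /= e0 eO].
pose A : set (circle R) := circle_pi @` ball (angle u) e.
pose B : set (sphere R n) := [set x | 0 < (-1) ^+ b * spt x 0 i /\ ball (rsubmx u) e (spt x *m (hemi_La i)^T)].
have oA : open A by apply: circle_pi_open; exact: ball_open.
have oB : open B.
  have cx : continuous (fun x : sphere R n => spt x 0 i).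
    move=> x; apply: (@continuous_comp _ _ _ spt (fun v : 'rV[R]_n => v 0 i)).
      exact: spt_continuous.
    exact: coord_continuous.
  have cp : continuous (fun x : sphere R n => spt x *m (hemi_La i)^T).
    move=> x; apply: (@continuous_comp _ _ _ spt (fun v : 'rV[R]_n => v *m (hemi_La i)^T)).
      exact: spt_continuous.
    apply: differentiable_continuous.
    exact: Cn_diff (Cn_mulmxr _ openT (Cn_id 0 openT)) _.
  have -> : B = (fun x : sphere R n => (-1) ^+ b * spt x 0 i) @^-1` [set t | 0 < t] `&`
      (fun x : sphere R n => spt x *m (hemi_La i)^T) @^-1` ball (rsubmx u) e by [].
  apply: openI; last by move/continuousP : cp => cp; apply: cp; exact: ball_open.
  apply: (@open_comp _ _ (fun x : sphere R n => (-1) ^+ b * spt x 0 i) [set t | 0 < t]).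
    move=> x _; apply: (@continuous_comp _ _ _ (fun x : sphere R n => spt x 0 i) (fun t => (-1) ^+ b * t)).
      exact: cx.
    exact: mulrl_continuous.
  exact: open_gt.
have nA : nbhs (c u).1 A.
  by apply: open_nbhs_nbhs; split=> //; rewrite E1; exists (angle u) => //; exact: ballxx.
have nB : nbhs (c u).2 B.
  apply: open_nbhs_nbhs; split=> //; rewrite /B /= E2 hemi_coord hemi_left_inverse.
  by split; [exact: height_gt0|exact: ballxx].
rewrite /interior /=; exists (A, B); first by [].
move=> [z x] /= [[t te <-] [xi xe]].
pose u' : 'rV[R]_(1 + n.-1) := row_mx t%:M (spt x *m (hemi_La i)^T).
have Ou' : O u'.
  apply: eO; split=> // j k; rewrite ord1 -[u]hsubmxK /u'.
  case: (split_ordP k) => k' ->.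
    by rewrite !row_mxEl ord1 [X in ball X]/(angle u) [in X in ball _ _ X]mxE eqxx mulr1n; exact: te.
  by rewrite !row_mxEr; case: xe => _; apply.
have [E1' E2'] := cE u' (Oc _ Ou').
have [_ xE] := hemi_coords (dot_spt x) xi.
exists u' => //; rewrite [c u']surjective_pairing E1'; congr (_, _).
  by rewrite /angle /u' row_mxKl mxE eqxx mulr1n.
by apply: spt_inj; rewrite E2' /u' row_mxKr xE.
Qed.

(** The angle changes by a multiple of 2 pi, and the sphere coordinates are a linear projection of a
    cap. The overlap [W] need not be connected and the multiple may vary on it, so smoothness is
    established near each point separately. *)
Lemma transition_smooth c1 c2 (tau : 'rV[R]_(1 + n.-1) -> 'rV[R]_(1 + n.-1)) :
  domainF_atlas R n c1 -> domainF_atlas R n c2 ->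
  let W := [set u | dom c1 u /\ (c2 @` dom c2) (c1 u)] in
  (forall u, W u -> dom c2 (tau u) /\ c2 (tau u) = c1 u) -> smooth_on W tau.
Proof.
move=> A1 A2 W tauW.
have [a1 [i1 [b1 [d1 E1]]]] := chart_dataP A1.
have [a2 [i2 [b2 [d2 E2]]]] := chart_dataP A2.
have o1 := chart_open A1.
have oW : open W.
  have o2 : open (c2 @` dom c2) by apply: chart_open_map => //; exact: chart_open.
  have cc := chart_continuous A1; rewrite continuous_open_subspace // in cc.
  exact: (continuous_inP c1 o1).1 cc _ o2.
move=> vs u0 W0.
have [du0 cu0] := tauW u0 W0; have [d1u0 _] := W0.
have [at0 _] := (d2 _).1 du0.
have [k kE] : exists k : int, angle (tau u0) = angle u0 + k%:~R * (2 * pi).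
  apply/circle_eqP/circle_piP; have [<- _] := E2 _ du0; have [<- _] := E1 _ d1u0.
  by rewrite cu0.
(* On this neighbourhood of [u0] the number [k] of turns is constant: adding [k] turns lands in the
   target arc, where the angle is unique by [arc_injective]. *)
pose O := W `&` (fun u => angle u + k%:~R * (2 * pi)) @^-1` [set t | a2 < t < a2 + 2 * pi].
have oO : open O.
  apply: openI => //.
  have -> : (fun u => angle u + k%:~R * (2 * pi)) @^-1` [set t | a2 < t < a2 + 2 * pi] =
    (fun u : 'rV[R]_(1 + n.-1) => angle u + k%:~R * (2 * pi)) @^-1` [set t | a2 < t] `&`
    (fun u : 'rV[R]_(1 + n.-1) => angle u + k%:~R * (2 * pi)) @^-1` [set t | t < a2 + 2 * pi].
    by apply/seteqP; split => u /=; [move=> /andP[]|move=> [-> ->]].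
  have ck : continuous (fun u : 'rV[R]_(1 + n.-1) => angle u + k%:~R * (2 * pi)).
    move=> u; apply: (@continuous_comp _ _ _ angle (fun t : R => t + k%:~R * (2 * pi))).
      exact: angle_continuous.
    by apply: cvgD; [exact: cvg_id|exact: cvg_cst].
  by move/continuousP : ck => ck; apply: openI; apply: ck; [exact: open_gt|exact: open_lt].
pose g (u : 'rV[R]_(1 + n.-1)) : 'rV[R]_(1 + n.-1) :=
  (angle u + k%:~R * (2 * pi)) *: row_mx 1%:M 0 +
  cap (hemi_La i1) (hemi_ep i1 b1) (rsubmx u) *m ((hemi_La i2)^T *m row_mx 0 1%:M).
have tauE u : O u -> g u = tau u.
  move=> [Wu Ou]; have [du cu] := tauW u Wu; have [d1u _] := Wu.
  have [F1 F2] := E2 _ du; have [G1 G2] := E1 _ d1u; have [atu _] := (d2 _).1 du.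
  rewrite /g mulmxA mul_mx_row mulmx0 mulmx1 -[RHS]hsubmxK.
  rewrite scale_row_mx scaler0 add_row_mx addr0 add0r; congr row_mx.
    rewrite [RHS]mx11_scalar scale_scalar_mx mulr1; congr (_%:M).
    apply: (arc_injective Ou atu); apply/circle_piP.
    rewrite -/(angle (tau u)) -F1 cu G1; apply/circle_piP/circle_eqP.
    by exists k.
  by rewrite -G2 -cu F2 hemi_left_inverse.
have sg : smooth_on O g.
  apply/smooth_onP => l.
  have OB : O `<=` [set u : 'rV[R]_(1 + n.-1) | ball1 (rsubmx u)].
    by move=> u [[/d1[_ Bu] _] _].
  have C1 : Cn l O (fun u => cap (hemi_La i1) (hemi_ep i1 b1) (rsubmx u)).
    by apply: (Cn_sub OB); apply: Cn_rsubmx; [exact: open_ball1|exact: Cn_cap].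
  have C2 : Cn l O (fun u => (angle u + k%:~R * (2 * pi))).
    apply: (@Cn_ext _ _ _ _ _ ((fun u => u 0 (lshift n.-1 0)) \+ cst (k%:~R * (2 * pi)))) => //.
      by move=> u _; rewrite /angle mxE.
    by apply: CnD => //; [exact: Cn_coord|exact: Cn_cst].
  have C3 := CnZl oO C2 (Cn_cst l O (row_mx 1%:M 0 : 'rV[R]_(1 + n.-1))).
  exact: CnD oO C3 (Cn_mulmxr _ oO C1).
have st : smooth_on O tau.
  by apply/smooth_onP => l; apply: Cn_ext oO tauE ((smooth_onP O g).1 sg l).
apply: st; split=> //=.
by rewrite -kE.
Qed.

End Manifold.

(** Hausdorffness and second countability are pulled back from Euclidean space through the embedding
    F. *)
Lemma domainF_manifold {R : realType} (n l0 l1 : nat) : (3 <= n)%N -> admissible R n l0 l1 ->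
  closed_connected_manifold (domainF_atlas R n).
Proof.
move=> hn adm; split; [|exact: domainF_compact|exact: domainF_connected].
pose L : 'M[R]_((1 + n) + (1 + n)) := 1%:M.
have LL : L *m L^T = 1%:M by rewrite trmx1 mulmx1.
have [_ inj_G cG emb_G] := embedding_F_mulmx hn adm LL.
split.
- split; first exact: injective_hausdorff cG inj_G rV_hausdorff.
  exact: second_countable_of_row cG inj_G emb_G.
- move=> c Ac; split; [exact: chart_open|exact: chart_injective|exact: chart_continuous|].
  by move=> O oO Oc; exact: chart_open_map.
- exact: domainF_cover.
exact: transition_smooth.
Qed.

(** * Linear isometries of spheres *)

Lemma sphere_chartP {R : realType} {k : nat} c : sphere_atlas R k c ->
  dom c = ball1 /\ exists i b, forall u, ball1 u -> spt (c u) = cap (hemi_La i) (hemi_ep i b) u.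
Proof.
move=> [dc [i [b cE]]]; split=> //; exists i, b => u Bu.
by rewrite -hemisphereE cE // dc.
Qed.

Section LinearSphereMap.
Context {R : realType} {k N : nat} (M : 'M[R]_(k, N)) (f : sphere R k -> 'rV[R]_N).
Hypothesis MM : M *m M^T = 1%:M.
Hypothesis fE : forall x, f x = spt x *m M.

Lemma linear_sphere_chart c : sphere_atlas R k c -> dom c = ball1 /\
  exists La ep, [/\ La *m La^T = 1%:M, ep *m La^T = 0, dot ep ep = 1,
    forall u, ball1 u -> cap La ep u = (spt \o c) u &
    forall u, ball1 u -> cap La ep u *m M = (f \o c) u].
Proof.
move=> /sphere_chartP [dc [i [b cE]]]; split=> //.
exists (hemi_La i), (hemi_ep i b); split; [exact: hemi_LaLa|exact: hemi_epLa|exact: dot_hemi_ep| |].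
  by move=> u Bu; rewrite /= cE.
by move=> u Bu; rewrite /= fE cE.
Qed.

Let oB := @open_ball1 R k.-1.

Let Cn_capM (La : 'M[R]_(k.-1, k)) (ep : 'rV[R]_k) l : Cn l ball1 (fun u => cap La ep u *m M).
Proof. by apply: Cn_mulmxr; [exact: oB|exact: Cn_cap]. Qed.

Let is_derive_capM (La : 'M[R]_(k.-1, k)) (ep : 'rV[R]_k) u X : ball1 u ->
  is_derive u X (fun u => cap La ep u *m M) ('D_X (cap La ep) u *m M).
Proof. by move=> Bu; apply: is_derive_mulmxr; exact: Cn_derive (Cn_cap La ep 0) Bu. Qed.

Let dot_derive_capM (La : 'M[R]_(k.-1, k)) (ep : 'rV[R]_k) u X Y : ball1 u ->
  dot ('D_X (fun u => cap La ep u *m M) u) ('D_Y (fun u => cap La ep u *m M) u) =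
  dot ('D_X (cap La ep) u) ('D_Y (cap La ep) u).
Proof.
move=> Bu; have [_ E1] := is_derive_capM La ep X Bu; have [_ E2] := is_derive_capM La ep Y Bu.
exact: etrans (congr2 dot E1 E2) (dot_mulmx_id _ _ MM).
Qed.

Lemma linear_riemannian_map : riemannian_map f.
Proof.
split.
  move=> c Ac; have [dc [La [ep [LL Le ee cE fcE]]]] := linear_sphere_chart Ac.
  by rewrite dc; apply/smooth_onP => l; apply: Cn_ext oB fcE (Cn_capM La ep l).
move=> c u Ac; have [dc [La [ep [LL Le ee cE fcE]]]] := linear_sphere_chart Ac.
rewrite dc => Bu.
have d1 := Cn_diff (Cn_capM La ep 0) Bu; have d2 := Cn_diff (Cn_cap La ep 0) Bu.
rewrite -(gram_ext oB fcE Bu d1) -(gram_ext oB cE Bu d2).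
apply/matrixP => i j; rewrite (gramE i j d1) (gramE i j d2).
exact: dot_derive_capM.
Qed.

(** The equation D_X D_Y phi = g(X, Y) (D_u phi - phi) of a cap is preserved by linear maps, so the
    second derivatives stay in the tangent cone. *)
Lemma linear_totally_geodesic c u X Y : sphere_atlas R k c -> dom c u ->
  second_ff (f \o c) u X Y = 0.
Proof.
move=> Ac; have [dc [La [ep [LL Le ee cE fcE]]]] := linear_sphere_chart Ac.
rewrite dc => Bu.
have d1 := Cn_diff (Cn_capM La ep 0) Bu; have d2 := Cn_diff (Cn_cap La ep 0) Bu.
rewrite -(second_ff_ext oB fcE Bu d1) /second_ff.
set phi := fun u => cap La ep u *m M.
have E : 'D_X ('D_Y phi) u = - cap_metric u X Y *: (phi u - 'D_u phi u).
  have H v : ball1 v -> 'D_Y (cap La ep) v *m M = 'D_Y phi v.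
    by move=> Bv; have [_ ->] := is_derive_capM La ep Y Bv.
  have H2 := is_derive_mulmxr M (is_derive2_cap La ep X Y Bu).
  have [_ H3] := is_derive_ext oB H Bu H2.
  have [_ H4] := is_derive_capM La ep u Bu.
  apply: etrans H3 _; rewrite [in RHS]H4 /phi -mulmxBl cap_sub_derive // -!scalemxAl scalerA.
  by congr (_ *: _); rewrite mulNr.
rewrite E -[_ *: _ in LHS]add0r normal_projE ?mul0mx //.
apply: scalemx_sub; apply: addmx_sub; first exact: tangent_cone_point.
by rewrite -scaleN1r scalemx_sub // tangent_cone_derive.
Qed.

Lemma linear_immersion : immersion (sphere_atlas R k) f.
Proof.
split; first by case: linear_riemannian_map.
move=> c u Ac; have [dc [La [ep [LL Le ee cE fcE]]]] := linear_sphere_chart Ac.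
rewrite dc => Bu; have d1 := Cn_diff (Cn_capM La ep 0) Bu.
rewrite -(jacobian_ext oB fcE Bu d1).
have [e e1] := cap_frame LL Le ee Bu.
apply: (@tangent_frame_row_free _ _ _ _ _ e); apply: tangent_frameP => // i j.
rewrite -e1 -(dot_derive_cap LL Le ee _ _ Bu).
exact: dot_derive_capM.
Qed.

Lemma linear_embedding : embedding (sphere_atlas R k) f.
Proof.
have cf : continuous f.
  have -> : f = (fun v => v *m M) \o spt by apply/funext => x; rewrite fE.
  move=> x; apply: continuous_comp; first exact: spt_continuous.
  exact/differentiable_continuous/(Cn_diff (Cn_mulmxr M openT (Cn_id 0 openT))).
have inj_f : injective f.
  move=> x y; rewrite !fE => /(congr1 (fun v => v *m M^T)).
  by rewrite -!mulmxA MM !mulmx1 => /spt_inj.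
split; [exact: linear_immersion|exact: inj_f|exact: cf|].
by apply: compact_open_image; [exact: cf|exact: inj_f|exact: rV_hausdorff|exact: sphere_compact].
Qed.

Lemma linear_unit x : dot (f x) (f x) = 1.
Proof. by rewrite fE dot_mulmx_id // dot_spt. Qed.

End LinearSphereMap.

Lemma totally_geodesic_ex {R : realType} {k N : nat} : (k <= N)%N ->
  exists iota : 'rV[R]_k -> 'rV[R]_N, totally_geodesic_inclusion iota.
Proof.
move=> kN; have [L LL _] : exists2 L : 'M[R]_(k, N), L *m L^T = 1%:M & (L <= (1%:M : 'M[R]_N))%MS.
  by apply: orthonormal_rows; rewrite mxrank1.
pose f (x : sphere R k) := spt x *m L; have fE x : f x = spt x *m L by [].
exists (fun v => v *m L); split.
- exact: (linear_unit LL fE).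
- exact: (linear_embedding LL fE).
- exact: (linear_riemannian_map LL fE).
exact: (linear_totally_geodesic fE).
Qed.

(** * Homogeneity *)

Lemma rotmx_add {R : realType} {p N : nat} (A B : 'M[R]_(p, N)) t t' :
  rotmx (rotmx A B t) (rotmx B (- A) t) t' = rotmx A B (t' + t).
Proof.
rewrite /rotmx !scalerDr !scalerA !scalerN cosD sinD.
by apply/matrixP => i j; rewrite !mxE; ring.
Qed.

Lemma mulmx_rotmx {R : realType} {p p' N : nat} (C : 'M[R]_(p', p)) (A B : 'M[R]_(p, N)) t :
  rotmx (C *m A) (C *m B) t = C *m rotmx A B t.
Proof. by rewrite /rotmx mulmxDr -!scalemxAr. Qed.

Lemma orthogonal_transitive {R : realType} {n : nat} (x y : sphere R n) :
  exists2 A : 'M[R]_n, A *m A^T = 1%:M & spt x *m A = spt y.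
Proof.
have [xy|xy] := eqVneq (spt x) (spt y).
  by exists 1%:M; rewrite ?trmx1 ?mulmx1.
pose w := spt x - spt y; pose d := dot w w.
have dn : d != 0 by rewrite dot_eq0 subr_eq0.
have dE : d = 2 - 2 * dot (spt x) (spt y).
  by rewrite /d /w !(dotBl, dotBr) !dot_spt (dotC (spt y)); ring.
(* The reflection in the hyperplane orthogonal to x - y. *)
pose A : 'M[R]_n := 1%:M - (2 / d) *: (w^T *m w).
have At : A^T = A.
  by rewrite /A linearB /= linearZ /= trmx1 trmx_mul trmxK.
have ww : w *m w^T = d%:M by rewrite [LHS]mx11_scalar.
exists A; last first.
  rewrite /A mulmxBr mulmx1 -scalemxAr mulmxA.
  have -> : spt x *m w^T = (d / 2)%:M.
    by rewrite [LHS]mx11_scalar -/(dot _ _) /w dotBr dot_spt dE; congr (_%:M); field.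
  rewrite mul_scalar_mx scalerA.
  have -> : 2 / d * (d / 2) = 1 by field.
  by rewrite scale1r /w opprB addrCA subrr addr0.
rewrite At.
have WW : w^T *m w *m (w^T *m w) = d *: (w^T *m w).
  by rewrite mulmxA -(mulmxA w^T) ww mul_mx_scalar -scalemxAl.
rewrite /A; move: (w^T *m w) WW => W WW.
rewrite mulmxBl mul1mx mulmxBr mulmx1 -scalemxAl -scalemxAr WW !scalerA.
have -> : 2 / d * (2 / d) * d = 2 / d + 2 / d by field.
by rewrite scalerDl opprB addrK subrK.
Qed.

Lemma orthoframe_col {R : realType} {n N : nat} (a b : 'rV[R]_N) (A B : 'M[R]_(n, N)) :
  orthoframe a b A B ->
  col_mx (col_mx a A) (col_mx b B) *m (col_mx (col_mx a A) (col_mx b B))^T = 1%:M.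
Proof.
move=> [aa bb ab AA BB AB aA aB bA bB].
rewrite !tr_col_mx !mul_col_row aa bb ab AA BB AB aA aB bA bB.
rewrite (mulmx_tr0 ab) (mulmx_tr0 AB) (mulmx_tr0 aA) (mulmx_tr0 aB) (mulmx_tr0 bA) (mulmx_tr0 bB).
rewrite !scalar_mx_block /block_mx !row_mx0 !col_mx0.
by congr col_mx; congr row_mx.
Qed.

Lemma orthoframe_mull {R : realType} {n N : nat} (a b : 'rV[R]_N) (A B : 'M[R]_(n, N)) (C : 'M[R]_n) :
  C *m C^T = 1%:M -> orthoframe a b A B -> orthoframe a b (C *m A) (C *m B).
Proof.
move=> CC [aa bb ab AA BB AB aA aB bA bB]; split=> //.
- by rewrite trmx_mul -mulmxA (mulmxA A) AA mul1mx.
- by rewrite trmx_mul -mulmxA (mulmxA B) BB mul1mx.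
- by rewrite trmx_mul -mulmxA (mulmxA A) AB mul0mx mulmx0.
- by rewrite trmx_mul mulmxA aA mul0mx.
- by rewrite trmx_mul mulmxA aB mul0mx.
- by rewrite trmx_mul mulmxA bA mul0mx.
- by rewrite trmx_mul mulmxA bB mul0mx.
Qed.

Section BlocksCol.
Context {R : realType} {n N : nat} (a b : 'rV[R]_N) (A B : 'M[R]_(n, N)).

Lemma blk_a_col : blk_a (col_mx (col_mx a A) (col_mx b B)) = a.
Proof. by rewrite /blk_a !col_mxKu. Qed.

Lemma blk_A_col : blk_A (col_mx (col_mx a A) (col_mx b B)) = A.
Proof. by rewrite /blk_A col_mxKu col_mxKd. Qed.

Lemma blk_b_col : blk_b (col_mx (col_mx a A) (col_mx b B)) = b.
Proof. by rewrite /blk_b col_mxKd col_mxKu. Qed.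

Lemma blk_B_col : blk_B (col_mx (col_mx a A) (col_mx b B)) = B.
Proof. by rewrite /blk_B !col_mxKd. Qed.

End BlocksCol.

(** [W] is the real form of diag(exp(i l0 t), exp(i l1 t) C). Its blocks are the rotated blocks of
    the identity, so [F_torus] for [W] adds the angles by [rotmx_add], and [C] moves the point of
    the sphere. *)
Lemma F_rotate {R : realType} {n l0 l1 : nat} (t : R) (C : 'M[R]_n) : C *m C^T = 1%:M ->
  exists2 W : 'M[R]_((1 + n) + (1 + n)), W *m W^T = 1%:M &
    forall t' (x x' : sphere R n), spt x' = spt x *m C ->
      F l0 l1 (circle_pi t', x) *m W = F l0 l1 (circle_pi (t' + t), x').
Proof.
move=> CC; pose I : 'M[R]_((1 + n) + (1 + n)) := 1%:M.
have II : I *m I^T = 1%:M by rewrite trmx1 mulmx1.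
have fI := orthoframe_mull CC (orthoframe_rot (l0%:R * t) (l1%:R * t) (blk_orthoframe II)).
have FI z : F l0 l1 z *m I = F l0 l1 z :> 'rV[R]_((1 + n) + (1 + n)) by rewrite mulmx1.
clearbody I.
exists (col_mx (col_mx (rotmx (blk_a I) (blk_b I) (l0%:R * t)) (C *m rotmx (blk_A I) (blk_B I) (l1%:R * t)))
  (col_mx (rotmx (blk_b I) (- blk_a I) (l0%:R * t)) (C *m rotmx (blk_B I) (- blk_A I) (l1%:R * t)))).
  exact: orthoframe_col.
move=> t' x x' xE; apply: etrans (F_torus _ l0 l1 t' x) _; rewrite -[RHS]FI (F_torus I l0 l1 (t' + t) x') xE.
rewrite blk_a_col blk_A_col blk_b_col blk_B_col.
by rewrite mulmx_rotmx !rotmx_add -!mulrDr mulmxA.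
Qed.

(* O is the identity on the orthogonal of the row space of L. *)
Lemma orthogonal_extension {R : realType} {p N : nat} (L : 'M[R]_(p, N)) (W : 'M[R]_p) :
  L *m L^T = 1%:M -> W *m W^T = 1%:M ->
  exists2 O : 'M[R]_N, O *m O^T = 1%:M & L *m O = W *m L.
Proof.
move=> LL WW; pose P := L^T *m L; exists (1%:M - P + L^T *m W *m L).
  have LP : (1%:M - P) *m L^T = 0 by rewrite mulmxBl mul1mx -mulmxA LL mulmx1 subrr.
  have PL : L *m (1%:M - P) = 0 by rewrite mulmxBr mulmx1 mulmxA LL mul1mx subrr.
  have Pt : (1%:M - P)^T = 1%:M - P by rewrite linearB /= trmx1 trmx_mul trmxK.
  have ZZ : (1%:M - P) *m (1%:M - P) = 1%:M - P.
    by rewrite [in LHS]mulmxBr mulmx1 /P [_ *m (L^T *m L)]mulmxA -/P LP mul0mx subr0.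
  rewrite -[RHS](subrK P) {2}/P.
  move: (1%:M - P) LP PL Pt ZZ => Z LP PL Pt ZZ.
  rewrite linearD /= Pt !trmx_mul trmxK mulmxDl !mulmxDr ZZ.
  rewrite -[L^T *m W *m L *m Z]mulmxA PL mulmx0 [Z *m (L^T *m _)]mulmxA LP mul0mx addr0 add0r.
  congr (_ + _); rewrite [L^T *m W *m L *m _]mulmxA -[_ *m L *m L^T]mulmxA LL mulmx1.
  by rewrite mulmxA -[_ *m W *m _]mulmxA WW mulmx1.
by rewrite mulmxDr mulmxBr mulmx1 !mulmxA LL !mul1mx subrr add0r.
Qed.

(* The group is that of all orthogonal transformations preserving the image. *)
Lemma homogeneous_transitive {R : realType} {N : nat} {M : Type} (G : M -> 'rV[R]_N) (z0 : M) :
  (forall z, dot (G z) (G z) = 1) ->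
  (forall z1 z2, exists2 O : 'M[R]_N, O *m O^T = 1%:M &
    [/\ G z1 *m O = G z2, forall z, exists z', G z *m O = G z' &
        forall z, exists z', G z' *m O = G z]) ->
  homogeneous G.
Proof.
move=> G1 sym.
pose S := [set g : sphere R N -> sphere R N | exists2 O : 'M[R]_N, O *m O^T = 1%:M &
  [/\ forall y, spt (g y) = spt y *m O, forall z, exists z', G z *m O = G z' &
      forall z, exists z', G z' *m O = G z]].
have act (O : 'M[R]_N) : O *m O^T = 1%:M -> exists g : sphere R N -> sphere R N, forall y, spt (g y) = spt y *m O.
  move=> OO; have ex (y : sphere R N) : exists y' : sphere R N, spt y' = spt y *m O.
    by apply: spt_ex; rewrite dot_mulmx_id // dot_spt.
  by have [g gE] := boolp.choice ex; exists g.
have Sinv g : S g -> exists g', [/\ S g', cancel g g' & cancel g' g].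
  move=> [ O OO [gO O1 O2]]; have OO' : O^T *m O = 1%:M by exact: mulmx1C.
  have OOt : O^T *m (O^T)^T = 1%:M by rewrite trmxK.
  have [g' gE] := act _ OOt; exists g'; split.
  - exists O^T => //; split=> // z.
      by have [z' <-] := O2 z; exists z'; rewrite -mulmxA OO mulmx1.
    by have [z' E] := O1 z; exists z'; rewrite -E -mulmxA OO mulmx1.
  - by move=> y; apply: spt_inj; rewrite gE gO -mulmxA OO mulmx1.
  by move=> y; apply: spt_inj; rewrite gO gE -mulmxA OO' mulmx1.
have [y yE] : exists y, spt y = G z0 by apply: spt_ex; exact: G1.
exists S, y; split.
  split.
  - move=> g Sg; have [g' [_ c1 c2]] := Sinv g Sg; split; first by exists g'.
    by move: Sg => [ O OO [gO _ _]]; exact: (linear_riemannian_map OO gO).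
  - exists 1%:M; first by rewrite trmx1 mulmx1.
    by split=> [v|z|z]; [rewrite mulmx1|exists z; rewrite mulmx1|exists z; rewrite mulmx1].
  - move=> g1 g2 [ O1 OO1 [gE1 a1 b1]] [ O2 OO2 [gE2 a2 b2]]; exists (O2 *m O1).
      by rewrite trmx_mul -mulmxA (mulmxA O1) OO1 mul1mx.
    split=> [v|z|z]; first by rewrite /= gE1 gE2 mulmxA.
      by have [z' E] := a2 z; have [z'' E'] := a1 z'; exists z''; rewrite mulmxA E.
    by have [z' E] := b1 z; have [z'' E'] := b2 z'; exists z''; rewrite mulmxA E'.
  - exact: Sinv.
apply/seteqP; split=> v /=.
  move=> [z _ <-]; have [ O OO [OE O1 O2]] := sym z0 z.
  by have [g gE] := act _ OO; exists g; [exists O|rewrite gE yE].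
by move=> [g [ O OO [gE O1 _]] <-]; have [z E] := O1 z0; exists z; rewrite // gE yE.
Qed.

Section Homogeneous.
Context {R : realType} (n l0 l1 : nat).
Hypothesis hn : (3 <= n)%N.
Hypothesis adm : admissible R n l0 l1.
Context {N : nat} (L : 'M[R]_((1 + n) + (1 + n), N)).
Hypothesis LL : L *m L^T = 1%:M.
Let G (z : domainF R n) : 'rV[R]_N := F l0 l1 z *m L.

(** The shift by the difference of the two angles, combined with an orthogonal [C] that moves one
    sphere point to the other. Preimages under it are found with the opposite shift and [C^T]. *)
Lemma orthogonal_symmetry (z1 z2 : domainF R n) : exists2 O : 'M[R]_N, O *m O^T = 1%:M &
  [/\ G z1 *m O = G z2, forall z, exists z', G z *m O = G z' &
      forall z, exists z', G z' *m O = G z].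
Proof.
have [C CC xC] := orthogonal_transitive z1.2 z2.2.
have [d dE] : exists d, circle_pi (circle_repr z1.1 + d) = z2.1.
  by exists (circle_repr z2.1 - circle_repr z1.1); rewrite subrKC circle_pi_repr.
have [W WW WE] := @F_rotate R n l0 l1 d C CC.
have [ O OO OE] := orthogonal_extension LL WW.
have GO t x x' : spt x' = spt x *m C -> G (circle_pi t, x) *m O = G (circle_pi (t + d), x').
  move=> /(WE t) E; apply: etrans _ (congr1 (fun v => v *m L) E).
  by rewrite -[RHS]mulmxA -OE mulmxA.
have piE (z : domainF R n) : z = (circle_pi (circle_repr z.1), z.2).
  by rewrite circle_pi_repr -surjective_pairing.
exists O => //; split.
- rewrite [in LHS](piE z1); apply: etrans (GO _ _ _ (esym xC)) _.
  by rewrite dE -surjective_pairing.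
- move=> z; have [x' xE] : exists x' : sphere R n, spt x' = spt z.2 *m C.
    by apply: spt_ex; rewrite dot_mulmx_id // dot_spt.
  by exists (circle_pi (circle_repr z.1 + d), x'); rewrite [in LHS](piE z); exact: GO.
move=> z; have CC' : C^T *m (C^T)^T = 1%:M by rewrite trmxK; exact: mulmx1C.
have [x' xE] : exists x' : sphere R n, spt x' = spt z.2 *m C^T.
  by apply: spt_ex; rewrite dot_mulmx_id // dot_spt.
exists (circle_pi (circle_repr z.1 - d), x').
rewrite [in RHS](piE z) -[in RHS](subrK d (circle_repr z.1)); apply: GO.
by rewrite xE -mulmxA -{2}[C]trmxK CC' mulmx1.
Qed.

Lemma homogeneous_F_mulmx : homogeneous G.
Proof.
have [z0] : exists z : domainF R n, True.
  have [x _] := @spt_delta_ex R n (Ordinal (ltnW (ltnW hn))).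
  by exists (circle_pi 0, x).
move=> _; exact: homogeneous_transitive z0 (dot_F_mulmx hn adm LL) orthogonal_symmetry.
Qed.

End Homogeneous.

(** * Linear fullness and the values of Q *)

Lemma linearly_full_F {R : realType} {n l0 l1 : nat} : (3 <= n)%N -> admissible R n l0 l1 ->
  linearly_full (@F R n l0 l1).
Proof.
move=> hn adm V FV; have r0 := radius_r_gt0 hn adm; have s0 := radius_s_gt0 hn adm.
have [l0_gt0 l1_gt0] : (0 < l0)%N /\ (0 < l1)%N by case: adm.
pose I : 'M[R]_((1 + n) + (1 + n)) := 1%:M.
have FI t (x : sphere R n) := etrans (esym (mulmx1 _)) (F_torus I l0 l1 t x).
have addV (u v w : 'rV[R]_((1 + n) + (1 + n))) (c : R) : c != 0 ->
    u \in V -> v \in V -> u + v = c *: w -> w \in V.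
  move=> c0 uV vV E; have : c *: w \in V by rewrite -E memvD.
  by move=> /(memvZ c^-1); rewrite scalerA mulVf // scale1r.
have opp (x : sphere R n) : exists x', spt x' = - spt x.
  by apply: spt_ex; rewrite dotNl dotNr opprK dot_spt.
have [e eE] : exists e : 'I_n -> sphere R n, forall i, spt (e i) = delta_mx 0 i.
  by have [e eE] := boolp.choice (@spt_delta_ex R n); exists e.
(* The sum and the difference of the values at [x] and at its antipode isolate the two components;
   the angles 0 and pi / 2 of each then give all four blocks. *)
have abV t : rotmx (blk_a I) (blk_b I) (l0%:R * t) \in V.
  have i0 : 'I_n by exact: (Ordinal (ltnW (ltnW hn))).
  have [x' xE] := opp (e i0).
  apply: (addV _ _ _ (2 * radius_r R n l0 l1) _ (FV (circle_pi t, e i0)) (FV (circle_pi t, x'))).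
    by rewrite mulf_neq0 ?pnatr_eq0 ?gt_eqF.
  rewrite !FI xE mulNmx scalerN addrACA subrr addr0 -scalerDl; congr (_ *: _); ring.
have ABV t i : row i (rotmx (blk_A I) (blk_B I) (l1%:R * t)) \in V.
  have [x' xE] := opp (e i).
  have NV : - F l0 l1 (circle_pi t, x') \in V by rewrite memvN.
  apply: (addV _ _ _ (2 * radius_s R n l0 l1) _ (FV (circle_pi t, e i)) NV).
    by rewrite mulf_neq0 ?pnatr_eq0 ?gt_eqF.
  rewrite !FI xE mulNmx scalerN opprD opprK addrACA subrr add0r -scalerDl eE -rowE.
  congr (_ *: _); ring.
have rot0 p (A B : 'M[R]_(p, (1 + n) + (1 + n))) : rotmx A B 0 = A.
  by rewrite /rotmx cos0 sin0 scale1r scale0r addr0.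
have rot1 p (A B : 'M[R]_(p, (1 + n) + (1 + n))) l : (0 < l)%N -> rotmx A B (l%:R * (pi / 2 / l%:R)) = B.
  move=> l_gt0; rewrite mulrC divfK ?pnatr_eq0 -?lt0n // /rotmx cos_pihalf sin_pihalf.
  by rewrite scale1r scale0r add0r.
have aV : blk_a I \in V by rewrite -[blk_a I](rot0 _ _ (blk_b I)) -(mulr0 l0%:R).
have bV : blk_b I \in V by rewrite -[blk_b I](rot1 _ (blk_a I) _ l0).
have AV i : row i (blk_A I) \in V by rewrite -[blk_A I](rot0 _ _ (blk_B I)) -(mulr0 l1%:R).
have BV i : row i (blk_B I) \in V by rewrite -[blk_B I](rot1 _ (blk_A I) _ l1).
have rowV p (A : 'M[R]_(p, (1 + n) + (1 + n))) (u : 'rV[R]_p) : (forall i, row i A \in V) -> u *m A \in V.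
  by move=> rA; rewrite mulmx_sum_row memv_suml // => i _; exact: memvZ.
have colV p p' (A : 'M[R]_(p, (1 + n) + (1 + n))) (B : 'M[R]_(p', (1 + n) + (1 + n))) :
    (forall i, row i A \in V) -> (forall i, row i B \in V) -> forall i, row i (col_mx A B) \in V.
  by move=> hA hB i; case: (split_ordP i) => k ->; rewrite ?rowKu ?rowKd.
have rV (w : 'rV[R]_((1 + n) + (1 + n))) : w \in V -> forall i, row i w \in V.
  by move=> wV i; congr (_ \in V): wV; apply/rowP => j; rewrite mxE ord1.
apply/vspaceP => v; rewrite memvf -(mulmx1 v) -/I (blkE I).
by apply: rowV; apply: (colV _ _ _ _ (colV _ _ _ _ _ _) (colV _ _ _ _ _ _)) => //; exact: rV.
Qed.

(** All values lie in the image of a linear map from dimension [k], too small by rank and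
    nullity. *)
Lemma not_linearly_full {R : realType} {M : Type} {k N : nat} (F : M -> 'rV[R]_k) (L : 'M[R]_(k, N)) :
  (k < N)%N -> ~ linearly_full (fun z => F z *m L).
Proof.
move=> kN full; pose f := linfun (mulmxr L : 'rV[R]_k -> 'rV[R]_N).
have fE : limg f = fullv by apply: full => z; rewrite -[_ *m L]/(mulmxr L _) -lfunE memv_img // memvf.
have := limg_ker_dim f fullv; rewrite fE !dimvf !dim_matrix => E.
have {}E : (\dim (fullv :&: lker f) + 1 * N = 1 * k)%N := E.
by move: E kN; rewrite !mul1n => <-; rewrite ltnNge leq_addl.
Qed.

(* Take l0 = 3^k, which is odd, and l1 = 1 mod 3, which is prime to it. *)
Lemma admissible_dense {R : realType} {n : nat} (u v : R) : 0 < u -> u < v -> v <= n%:R^-1 ->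
  exists l0 l1, admissible R n l0 l1 /\ u < rho R l0 l1 < v.
Proof.
move=> u0 uv vn; set a := Num.sqrt u; set b := Num.sqrt v.
have a0 : 0 < a by rewrite sqrtr_gt0.
have ab : a < b by rewrite ltr_sqrt // (lt_trans u0).
pose k := Num.bound (4 / (b - a)); pose l0 := (3 ^ k)%N.
have kl : 4 < l0%:R * (b - a).
  rewrite -ltr_pdivrMr ?subr_gt0 //; apply: (lt_trans (archi_boundP _)).
    by rewrite divr_ge0 // subr_ge0 ltW.
  by rewrite ltr_nat ltn_expl.
have l0_gt0 : 0 < l0%:R :> R by rewrite ltr0n expn_gt0.
have /andP[j1 j2] := @truncn_itv _ (l0%:R * a / 3) (divr_ge0 (mulr_ge0 (ltW l0_gt0) (ltW a0)) (ler0n _ 3)).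
(* By the choice of [j], 3 j <= l0 a < 3 j + 3. Adding 4 exceeds l0 a and has residue 1 modulo 3,
   and the result is at most l0 a + 4, which is below l0 b by [kl]. *)
set j := Num.trunc _ in j1 j2; pose l1 := (3 * j + 4)%N.
have l1E : l1%:R = 3 * j%:R + 4 :> R by rewrite natrD natrM.
have al : a < l1%:R / l0%:R.
  rewrite ltr_pdivlMr // l1E mulrC; move: j2; rewrite -(natr1 j); lra.
have lb : l1%:R / l0%:R < b.
  rewrite ltr_pdivrMr // l1E mulrC; move: j1 kl; lra.
have rE : rho R l0 l1 = (l1%:R / l0%:R) ^+ 2 by rewrite /rho expr_div_n.
have ur : u < rho R l0 l1.
  by rewrite rE -(sqr_sqrtr (ltW u0)) ltr_pXn2r // ?nnegrE ?(ltW a0) ?divr_ge0.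
have rv : rho R l0 l1 < v.
  have v0 : 0 <= v by rewrite ltW // (lt_trans u0).
  by rewrite rE -(sqr_sqrtr v0) ltr_pXn2r // ?nnegrE ?sqrtr_ge0 ?divr_ge0.
exists l0, l1; split; last by rewrite ur.
split.
- by rewrite expn_gt0 addn_gt0 orbT.
- by rewrite coprimeXl // prime_coprime // dvdn_addr // dvdn_mulr.
- by rewrite oddX orbT.
by rewrite (lt_trans u0 ur) (lt_le_trans rv).
Qed.

Section Values.
Context {R : realType} (n : nat).
Hypothesis hn : (3 <= n)%N.
Context {q N : nat} (L : 'M[R]_((1 + n) + (1 + n), N)).
Hypothesis LL : L *m L^T = 1%:M.
Hypothesis Nq : N = (n + q).+1.
Hypothesis nq : (n < q)%N.

(** The characteristic polynomial determines the ordered list of eigenvalues, so the list chosen in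
    [is_Q] is the one given by the constant spectrum. *)
Lemma is_QP l0 l1 p y : admissible R n l0 l1 ->
  is_Q q (domainF_atlas R n) (fun z => F l0 l1 z *m L) p y <-> y = n%:R + n%:R ^+ 2 * rho R l0 l1.
Proof.
move=> adm; have [[B0 fB0] spec] := constant_spectrum_F_mulmx hn adm LL Nq nq p; split.
  move=> [B [s' [fB [s'1 s'2] ->]]]; have [s [[s1 s2] _ _ <-]] := spec B fB.
  suff -> : s' = s by [].
  apply: (sorted_eq ge_trans ge_anti) => //.
  by apply: prod_XsubC_eq; rewrite -s'2 -s2.
by move=> ->; have [s [os _ _ <-]] := spec B0 fB0; exists B0, s.
Qed.

Lemma Q_values_dense : dense_in (Q_values q (fun l0 l1 z => F l0 l1 z *m L)) `]n%:R, 2 * n%:R[.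
Proof.
have n0 : 0 < n%:R :> R by rewrite ltr0n (leq_trans _ hn).
have n20 : 0 < n%:R ^+ 2 :> R by rewrite exprn_gt0.
have n2V : n%:R ^+ 2 * n%:R^-1 = n%:R :> R by rewrite expr2 mulfK // gt_eqF.
split=> y.
  move=> [l0 [l1 [adm [p /(is_QP _ _ adm) ->]]]]; rewrite /= in_itv /=.
  have /andP[r0 r1] : 0 < rho R l0 l1 < n%:R^-1 by case: adm.
  rewrite ltrDl mulr_gt0 //= mulr_natl mulr2n ltrD2l.
  by rewrite -[ltRHS]n2V ltr_pM2l.
rewrite /= in_itv /= => /andP[y1 y2] B /nbhs_ballP[e /= e0 eB].
pose u := (y - n%:R) / n%:R ^+ 2.
have u0 : 0 < u by rewrite divr_gt0 // subr_gt0.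
have uE : y = n%:R + n%:R ^+ 2 * u by rewrite mulrC divfK ?gt_eqF // subrKC.
(* The first bound keeps rho admissible; the second keeps Q within [e] of [y]. *)
pose v := Num.min n%:R^-1 (u + e / n%:R ^+ 2).
have uv : u < v.
  rewrite lt_min ltrDl divr_gt0 // andbT ltr_pdivrMr // mulrC n2V ltrBlDr.
  by move: y2; rewrite mulr_natl mulr2n.
have vn : v <= n%:R^-1 by rewrite ge_min lexx.
have [l0 [l1 [adm /andP[ur rv]]]] := admissible_dense u0 uv vn.
exists (n%:R + n%:R ^+ 2 * rho R l0 l1); split.
  exists l0, l1; split=> //.
  have [x _] := @spt_delta_ex R n (Ordinal (ltnW (ltnW hn))).
  by exists (circle_pi 0, x); apply/is_QP.
apply: eB; rewrite /ball /= uE opprD addrACA subrr add0r -mulrBr.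
have h1 : rho R l0 l1 - u < e / n%:R ^+ 2.
  by rewrite ltrBlDl; apply: (lt_le_trans rv); rewrite ge_min lexx orbT.
rewrite normrM gtr0_norm // distrC gtr0_norm ?subr_gt0 //.
by rewrite mulrC -ltr_pdivlMr.
Qed.

End Values.

Lemma minimal_embedding_F_mulmx {R : realType} {n l0 l1 N : nat} (L : 'M[R]_((1 + n) + (1 + n), N)) :
  (3 <= n)%N -> admissible R n l0 l1 -> L *m L^T = 1%:M ->
  minimal_embedding (domainF_atlas R n) (fun z => F l0 l1 z *m L).
Proof.
move=> hn adm LL; split; [exact: dot_F_mulmx|exact: embedding_F_mulmx|exact: minimal_F_mulmx].
Qed.

Theorem theorem1p1 (R : realType) (n : nat) (hn : (3 <= n)%N) :
  [/\ forall l0 l1 : nat, admissible R n l0 l1 ->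
        [/\ closed_connected_manifold (domainF_atlas R n),
            minimal_embedding (domainF_atlas R n) (@F R n l0 l1),
            homogeneous (@F R n l0 l1) &
            linearly_full (@F R n l0 l1)],
      forall l0 l1 : nat, admissible R n l0 l1 ->
        constant_spectrum n.+1 (domainF_atlas R n) (@F R n l0 l1)
          (n%:R * (1 - n%:R * rho R l0 l1)
             :: nseq n.-1 (2 * n%:R * rho R l0 l1) ++ [:: 0])
          (n%:R + n%:R * (n%:R - 2) * rho R l0 l1)
          (n%:R + n%:R ^+ 2 * rho R l0 l1),
      dense_in (Q_values n.+1 (@F R n)) (`]n%:R, 2 * n%:R[) /\
      homeomorphic (domainF R n) (sphere R 2 * sphere R n)%type &
      forall q : nat, (n.+1 < q)%N ->
        (exists iota : 'rV[R]_((1 + n) + (1 + n)) -> 'rV[R]_(n + q).+1,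
           totally_geodesic_inclusion iota) /\
        forall iota : 'rV[R]_((1 + n) + (1 + n)) -> 'rV[R]_(n + q).+1,
          totally_geodesic_inclusion iota ->
          [/\ forall l0 l1 : nat, admissible R n l0 l1 ->
                [/\ closed_connected_manifold (domainF_atlas R n),
                    minimal_embedding (domainF_atlas R n)
                      (iota \o @F R n l0 l1),
                    homogeneous (iota \o @F R n l0 l1) &
                    ~ linearly_full (iota \o @F R n l0 l1)],
              forall l0 l1 : nat, admissible R n l0 l1 ->
                constant_spectrum q (domainF_atlas R n)
                  (iota \o @F R n l0 l1)
                  (n%:R * (1 - n%:R * rho R l0 l1)
                     :: nseq n.-1 (2 * n%:R * rho R l0 l1)
                        ++ 0 :: nseq (q - n.+1) 0)
                  (n%:R + n%:R * (n%:R - 2) * rho R l0 l1)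
                  (n%:R + n%:R ^+ 2 * rho R l0 l1) &
              dense_in (Q_values q (fun l0 l1 => iota \o @F R n l0 l1))
                (`]n%:R, 2 * n%:R[) /\
              homeomorphic (domainF R n) (sphere R 2 * sphere R n)%type]].

Proof.
pose I : 'M[R]_((1 + n) + (1 + n)) := 1%:M.
have II : I *m I^T = 1%:M by rewrite trmx1 mulmx1.
have FI l0 l1 : @F R n l0 l1 = fun z => F l0 l1 z *m I.
  by apply/funext => z; rewrite mulmx1.
have nI : (1 + n + (1 + n) = (n + n.+1).+1)%N by [].
have nn : (n < n.+1)%N by [].
split.
- move=> l0 l1 adm; split; [exact: domainF_manifold hn adm| | |exact: linearly_full_F].
    by rewrite FI; exact: minimal_embedding_F_mulmx.
  by rewrite FI; exact: homogeneous_F_mulmx.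
- move=> l0 l1 adm; rewrite FI.
  by have := constant_spectrum_F_mulmx hn adm II nI nn; rewrite subSnn.
- split; last exact: domainF_homeo.
  have -> : @F R n = fun l0 l1 z => F l0 l1 z *m I by apply/funext => l0; apply/funext => l1.
  exact: Q_values_dense.
move=> q nq; have Nq : ((1 + n) + (1 + n) < (n + q).+1)%N.
  by rewrite nI ltnS ltn_add2l.
split; first by apply: totally_geodesic_ex; exact: ltnW.
move=> iota tg; have k1 : (1 < (1 + n) + (1 + n))%N.
  by rewrite nI ltnS addn_gt0 orbT.
have [L LL LE] := totally_geodesic_linear k1 tg.
(* [iota] is linear only on the unit sphere, so the equality needs the values of F to be unit
   vectors, which is known for admissible pairs. *)
have iotaF l0 l1 : admissible R n l0 l1 -> iota \o @F R n l0 l1 = fun z => F l0 l1 z *m L.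
  move=> adm; apply/funext => z; have := dot_F_mulmx hn adm II z; rewrite mulmx1 => /spt_ex[x xE].
  by rewrite /= -xE LE.
have nq' := ltnW nq; split.
- move=> l0 l1 adm; rewrite (iotaF l0 l1 adm); split; [exact: domainF_manifold hn adm| | |].
  + exact: minimal_embedding_F_mulmx.
  + exact: homogeneous_F_mulmx.
  + exact: not_linearly_full.
- move=> l0 l1 adm; rewrite (iotaF l0 l1 adm).
  by have := constant_spectrum_F_mulmx hn adm LL erefl nq'; rewrite -(subnSK nq').
split; last exact: domainF_homeo.
(* The two families are identified at admissible pairs only, so the sets of values are compared
   element by element. *)
have -> : Q_values q (fun l0 l1 => iota \o @F R n l0 l1) = Q_values q (fun l0 l1 z => F l0 l1 z *m L).
  apply/seteqP; split=> y [l0 [l1 [adm [p pQ]]]]; exists l0, l1; split=> //; exists p.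
    by rewrite -(iotaF l0 l1 adm).
  by rewrite (iotaF l0 l1 adm).
exact: Q_values_dense.
Qed.
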